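(* Let $K\ge 1$ and let $N_0,N_1,\dots,N_K$ be positive integers with $N_0=\min_{0\le k\le K}N_k$. For $q>0$ let $\tilde R_{(N_0,N_1,\dots,N_K)}(q)$ denote the ergodic capacity of the Rayleigh product channel with parameters $(N_0,N_1,\dots,N_K)$, and let $\tilde R_{(N_0,N_0,\dots,N_0)}(q)$ denote that of the Rayleigh product channel with the same number $K$ of factors, all of which are square of size $N_0\times N_0$. Then the high-SNR ergodic capacity increment $$\Delta\tilde R=\lim_{q\to\infty}\left(\tilde R_{(N_0,N_1,\dots,N_K)}(q)-\tilde R_{(N_0,N_0,\dots,N_0)}(q)\right)$$ is given by $$\Delta\tilde R=\sum_{k=1}^{K}\sum_{\ell=1}^{N_0}\psi(N_k-\ell+1)-\sum_{k=1}^{K}\sum_{\ell=1}^{N_0}\psi(N_0-\ell+1)=\sum_{k=1}^{K}\sum_{\ell=1}^{N_0}\sum_{s=N_0}^{N_k-1}\frac{1}{s-\ell+1}.$$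
   Context: Rayleigh product channel with parameters $(N_0,\dots,N_K)$: $H=Q_KQ_{K-1}\cdots Q_1$, an $N_K\times N_0$ random matrix, where $Q_1,\dots,Q_K$ are independent, $Q_k$ has size $N_k\times N_{k-1}$, and the entries of each $Q_k$ are i.i.d. circularly symmetric complex Gaussian with mean $0$ and variance $1$ (density $\pi^{-1}e^{-|z|^2}$ on $\mathbb{C}$). Its ergodic capacity at $q>0$ is $\tilde R(q)=\mathbb{E}\left[\ln\det\left(I+qH^\dagger H\right)\right]$, with $\dagger$ the conjugate transpose and $I$ an identity matrix of the appropriate size. $\psi$ is the digamma function, so $\psi(n)=-\gamma+\sum_{j=1}^{n-1}\frac1j$ for positive integers $n$, with $\gamma$ the Euler–Mascheroni constant. Empty sums are $0$. The existence of the limit is part of the assertion. *)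

(* Defs.v *)
From HB Require Import structures.
From mathcomp Require Import all_boot all_order all_algebra.
From mathcomp Require Import complex.
From mathcomp Require Import all_classical all_reals all_analysis.

Set Implicit Arguments.
Unset Strict Implicit.
Unset Printing Implicit Defensive.

Import Order.TTheory GRing.Theory Num.Theory.
Import numFieldNormedType.Exports.

Local Open Scope classical_set_scope.
Local Open Scope ring_scope.
Local Open Scope sesquilinear_scope.

Definition Gamma_fun {R : realType} (x : R) : R :=
  (\int[lebesgue_measure]_(t in `]0%R, +oo[) (t `^ (x - 1) * expR (- t)))%R.

Definition digamma {R : realType} (x : R) : R := derive1 Gamma_fun x / Gamma_fun x.

(* R[i] carries no measurable structure: a complex random variable is handled
   through its image in R * R, with the Borel (product) sigma-algebra. *)
Definition reim {R : realType} (z : R[i]) : R * R :=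
  (complex.Re z, complex.Im z).

Section complex_random_variables.
Context {R : realType} {d : measure_display} {T : measurableType d}.
Variable P : probability T R.

Definition complex_random_variable (Z : T -> R[i]) : Prop :=
  measurable_fun [set: T] (fun w => reim (Z w)).

(* Z has density pi^-1 * exp (- |z|^2) with respect to Lebesgue measure on C. *)
Definition std_complex_gaussian (Z : T -> R[i]) : Prop :=
  complex_random_variable Z /\
  forall A : set (R * R), measurable A ->
    P ((fun w => reim (Z w)) @^-1` A) =
    (\int[lebesgue_measure \x lebesgue_measure]_(z in A)
       (pi^-1 * expR (- (z.1 ^+ 2 + z.2 ^+ 2)))%:E)%E.

Definition mutually_independent (I : finType) (Z : I -> T -> R[i]) : Prop :=
  forall (J : {set I}) (A : I -> set (R * R)),
    (forall i, i \in J -> measurable (A i)) ->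
    P (\bigcap_(i in [set` J]) ((fun w => reim (Z i w)) @^-1` A i)) =
    (\prod_(i in J) P ((fun w => reim (Z i w)) @^-1` A i))%E.

End complex_random_variables.

Section rayleigh_product_channel.
Context {R : realType} {d : measure_display} {T : measurableType d}.
Variable P : probability T R.

(* Factors are numbered from 0: [Q k], of size N_(k+1) x N_k, is the factor
   usually written Q_(k+1). Only the factors with k < K matter. *)

Definition entry_index (K : nat) (N : nat -> nat) : finType :=
  {k : 'I_K & ('I_(N k.+1) * 'I_(N k))%type}.

Definition entry (K : nat) (N : nat -> nat)
    (Q : forall k : nat, T -> 'M[R[i]]_(N k.+1, N k))
    (e : entry_index K N) : T -> R[i] :=
  fun w => Q (tag e) w (tagged e).1 (tagged e).2.

Definition is_rayleigh_product_channel (K : nat) (N : nat -> nat)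
    (Q : forall k : nat, T -> 'M[R[i]]_(N k.+1, N k)) : Prop :=
  (forall e : entry_index K N, std_complex_gaussian P (entry Q e)) /\
  mutually_independent P (fun e : entry_index K N => entry Q e).

(* Q_K *m ... *m Q_1 *)
Fixpoint channel_matrix (N : nat -> nat)
    (Q : forall k : nat, T -> 'M[R[i]]_(N k.+1, N k)) (K : nat) (w : T) :
    'M[R[i]]_(N K, N 0%N) :=
  match K with
  | 0%N => 1%:M
  | k.+1 => Q k w *m channel_matrix Q k w
  end.

(* For q >= 0 the determinant is a real number >= 1, hence the use of its real part. *)
Definition ergodic_capacity (K : nat) (N : nat -> nat)
    (Q : forall k : nat, T -> 'M[R[i]]_(N k.+1, N k)) (q : R) : \bar R :=
  'E_P[fun w =>
    let H := channel_matrix Q K w in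
    ln (complex.Re (\det (1%:M + (real_complex R q) *: (H ^t* *m H))))]%E.

End rayleigh_product_channel.

(* Main.v *)
Require Import Defs.
From HB Require Import structures.
From mathcomp Require Import all_boot all_order all_algebra.
From mathcomp Require Import complex.
From mathcomp Require Import all_classical all_reals all_analysis.
From mathcomp Require Import measurable_realfun ring lra.

Set Implicit Arguments.
Unset Strict Implicit.
Unset Printing Implicit Defensive.

Import Order.TTheory GRing.Theory Num.Theory.
Import numFieldNormedType.Exports.

Local Open Scope classical_set_scope.
Local Open Scope ring_scope.

(** For [H] a channel matrix and [m = N_0], let [Y_t = det (t I + H^* H)], so that the
capacity at [q] is [m ln q + E ln Y_(1/q)]. It suffices to find the limit of [E ln Y_t] as
[t] tends to 0, and it is the derivative at 0 of [s |-> E Y_0^s], in two steps.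

The moments of [Y_0] are products of Gamma quotients. Conditionally on the other rows,
[det (S + (Q B)^* (Q B))] is an affine function of a Hermitian form in one Gaussian row of [Q];
the Laplace transform of that form, hence its fractional moments, depends only on [B^* B].
Replacing the rows one at a time, [B] may be taken square, and then the determinant splits
off [det (B^* B)] from that of an [N x m] Gaussian matrix. For the latter, adding one row
multiplies the Gram determinant by a form of Gamma law.

The exchange of limit and expectation needs no dominated convergence. As all eigenvalues of
[H^* H] are nonnegative, [Y_t <= Y_0 + t Y_1] for [t <= 1], so for small [s]
[E ln Y_t <= (E Y_t^s - 1) / s <= (E Y_0^s - 1) / s + t^s E Y_1^s / s];
conversely [(E Y_0^s - 1) / s <= (E Y_t^s - 1) / s <= E ln Y_t + O_t(s)]. *)

(** * The Gamma function *)

(** The obstacle is rectangular factors. If [B] is the product of the earlier factors and [Q] the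
    next one, [Q B] is not a product of square matrices when [B] is tall, and its Gram determinant
    does not split pointwise; only its moments do.

    Powers are used because [Y_0] may vanish at some points, where [ln] is 0 by convention, while a
    power with exponent [s > 0] vanishes there as it should. Powers are also nonnegative, so Tonelli
    and monotone convergence apply directly.

    A Laplace transform determines the moments of order [0 < s < 1] through [Gamma (1 - s) x^s =
    int_0^oo t^(-s) x expR (- t x) dt]: after taking expectations, the right-hand side involves only
    the derivative of the transform.

    Digammas appear because [digamma k] is the derivative at [s = 0] of [Gamma (k + s) / Gamma k],
    the moment of order [s] of the Gamma law of shape [k].

    The finite moment of [Y_1] used in the exchange comes from a polynomial bound in the moduli of
    the entries, taken to a small power. *)

Section gamma_integral.
Context {R : realType}.
Local Notation mu := (@lebesgue_measure R).

(** Lebesgue measure is [c] times its image under multiplication by [c]: the two agree on half-open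
    intervals, which determine it. *)
Lemma ge0_integral_scale (c : R) (f : R -> \bar R) : 0 < c ->
  measurable_fun setT f -> (forall x, (0 <= f x)%E) ->
  (\int[mu]_x f x = c%:E * \int[mu]_x f (c * x)%R)%E.
Proof.
move=> c0 mf f0.
have mc : measurable_fun setT ( *%R c : measurableTypeR R -> measurableTypeR R).
  exact: measurable_funM.
have E : forall A, measurable A -> mu A = mscale (NngNum (ltW c0)) (pushforward mu ( *%R c : _ -> measurableTypeR R)) A.
  move=> m; apply: lebesgue_measure_unique => _ [[a b]] _ <-.
  change (mu `]a, b] = c%:E * mu (( *%R c : R -> R) @^-1` `]a, b]))%E.
  have -> : ( *%R c : R -> R) @^-1` `]a, b] = `]a / c, b / c]%classic.
    by apply/seteqP; split => x /=; rewrite !in_itv/= ltr_pdivrMr// ler_pdivlMr// mulrC.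
  rewrite !lebesgue_measure_itv/= !lte_fin ltr_pM2r ?invr_gt0//.
  case: ifPn => _; last by rewrite mule0.
  by rewrite -!EFinD -EFinM -mulrBl mulrCA divff ?mulr1// gt_eqF.
rewrite [LHS](eq_measure_integral (mscale (NngNum (ltW c0)) (pushforward mu ( *%R c : _ -> measurableTypeR R)))); last first.
  by move=> A mA _; exact: E.
rewrite ge0_integral_mscale//=.
by rewrite ge0_integral_pushforward.
Qed.

(** The rate [c] is kept so that the Laplace transform of a Gamma density is again an integral of
    this kind. The value is extended real because finiteness for [p > 0] only comes with
    [gamma_integral_lty]. *)
Definition gamma_integral (p c : R) : \bar R :=
  (\int[mu]_(t in `]0%R, +oo[) (t `^ (p - 1) * expR (- (c * t)))%:E)%E.

Lemma measurable_gamma_integrand (p c : R) (D : set R) :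
  measurable_fun D (fun t : R => t `^ (p - 1) * expR (- (c * t))).
Proof.
apply: measurable_funTS; apply: measurable_funM; first exact: measurable_powR.
apply: measurableT_comp; first exact: measurable_expR.
apply: measurableT_comp; first by [].
exact: measurable_funM.
Qed.

Lemma gamma_integrand_ge0 (p c t : R) : 0 <= t `^ (p - 1) * expR (- (c * t)).
Proof. by rewrite mulr_ge0 ?powR_ge0 ?expR_ge0. Qed.

Lemma gamma_integral_ge0 p c : (0 <= gamma_integral p c)%E.
Proof. by apply: integral_ge0 => t _; rewrite lee_fin gamma_integrand_ge0. Qed.

Lemma gamma_integral_scale (p c : R) : 0 < c ->
  gamma_integral p c = ((c `^ (- p))%:E * gamma_integral p 1)%E.
Proof.
move=> c0; have ci0 : 0 < c^-1 by rewrite invr_gt0.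
rewrite /gamma_integral integral_mkcond (ge0_integral_scale ci0); last 2 first.
- apply/(measurable_restrictT _ _).1 => //.
  by apply/measurable_EFinP; exact: measurable_gamma_integrand.
- by move=> x; apply: erestrict_ge0 => t _; rewrite lee_fin gamma_integrand_ge0.
rewrite [in RHS]integral_mkcond -!ge0_integralZl//; last 6 first.
- apply: (@measurableT_comp _ _ _ (measurableTypeR R) (measurableTypeR R) _ _ _ (fun x => c^-1 * x)).
    apply/(measurable_restrictT _ _).1 => //.
    by apply/measurable_EFinP; exact: measurable_gamma_integrand.
  exact: measurable_funM.
- by move=> x _; apply: erestrict_ge0 => t _; rewrite lee_fin gamma_integrand_ge0.
- by rewrite lee_fin ltW.
- apply/(measurable_restrictT _ _).1 => //.
  by apply/measurable_EFinP; exact: measurable_gamma_integrand.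
- by move=> x _; apply: erestrict_ge0 => t _; rewrite lee_fin gamma_integrand_ge0.
- by rewrite lee_fin powR_ge0.
apply: eq_integral => x _; rewrite !patchE.
have -> : (c^-1 * x \in `]0, +oo[%classic) = (x \in `]0, +oo[%classic).
  apply/idP/idP => /set_mem/=; rewrite in_itv/= andbT => x0; apply/mem_set;
    by move: x0; rewrite /= in_itv/= andbT pmulr_rgt0.
case: ifPn => [/set_mem/=|_]; last by rewrite (_ : point = 0%E)// !mule0.
rewrite in_itv/= andbT => x0.
rewrite -!EFinM mul1r mulVKf ?gt_eqF// powRM ?(ltW ci0) ?(ltW x0)// 2!mulrA [in RHS]mulrA; congr (_ * _ * _)%:E.
rewrite -powR_inv1 ?(ltW c0)// -powRrM.
rewrite -powRD ?(gt_eqF c0) ?implybT//.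
by congr (_ `^ _); ring.
Qed.

(** Exhaust []0, 1]] by the intervals [[1 / (n + 2), 1]], on which the primitive [x^p / p] bounds
    the integral by [1 / p]; the shift by 2 keeps them nondegenerate. *)
Lemma integral_powR01_lty (p : R) : 0 < p ->
  (\int[mu]_(t in `]0%R, 1%R]) (t `^ (p - 1))%:E < +oo)%E.
Proof.
move=> p0.
pose F n := `[n.+2%:R^-1 : R, 1]%classic.
have FE : `]0, 1]%classic = \bigcup_n F n :> set R.
  apply/seteqP; split => x /=.
    rewrite in_itv/= => /andP[x0 x1].
    have [n _ Hn] : exists2 n : nat, True & x^-1 <= n.+2%:R.
      exists (Num.bound x^-1) => //; apply: ltW.
      have := archi_boundP (ltW (_ : 0 < x^-1)); rewrite invr_gt0 => /(_ x0) /lt_trans; apply.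
      by rewrite ltr_nat.
    exists n => //; rewrite /F /= in_itv/= x1 andbT.
    by rewrite -[leRHS]invrK lef_pV2 ?posrE ?invr_gt0.
  case=> n _; rewrite /F/= !in_itv/= => /andP[nx ->]; rewrite andbT.
  exact: lt_le_trans nx.
have H : (\int[mu]_(t in F n) (t `^ (p - 1))%:E)%E @[n --> \oo] --> (\int[mu]_(t in `]0%R, 1%R]) (t `^ (p - 1))%:E)%E.
  rewrite FE; apply: ge0_nondecreasing_set_cvg_integral.
  - move=> m n mn; apply/subsetPset => x; rewrite /F/= !in_itv/= => /andP[mx ->].
    rewrite andbT; apply: le_trans mx; rewrite lef_pV2 ?posrE// ler_nat.
    by rewrite !ltnS.
  - by move=> i; rewrite /F.
  - move=> i; apply/measurable_EFinP/measurable_funTS; exact: measurable_powR.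
  - by move=> i x _; rewrite lee_fin powR_ge0.
suff : (\int[mu]_(t in `]0%R, 1%R]) (t `^ (p - 1))%:E <= (p^-1)%:E)%E.
  by move=> /le_lt_trans; apply; rewrite ltry.
move: (H) => /cvg_lim <-//; apply: lime_le.
  by apply/cvg_ex; eexists; exact: H.
apply: nearW => n; rewrite /F.
have n0 : (0 : R) < n.+2%:R^-1 by rewrite invr_gt0.
rewrite (@continuous_FTC2 _ _ (fun x => p^-1 * x `^ p)).
- rewrite powR1 mulr1 -EFinB lee_fin gerBl mulr_ge0// ?powR_ge0// invr_ge0 ltW//.
- by rewrite invf_lt1// ltr1n.
- apply: derivable_within_continuous => x; rewrite in_itv/= => /andP[nx _].
  by apply: derivable_powR; rewrite in_itv/= andbT (lt_le_trans n0).
- have D x : n.+2%:R^-1 <= x -> derivable (fun x0 => p^-1 * x0 `^ p) x 1.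
    move=> nx; apply: derivableM => //.
    by apply: derivable_powR; rewrite in_itv/= andbT (lt_le_trans n0).
  have cD x : n.+2%:R^-1 <= x -> {for x, continuous (fun x0 => p^-1 * x0 `^ p)}.
    by move=> nx; apply/differentiable_continuous/derivable1_diffP/D.
  split.
  + by move=> x; rewrite in_itv/= => /andP[nx _]; apply: D; exact: ltW.
  + by apply: cvg_at_right_filter; apply: cD.
  + by apply: cvg_at_left_filter; apply: cD; rewrite invf_le1// ler1n.
- move=> x; rewrite in_itv/= => /andP[nx _].
  have x0 : 0 < x by exact: lt_trans nx.
  rewrite derive1Ml; last by apply: derivable_powR; rewrite in_itv/= andbT.
  by rewrite powR_derive1 ?in_itv/= ?x0// mulrA mulVf ?mul1r// gt_eqF.
Qed.

(** The integrand is twice the exponential density of rate [1/2], the rate left in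
    [gamma_integral_lty] once half of the exponent has absorbed the power of [t]. *)
Lemma integral_expR_half_lty : (\int[mu]_(t in `]0%R, +oo[) (expR (- (2^-1 * t)))%:E < +oo)%E.
Proof.
have h0 : 0 < 2^-1 :> R by [].
apply: (@le_lt_trans _ _ (2%:E * \int[mu]_x (exponential_pdf (2^-1) x)%:E)%E); last first.
  by rewrite integral_exponential_pdf// mule1 ltry.
rewrite -ge0_integralZl//; last 2 first.
- by apply/measurable_EFinP; exact: measurable_exponential_pdf.
- by move=> x _; rewrite lee_fin exponential_pdf_ge0.
rewrite [leLHS]integral_mkcond; apply: ge0_le_integral => //.
- by move=> x _; apply: erestrict_ge0 => t _; rewrite lee_fin expR_ge0.
- apply/(measurable_restrictT _ _).1 => //; apply/measurable_EFinP/measurable_funTS.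
  apply: measurableT_comp; first exact: measurable_expR.
  by apply: measurableT_comp => //; exact: measurable_funM.
- by apply: emeasurable_funM => //; by apply/measurable_EFinP; exact: measurable_exponential_pdf.
- move=> x _; rewrite patchE; case: ifPn => [/set_mem/=|_].
    rewrite in_itv/= andbT => x0; rewrite -EFinM lee_fin exponential_pdfE ?(ltW x0)//.
    by rewrite mulrA divff// mul1r mulNr.
  by rewrite (_ : point = 0%E)// mule_ge0 ?lee_fin// exponential_pdf_ge0.
Qed.

Lemma gamma_integral_lty (p : R) : 0 < p -> (gamma_integral p 1 < +oo)%E.
Proof.
move=> p0; rewrite /gamma_integral.
have [n pn] : exists n : nat, p - 1 <= n.+1%:R.
  exists (Num.bound p); rewrite (le_trans (_ : _ <= p))//; first by rewrite gerBl.
  by apply: ltW; apply: lt_trans (archi_boundP (ltW p0)) _; rewrite ltr_nat.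
(* [(t / 2)^(n+1) / (n+1)!] is a term of the series of [expR (t / 2)], so
   [t^(n+1) <= C * expR (t / 2)], which controls [t > 1]. On []0, 1]] the power [t^(p-1)] alone
   dominates. *)
pose C : R := n.+1`!%:R * 2 ^+ n.+1.
pose g t : R := (t `^ (p - 1) * \1_(`]0, 1]) t) + C * expR (- (2^-1 * t)).
have C0 : 0 <= C by rewrite mulr_ge0// exprn_ge0.
have mp D : measurable_fun D (fun t : R => t `^ (p - 1) * \1_(`]0, 1]) t).
  by apply: measurable_funTS; apply: measurable_funM => //; exact: measurable_powR.
have me D : measurable_fun D (fun t : R => expR (- (2^-1 * t))).
  apply/measurable_funTS/measurableT_comp; first exact: measurable_expR.
  by apply: measurableT_comp => //; exact: measurable_funM.
apply: (@le_lt_trans _ _ (\int[mu]_(t in `]0%R, +oo[) (g t)%:E)%E).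
  apply: ge0_le_integral => //.
  - by move=> t _; rewrite lee_fin gamma_integrand_ge0.
  - by apply/measurable_EFinP; exact: measurable_gamma_integrand.
  - apply/measurable_EFinP; apply: measurable_funD; first exact: mp.
  by apply: measurable_funM; [exact: measurable_cst|exact: me].
  - move=> t /=; rewrite in_itv/= andbT => t0; rewrite lee_fin /g mul1r indicE.
    have [t1|t1] := leP t 1.
      rewrite mem_set/= ?in_itv/= ?t0// mulr1.
      rewrite (le_trans (_ : _ <= t `^ (p - 1)))//.
        by rewrite ler_piMr ?powR_ge0// expR_le1 oppr_le0 ltW.
      by rewrite lerDl mulr_ge0// expR_ge0.
    rewrite memNset/= ?in_itv/= ?t0//=; last by apply/negP; rewrite -ltNge.
    rewrite mulr0 add0r (_ : - t = - (2^-1 * t) + - (2^-1 * t)); last by field.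
    rewrite expRD mulrA ler_wpM2r ?expR_ge0// expRN ler_pdivrMr ?expR_gt0//.
    apply: le_trans (ler_powR (ltW t1) pn) _; rewrite powR_mulrn ?(ltW t0)//.
    have h0 : 0 <= 2^-1 * t by rewrite mulr_ge0// (ltW t0).
    have := expR_ge1Dxn n h0 => H.
    have {}H : (2^-1 * t) ^+ n.+1 / n.+1`!%:R <= expR (2^-1 * t) by apply: le_trans H; rewrite lerDr.
    apply: le_trans (ler_wpM2l C0 H).
    rewrite /C exprMn exprVn.
    have f0 : n.+1`!%:R != 0 :> R by rewrite pnatr_eq0 -lt0n fact_gt0.
    have e0 : (2 : R) ^+ n.+1 != 0 by rewrite expf_neq0.
    by rewrite le_eqVlt; apply/orP; left; apply/eqP; field; rewrite f0 e0.
rewrite /g; under eq_integral do rewrite EFinD EFinM.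
rewrite ge0_integralD//; last 4 first.
- by move=> x _; rewrite -EFinM lee_fin mulr_ge0 ?powR_ge0.
- apply: emeasurable_funM; apply/measurable_EFinP; last exact: measurable_indic.
  by apply: measurable_funTS; exact: measurable_powR.
- by move=> x _; rewrite lee_fin mulr_ge0 ?expR_ge0.
- apply/measurable_EFinP.
  by apply: measurable_funM; [exact: measurable_cst|exact: me].
rewrite lte_add_pinfty//.
  have -> : (\int[mu]_(x in `]0%R, +oo[) ((x `^ (p - 1))%:E * (\1_`]0, 1] x)%:E) =
      \int[mu]_(x in `]0%R, 1%R]) (x `^ (p - 1))%:E)%E.
    rewrite [RHS]integral_mkcond [LHS]integral_mkcond; apply: eq_integral => t _.
    rewrite !patchE indicE; have [/set_mem/=|_] := boolP (t \in `]0%R, 1%R]%classic).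
      by rewrite in_itv/= => /andP[t0 _]; rewrite mem_set/= ?in_itv/= ?t0// mule1.
    by rewrite mule0; case: ifP.
  exact: integral_powR01_lty.
under eq_integral do rewrite EFinM.
rewrite ge0_integralZl//.
- by rewrite lte_mul_pinfty// integral_expR_half_lty.
by apply/measurable_EFinP; exact: me.
Qed.

Lemma gamma_integral_gt0 (p : R) : 0 < p -> (0 < gamma_integral p 1)%E.
Proof.
move=> p0.
(* For [t] in [[1, 2]], [p > 0] gives [t^(p-1) >= 1/t >= 1/2], and [expR (- t) >= expR (- 2)]. *)
have m0 : 0 < 2^-1 * expR (- 2) :> R by rewrite mulr_gt0// expR_gt0.
apply: (@lt_le_trans _ _ (\int[mu]_(t in `[1%R, 2%R]) (2^-1 * expR (- 2))%:E)%E).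
  rewrite (integral_cst mu (measurable_itv `[1%R, 2%R]) (2^-1 * expR (- 2))%:E).
  rewrite [X in (_ * X)%E](_ : _ = 1%E) ?mule1 ?lte_fin//.
  have := @lebesgue_measure_itv R `[1%R, 2%R].
  by rewrite /= lte_fin ltr1n -EFinD (_ : 2 - 1 = 1 :> R)//; ring.
apply: (@le_trans _ _ (\int[mu]_(t in `[1%R, 2%R]) (t `^ (p - 1) * expR (- (1 * t)))%:E)%E).
  apply: ge0_le_integral => //.
  - by apply/measurable_EFinP; exact: measurable_gamma_integrand.
  - move=> t /=; rewrite in_itv/= => /andP[t1 t2]; rewrite lee_fin.
    apply: ler_pM; [by []|exact: expR_ge0| |].
      apply: (@le_trans _ _ (t `^ (-1))).
        rewrite powR_inv1; last exact: le_trans t1.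
        by rewrite lef_pV2 ?posrE// (lt_le_trans _ t1).
      by apply: ler_powR => //; lra.
    by rewrite ler_expR mul1r lerN2.
apply: ge0_subset_integral => //.
- by apply/measurable_EFinP; exact: measurable_gamma_integrand.
- by move=> t _; rewrite lee_fin gamma_integrand_ge0.
- move=> t /=; rewrite !in_itv/= => /andP[t1 _]; rewrite andbT.
  exact: lt_le_trans t1.
Qed.

Lemma Gamma_fun_EFin (p : R) : 0 < p -> (Gamma_fun p)%:E = gamma_integral p 1.
Proof.
move=> p0; rewrite /Gamma_fun /Rintegral fineK.
  by apply: eq_integral => t _; rewrite mul1r.
have -> : (\int[mu]_(t in `]0%R, +oo[) (t `^ (p - 1) * expR (- t))%:E)%E = gamma_integral p 1.
  by apply: eq_integral => t _; rewrite mul1r.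
by rewrite ge0_fin_numE ?gamma_integral_lty// gamma_integral_ge0.
Qed.

Lemma Gamma_fun_gt0 (p : R) : 0 < p -> 0 < Gamma_fun p.
Proof. by move=> p0; rewrite -lte_fin Gamma_fun_EFin// gamma_integral_gt0. Qed.

Lemma gamma_integralE (p c : R) : 0 < p -> 0 < c ->
  gamma_integral p c = (c `^ (- p) * Gamma_fun p)%:E.
Proof. by move=> p0 c0; rewrite gamma_integral_scale// EFinM Gamma_fun_EFin. Qed.

(** Convexity of the exponential: its tangent at [- (th * u)] lies below the graph at [- u] and at
    0, and the weights [th] and [1 - th] cancel the slope. *)
Lemma expRN_secant (th u : R) : 0 <= th <= 1 ->
  expR (- (th * u)) <= th * expR (- u) + (1 - th).
Proof.
move=> /andP[t0 t1].
have B0 := expR_gt0 (- (th * u)).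
have H1 : expR (- (th * u)) * (1 - (1 - th) * u) <= expR (- u).
  rewrite [X in _ <= expR X](_ : _ = - (th * u) + - ((1 - th) * u)); last by ring.
  by rewrite expRD ler_pM2l//; apply: le_trans (expR_ge1Dx _); rewrite lexx.
have H2 : expR (- (th * u)) * (1 + th * u) <= 1.
  rewrite -[leRHS]expR0 -(addNr (th * u)) expRD ler_pM2l//.
  exact: expR_ge1Dx.
have := ler_wpM2l t0 H1.
have t1' : 0 <= 1 - th by rewrite subr_ge0.
have := ler_wpM2l t1' H2.
set B := expR _; set A := expR _; nra.
Qed.

Lemma one_sub_expRN_le (v : R) : 1 - expR (- v) <= v.
Proof. by have := expR_ge1Dx (- v); lra. Qed.

Lemma one_sub_expRN_ge (v : R) : 0 <= v -> v - v ^+ 2 <= 1 - expR (- v).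
Proof.
move=> v0; have := expR_ge1Dx v => H.
have e1 : expR (- v) * expR v = 1 by rewrite -expRD addNr expR0.
have := expR_gt0 (- v); set a := expR (- v) in e1 *; set b := expR v in e1 H *.
by move=> a0; nra.
Qed.

Lemma cvg_laplace_quotient (x t : R) : 0 <= x ->
  n.+1%:R * (expR (- (t * x)) - expR (- ((t + n.+1%:R^-1) * x))) @[n --> \oo]
  --> x * expR (- (t * x)).
Proof.
move=> x0.
have E n : n.+1%:R * (expR (- (t * x)) - expR (- ((t + n.+1%:R^-1) * x))) =
   n.+1%:R * (1 - expR (- (n.+1%:R^-1 * x))) * expR (- (t * x)).
  by rewrite mulrDl opprD expRD; ring.
under eq_fun do rewrite E.
apply: cvgMr_tmp.
apply: (@squeeze_cvgr _ _ _ _ (fun n => x - x ^+ 2 * n.+1%:R^-1) (fun=> x)).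
- apply: nearW => n.
  have n0 : (0 : R) < n.+1%:R by [].
  have v0 : 0 <= n.+1%:R^-1 * x by rewrite mulr_ge0.
  apply/andP; split.
    have := ler_wpM2l (ltW n0) (one_sub_expRN_ge v0); apply: le_trans.
    by rewrite le_eqVlt; apply/orP; left; apply/eqP; field; rewrite gt_eqF.
  have := ler_wpM2l (ltW n0) (one_sub_expRN_le (n.+1%:R^-1 * x)) => /le_trans; apply.
  by rewrite mulVKf// gt_eqF.
- rewrite -[X in _ --> X]subr0; apply: cvgB; first exact: cvg_cst.
  rewrite -[X in _ --> X](mulr0 (x ^+ 2)); apply: cvgMl_tmp.
  exact: cvg_harmonic.
- exact: cvg_cst.
Qed.

(** By convexity, secant slopes steepen as the step shrinks. This monotonicity is what allows a
    Laplace transform to be differentiated by monotone convergence. *)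
Lemma laplace_quotient_homo (x t : R) : 0 <= x ->
  {homo (fun n => n.+1%:R * (expR (- (t * x)) - expR (- ((t + n.+1%:R^-1) * x))))
    : m n / (m <= n)%N >-> m <= n}.
Proof.
move=> x0 m n mn.
have E k : k.+1%:R * (expR (- (t * x)) - expR (- ((t + k.+1%:R^-1) * x))) =
   k.+1%:R * (1 - expR (- (k.+1%:R^-1 * x))) * expR (- (t * x)).
  by rewrite mulrDl opprD expRD; ring.
rewrite !E ler_wpM2r ?expR_ge0//.
have m0 : (0 : R) < m.+1%:R by [].
have n0 : (0 : R) < n.+1%:R by [].
have th01 : 0 <= (m.+1%:R / n.+1%:R : R) <= 1.
  by rewrite divr_ge0//= ler_pdivrMr// mul1r ler_nat.
have := expRN_secant (m.+1%:R^-1 * x) th01.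
rewrite (_ : _ / _ * (_ * _) = n.+1%:R^-1 * x); last by field; rewrite !gt_eqF.
set b := expR _; set a := expR _ => H.
have : n.+1%:R * b <= n.+1%:R * (m.+1%:R / n.+1%:R * a + (1 - m.+1%:R / n.+1%:R)).
  by rewrite ler_pM2l.
rewrite (_ : n.+1%:R * (_ + _) = m.+1%:R * a + n.+1%:R - m.+1%:R); last by field; rewrite gt_eqF.
lra.
Qed.

End gamma_integral.

(** * Fractional moments from Laplace transforms *)

Section laplace.
Context {R : realType} {d : measure_display} {T : measurableType d}.
Variables (m : {measure set T -> \bar R}) (D : set T).
Hypothesis mD : measurable D.
Variables (h X : T -> R).
Hypotheses (mh : measurable_fun D h) (mX : measurable_fun D X).
Hypotheses (h0 : forall x, D x -> 0 <= h x) (X0 : forall x, D x -> 0 <= X x).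

(** The weight [h] lets a law be given either by a probability, with [h = 1], or by a density with
    respect to Lebesgue measure. *)
Definition laplace (t : R) : \bar R := (\int[m]_(x in D) (h x * expR (- (t * X x)))%:E)%E.

Hypothesis laplace0 : (laplace 0 < +oo)%E.

Lemma measurable_laplace_integrand t : measurable_fun D (fun x => h x * expR (- (t * X x))).
Proof.
apply: measurable_funM => //; apply: measurableT_comp; first exact: measurable_expR.
by apply: measurableT_comp => //; exact: measurable_funM.
Qed.

Lemma laplace_ge0 t : (0 <= laplace t)%E.
Proof. by apply: integral_ge0 => x Dx; rewrite lee_fin mulr_ge0 ?h0 ?expR_ge0. Qed.

Lemma laplace_lty t : 0 <= t -> (laplace t < +oo)%E.
Proof.
move=> t0; apply: le_lt_trans laplace0; apply: ge0_le_integral => //.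
- by move=> x Dx; rewrite lee_fin mulr_ge0 ?h0 ?expR_ge0.
- by apply/measurable_EFinP; exact: measurable_laplace_integrand.
- by apply/measurable_EFinP; exact: measurable_laplace_integrand.
- move=> x Dx; rewrite lee_fin ler_wpM2l ?h0// ler_expR mul0r oppr0 oppr_le0.
  by rewrite mulr_ge0 ?X0.
Qed.

(** The limit is minus the right derivative of the transform at [t], taken under the integral by
    monotone convergence. It may be [+oo] at [t = 0]. *)
Lemma cvg_laplace_derive t : 0 <= t ->
  (n.+1%:R%:E * (laplace t - laplace (t + n.+1%:R^-1)%R))%E @[n --> \oo] -->
  (\int[m]_(x in D) (h x * X x * expR (- (t * X x)))%:E)%E.
Proof.
move=> t0.
pose g n x := (h x * (n.+1%:R * (expR (- (t * X x)) - expR (- ((t + n.+1%:R^-1) * X x)))))%:E.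
have mg n : measurable_fun D (g n).
  apply/measurable_EFinP; apply: measurable_funM => //; apply: measurable_funM => //.
  apply: measurable_funB; apply: measurableT_comp; (try exact: measurable_expR);
    by apply: measurableT_comp => //; exact: measurable_funM.
have g0 n x : D x -> (0 <= g n x)%E.
  move=> Dx; rewrite lee_fin mulr_ge0 ?h0// mulr_ge0// subr_ge0 ler_expR lerN2.
  by rewrite ler_wpM2r ?X0// lerDl invr_ge0.
have ndg x : D x -> {homo g^~ x : a b / (a <= b)%N >-> (a <= b)%E}.
  move=> Dx a b ab; rewrite lee_fin ler_wpM2l ?h0//.
  exact: (laplace_quotient_homo _ (X0 Dx)).
have := cvg_monotone_convergence (mu := m) mD mg g0 ndg.
rewrite (_ : (fun n => \int[m]_(x in D) g n x)%E = (fun n => (n.+1%:R%:E * (laplace t - laplace (t + n.+1%:R^-1)%R))%E)).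
  rewrite (_ : (\int[m]_(x in D) limn (g^~ x))%E = (\int[m]_(x in D) (h x * X x * expR (- (t * X x)))%:E)%E)//.
  apply: eq_integral => x /set_mem Dx; apply/cvg_lim => //.
  apply: cvg_EFin; first exact: nearW.
  rewrite (_ : fine \o _ = (fun n => h x * (n.+1%:R * (expR (- (t * X x)) - expR (- ((t + n.+1%:R^-1) * X x))))))//.
  rewrite -mulrA; apply: cvgMl_tmp.
  exact: (cvg_laplace_quotient (X0 Dx)).
apply/funext => n.
have n0 : (0 : R) < n.+1%:R by [].
have tn0 : 0 <= t + n.+1%:R^-1 by rewrite addr_ge0.
(* The difference of the two transforms is recovered by adding the second one to the integral of [e]
   and cancelling that finite term. *)
pose e x := (h x * (expR (- (t * X x)) - expR (- ((t + n.+1%:R^-1) * X x))))%:E.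
have e0 x : D x -> (0 <= e x)%E.
  move=> Dx; rewrite lee_fin mulr_ge0 ?h0// subr_ge0 ler_expR lerN2.
  by rewrite ler_wpM2r ?X0// lerDl invr_ge0.
have me : measurable_fun D e.
  apply/measurable_EFinP; apply: measurable_funM => //.
  apply: measurable_funB; apply: measurableT_comp; (try exact: measurable_expR);
    by apply: measurableT_comp => //; exact: measurable_funM.
have ge x : g n x = (n.+1%:R%:E * e x)%E by rewrite /g /e -EFinM mulrCA.
rewrite (eq_integral (fun x => (n.+1%:R%:E * e x)%E)); last by move=> x _; rewrite ge.
rewrite ge0_integralZl ?lee_fin//; congr (_ * _)%E.
have -> : laplace t = (\int[m]_(x in D) e x + laplace (t + n.+1%:R^-1))%E.
  rewrite -ge0_integralD//.
  - by apply: eq_integral => x _; rewrite /e -EFinD; congr _%:E; ring.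
  - by move=> x Dx; rewrite lee_fin mulr_ge0 ?h0 ?expR_ge0.
  - by apply/measurable_EFinP; exact: measurable_laplace_integrand.
by rewrite addeK// ge0_fin_numE ?laplace_ge0// laplace_lty.
Qed.

End laplace.

(** Both sides are limits of the same difference quotients. *)
Lemma eq_laplace_derive {R : realType}
    d (T : measurableType d) (m : {measure set T -> \bar R}) (D : set T) (h X : T -> R)
    d' (T' : measurableType d') (m' : {measure set T' -> \bar R}) (D' : set T') (h' X' : T' -> R) :
  measurable D -> measurable_fun D h -> measurable_fun D X ->
  (forall x, D x -> 0 <= h x) -> (forall x, D x -> 0 <= X x) ->
  measurable D' -> measurable_fun D' h' -> measurable_fun D' X' ->
  (forall x, D' x -> 0 <= h' x) -> (forall x, D' x -> 0 <= X' x) ->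
  (laplace m D h X 0 < +oo)%E ->
  (forall t, 0 <= t -> laplace m D h X t = laplace m' D' h' X' t) ->
  forall t, 0 <= t ->
  (\int[m]_(x in D) (h x * X x * expR (- (t * X x)))%:E =
   \int[m']_(x in D') (h' x * X' x * expR (- (t * X' x)))%:E)%E.
Proof.
move=> mD mh mX h0 X0 mD' mh' mX' h0' X0' fin E t t0.
have := @cvg_laplace_derive _ _ _ m D mD h X mh mX h0 X0 fin t t0.
have fin' : (laplace m' D' h' X' 0 < +oo)%E by rewrite -E.
have := @cvg_laplace_derive _ _ _ m' D' mD' h' X' mh' mX' h0' X0' fin' t t0.
have -> : (fun n => (n.+1%:R%:E * (laplace m' D' h' X' t - laplace m' D' h' X' (t + n.+1%:R^-1)%R))%E) =
  (fun n => (n.+1%:R%:E * (laplace m D h X t - laplace m D h X (t + n.+1%:R^-1)%R))%E).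
  by apply/funext => n; rewrite !E// addr_ge0.
by move=> /cvg_lim H1 /cvg_lim H2; rewrite -H1// -H2.
Qed.

Section laplace_power.
Context {R : realType} {d : measure_display} {T : measurableType d}.
Local Notation mu := (@lebesgue_measure R).
Variables (m : {sigma_finite_measure set T -> \bar R}).
Variables (h X : T -> R).
Hypotheses (mh : measurable_fun setT h) (mX : measurable_fun setT X).
Hypotheses (h0 : forall x, 0 <= h x) (X0 : forall x, 0 <= X x).

(** Tonelli applied to [x^s * Gamma (1 - s) = int t^(-s) x expR (- t x) dt]. Here [s < 1] makes the
    Gamma factor finite, and [s > 0] makes both sides vanish at [x = 0]. *)
Lemma powR_moment_laplace (s : R) : 0 < s < 1 ->
  (\int[m]_x (h x * X x `^ s)%:E * (Gamma_fun (1 - s))%:E =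
  \int[mu]_(t in `]0%R, +oo[) ((t `^ (- s))%:E *
     \int[m]_x (h x * X x * expR (- (t * X x)))%:E))%E.
Proof.
move=> /andP[s0 s1]; have s1' : 0 < 1 - s by rewrite subr_gt0.
(* The indicator puts the half-line into the integrand, so that Tonelli is applied on the whole
   line. *)
pose k (t : R) : R := \1_`]0, +oo[ t * t `^ (- s).
pose F (z : T * measurableTypeR R) := (h z.1 * X z.1 * (k z.2 * expR (- (z.2 * X z.1))))%:E.
have mk : measurable_fun setT (k : measurableTypeR R -> R).
  by apply: measurable_funM; [exact: measurable_indic|exact: measurable_powR].
have mX1 : measurable_fun setT (fun z : T * measurableTypeR R => X z.1).
  exact: (measurableT_comp mX measurable_fst).
have mF : measurable_fun setT F.
  apply/measurable_EFinP; apply: measurable_funM.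
    by apply: measurable_funM => //; exact: (measurableT_comp mh measurable_fst).
  apply: measurable_funM; first exact: (measurableT_comp mk measurable_snd).
  apply: measurableT_comp; first exact: measurable_expR.
  apply: measurableT_comp => //; apply: measurable_funM => //; exact: measurable_snd.
have k0 t : 0 <= k t by rewrite mulr_ge0 ?powR_ge0.
have F0 z : (0 <= F z)%E.
  by rewrite lee_fin mulr_ge0// mulr_ge0// expR_ge0.
have := fubini_tonelli (m1 := m) (m2 := mu) F mF F0.
have -> : (\int[mu]_y \int[m]_x F (x, y) = \int[mu]_(t in `]0%R, +oo[) ((t `^ (- s))%:E *
     \int[m]_x (h x * X x * expR (- (t * X x)))%:E))%E.
  rewrite [RHS]integral_mkcond; apply: eq_integral => t _.
  rewrite patchE; case: ifPn => tD; last first.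
    rewrite (_ : point = 0%E)//; apply: integral0_eq => x _.
    by rewrite /F/k/= indicE (negbTE tD) !mul0r mulr0.
  rewrite -ge0_integralZl ?lee_fin ?powR_ge0//.
  - by apply: eq_integral => x _; rewrite /F/k/= indicE tD -EFinM mul1r; congr _%:E; ring.
  - apply/measurable_EFinP; apply: measurable_funM; first exact: measurable_funM.
    apply: measurableT_comp; first exact: measurable_expR.
    by apply: measurableT_comp => //; exact: measurable_funM.
  - by move=> x _; rewrite lee_fin mulr_ge0 ?expR_ge0// mulr_ge0.
move=> <-.
rewrite -ge0_integralZr//; last 3 first.
- apply/measurable_EFinP; apply: measurable_funM => //.
  exact: (measurableT_comp (measurable_powR s) mX).
- by move=> x _; rewrite lee_fin mulr_ge0 ?powR_ge0.
- by rewrite lee_fin ltW// Gamma_fun_gt0.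
apply: eq_integral => x _.
have [X0'|Xn0] := eqVneq (X x) 0.
  rewrite X0' powR0 ?gt_eqF// mulr0 mul0e; apply/esym/integral0_eq => t _.
  by rewrite /F /= X0' mulr0 mul0r.
have Xp : 0 < X x by rewrite lt_def Xn0 X0.
rewrite (_ : (\int[mu]_y F (x, y) = (h x * X x)%:E * gamma_integral (1 - s) (X x))%E).
  rewrite gamma_integralE// -!EFinM; congr _%:E.
  rewrite (_ : X x `^ s = X x * X x `^ (- (1 - s))); first by ring.
  rewrite -[X in X * _](@powRr1 _ (X x)) ?X0// -powRD ?Xn0 ?implybT//.
  by congr (_ `^ _); ring.
rewrite /gamma_integral [in RHS]integral_mkcond -ge0_integralZl//; last 3 first.
- apply/(measurable_restrictT _ _).1 => //.
  by apply/measurable_EFinP; exact: measurable_gamma_integrand.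
- by move=> t _; apply: erestrict_ge0 => u _; rewrite lee_fin gamma_integrand_ge0.
- by rewrite lee_fin mulr_ge0.
apply: eq_integral => t _; rewrite patchE /F /k /= indicE.
case: ifPn => tD; last by rewrite (_ : point = 0%E)// mule0 !mul0r mulr0.
rewrite -EFinM; congr _%:E; rewrite mul1r; congr (_ * _); congr (_ `^ _ * expR (- _)); ring.
Qed.

End laplace_power.

(** The right-hand side of [powR_moment_laplace] depends only on the transform, and the positive
    real [Gamma_fun (1 - s)] cancels even if the moments are infinite. *)
Lemma eq_powR_moment {R : realType}
    d (T : measurableType d) (m : {sigma_finite_measure set T -> \bar R}) (h X : T -> R)
    d' (T' : measurableType d') (m' : {sigma_finite_measure set T' -> \bar R}) (h' X' : T' -> R) (s : R) :
  measurable_fun setT h -> measurable_fun setT X ->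
  (forall x, 0 <= h x) -> (forall x, 0 <= X x) ->
  measurable_fun setT h' -> measurable_fun setT X' ->
  (forall x, 0 <= h' x) -> (forall x, 0 <= X' x) ->
  (laplace m setT h X 0 < +oo)%E ->
  (forall t, 0 <= t -> laplace m setT h X t = laplace m' setT h' X' t) ->
  0 < s < 1 ->
  (\int[m]_x (h x * X x `^ s)%:E = \int[m']_x (h' x * X' x `^ s)%:E)%E.
Proof.
move=> mh mX h0 X0 mh' mX' h0' X0' fin E s01.
have s1 : 0 < 1 - s by case/andP: s01 => _; rewrite subr_gt0.
have G0 := Gamma_fun_gt0 s1.
have H : (\int[m]_x (h x * X x `^ s)%:E * (Gamma_fun (1 - s))%:E =
          \int[m']_x (h' x * X' x `^ s)%:E * (Gamma_fun (1 - s))%:E)%E.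
  rewrite !powR_moment_laplace//; apply: eq_integral => t /set_mem/=.
  rewrite in_itv/= andbT => t0; congr (_ * _)%E.
  by apply: eq_laplace_derive => //; exact: ltW.
move: H => /(congr1 (fun x => x * ((Gamma_fun (1 - s))^-1)%:E)%E).
by rewrite -!muleA -EFinM divff ?gt_eqF// !mule1.
Qed.

(** * Recurrence and differentiability of the Gamma function *)

Section gamma_recurrence.
Context {R : realType}.
Local Notation mu := (@lebesgue_measure R).
Local Notation Rpos := (`]0%R, +oo[%classic : set (measurableTypeR R)).

Lemma laplace_gamma (p t : R) : -1 < t ->
  laplace mu Rpos (fun x => (x : R) `^ (p - 1) * expR (- (x : R)))%R id t = gamma_integral p (1 + t).
Proof.
move=> t0; apply: eq_integral => x _; congr _%:E.
by rewrite -mulrA -expRD; congr (_ * expR _); ring.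
Qed.

Lemma cvg_powR_quotient (p : R) :
  n.+1%:R * (1 - (1 + n.+1%:R^-1) `^ (- p)) @[n --> \oo] --> p.
Proof.
have [D1 D2] := is_derive1_powR (- p) (@ltr01 R).
have /cvgr_dnbhsP/(_ (fun n => n.+1%:R^-1)) := D1.
rewrite -/(derive _ _ _) D2 powR1 mulr1 => H.
have {}H := H (conj (fun n => _) (@cvg_harmonic R)).
have /H/cvgN : forall n : nat, n.+1%:R^-1 != 0 :> R by move=> n; rewrite invr_eq0.
rewrite opprK; apply: cvg_trans; apply: near_eq_cvg; apply: nearW => n.
rewrite fctE /= invrK /shift/= /GRing.scale/= mulr1 (addrC _ 1); ring.
Qed.

(** Both sides are minus the derivative at [t = 0] of [gamma_integral p (1 + t) = (1 + t)^(-p) *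
    Gamma_fun p]: one is computed under the integral, the other from the closed form. *)
Lemma Gamma_funS (p : R) : 0 < p -> Gamma_fun (p + 1) = p * Gamma_fun p.
Proof.
move=> p0.
have mh : measurable_fun Rpos (fun x : measurableTypeR R => x `^ (p - 1) * expR (- x)).
  apply: measurable_funM; first by apply: measurable_funTS; exact: measurable_powR.
  by apply: measurable_funTS; apply: measurableT_comp; first exact: measurable_expR.
have mid : measurable_fun Rpos (id : measurableTypeR R -> R) by exact: measurable_id.
have h0 (x : measurableTypeR R) : Rpos x -> 0 <= x `^ (p - 1) * expR (- x).
  by move=> _; rewrite mulr_ge0 ?powR_ge0 ?expR_ge0.
have X0 (x : measurableTypeR R) : Rpos x -> 0 <= (x : R).
  by rewrite /= in_itv/= andbT => /ltW.
have fin : (laplace mu Rpos (fun x => (x : R) `^ (p - 1) * expR (- (x : R)))%R id 0 < +oo)%E.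
  by rewrite laplace_gamma ?ltrN10// addr0 gamma_integral_lty.
have := @cvg_laplace_derive R _ _ mu Rpos (measurable_itv _) _ _ mh mid h0 X0 fin 0 (lexx 0).
rewrite (_ : (\int[mu]_(x in _) _)%E = (Gamma_fun (p + 1))%:E); last first.
  rewrite Gamma_fun_EFin ?addr_gt0//; apply: eq_integral => x /set_mem/=.
  rewrite in_itv/= andbT => x0; congr _%:E.
  rewrite mul0r oppr0 expR0 mulr1 mul1r mulrAC; congr (_ * _).
  rewrite -[X in _ * X](@powRr1 _ x) ?(ltW x0)// -powRD ?(gt_eqF x0) ?implybT//.
  by congr (_ `^ _); ring.
rewrite (_ : (fun n => _) = (fun n : nat => (n.+1%:R * (1 - (1 + n.+1%:R^-1) `^ (- p)) * Gamma_fun p)%:E)); last first.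
  apply/funext => n; rewrite !laplace_gamma ?ltrN10//; last first.
    by rewrite (lt_le_trans (ltrN10 _))// add0r invr_ge0.
  rewrite add0r addr0 !gamma_integralE// ?addr_gt0// -EFinB -EFinM powR1; congr _%:E; ring.
move=> /fine_cvgP[_ H].
have H' : n.+1%:R * (1 - (1 + n.+1%:R^-1) `^ (- p)) * Gamma_fun p @[n --> \oo] --> p * Gamma_fun p.
  by apply: cvgMr_tmp; exact: cvg_powR_quotient.
exact: (cvg_unique _ H H').
Qed.

(** Since [y + 1 <= expR y]; it lets a small power absorb a logarithm. *)
Lemma mulr_ln_le_powR (t e : R) : 0 < t -> e * ln t <= t `^ e.
Proof.
move=> t0; rewrite /powR gt_eqF//; apply: le_trans (expR_ge1Dx _).
by rewrite lerDr.
Qed.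

Lemma is_derive_powR_exponent (t x : R) : 0 < t ->
  is_derive x 1 (fun x => t `^ (x - 1) * expR (- t)) (ln t * (t `^ (x - 1) * expR (- t))).
Proof.
move=> t0.
have -> : (fun x => t `^ (x - 1) * expR (- t)) = (fun x => expR ((x - 1) * ln t) * expR (- t)).
  by apply/funext => y; rewrite /powR gt_eqF.
rewrite /powR gt_eqF//.
apply: is_derive_eq.
rewrite /GRing.scale/=; ring.
Qed.

Lemma derivable_Gamma_fun (a : R) : 0 < a -> derivable Gamma_fun a 1.
Proof.
move=> a0.
(* With [a = 4 e], let [x] range over []2 e, a + 1[]. For [t <= 1], [e |ln t| <= t^(-e)] and
   [t^(x-1) <= t^(2e-1)]; for [t > 1], [e ln t <= t^e] and [t^(x-1) <= t^(4e)]. The products are the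
   two powers in [G]. *)
pose e := a / 4; have e0 : 0 < e by rewrite divr_gt0.
pose f (x : R) (t : measurableTypeR R) : R := t `^ (x - 1) * expR (- t).
pose G (t : measurableTypeR R) : R := e^-1 * (t `^ (e - 1) * expR (- (1 * t)) + t `^ ((5 * e + 1) - 1) * expR (- (1 * t))).
have mRpos : measurable Rpos by exact: measurable_itv.
have If p : 0 < p -> mu.-integrable Rpos (EFin \o (fun t : measurableTypeR R => t `^ (p - 1) * expR (- (1 * t)))).
  move=> p0; apply/integrableP; split.
    by apply/measurable_EFinP; exact: measurable_gamma_integrand.
  under eq_integral => t _ do rewrite /= ger0_norm ?gamma_integrand_ge0//.
  exact: gamma_integral_lty.
apply: (@derivable_under_integral R _ _ mu f Rpos (measurable_itv _) a (2 * e) (a + 1) _ _ _ G).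
- by rewrite /= in_itv/=; apply/andP; split; rewrite /e; lra.
- move=> x; rewrite /= in_itv/= => /andP[x0 x1].
  rewrite (_ : f x = (fun t : measurableTypeR R => t `^ (x - 1) * expR (- (1 * t)))); last by apply/funext => t; rewrite /f mul1r.
  by apply: If; apply: lt_trans x0; rewrite mulr_gt0.
- move=> x t _; rewrite /= in_itv/= andbT => t0.
  by have [] := is_derive_powR_exponent x t0.
- move=> t; rewrite mulr_ge0 ?invr_ge0 ?(ltW e0)// addr_ge0// mulr_ge0 ?powR_ge0 ?expR_ge0//.
- have := integrableZl mRpos e^-1 (integrableD mRpos (If _ e0) (If (5 * e + 1) _)).
  apply.
  by rewrite addr_gt0// mulr_gt0.
- move=> x t; rewrite /= !in_itv/= andbT => /andP[x0 x1] t0.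
  rewrite partial1of2E.
  have [_ ->] := is_derive_powR_exponent x t0.
  rewrite normrM [X in _ * X]ger0_norm ?mulr_ge0 ?powR_ge0 ?expR_ge0// mulrA.
  rewrite /G mul1r -mulrDl mulrA ler_wpM2r ?expR_ge0//.
  rewrite ler_pdivlMl// mulrA.
  have [t1|t1] := leP t 1.
    apply: (@le_trans _ _ (t `^ (e - 1))); last by rewrite lerDl powR_ge0.
    rewrite (_ : e - 1 = - e + (2 * e - 1)); last by ring.
    rewrite [leRHS]powRD ?(gt_eqF t0) ?implybT//.
    apply: ler_pM; [exact: mulr_ge0 (ltW e0) (normr_ge0 _)|exact: powR_ge0| |].
      rewrite ler0_norm ?ln_le0// mulrN -mulNr; exact: mulr_ln_le_powR.
    by apply: ger_powR; rewrite ?t0//; lra.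
  apply: (@le_trans _ _ (t `^ (5 * e + 1 - 1))); last by rewrite lerDr powR_ge0.
  rewrite (_ : 5 * e + 1 - 1 = e + (a + 1 - 1)); last by rewrite /e; field.
  rewrite [leRHS]powRD ?(gt_eqF t0) ?implybT//.
  apply: ler_pM; [exact: mulr_ge0 (ltW e0) (normr_ge0 _)|exact: powR_ge0| |].
    rewrite ger0_norm ?ln_ge0 ?(ltW t1)//; exact: mulr_ln_le_powR.
  by apply: ler_powR; [exact: ltW|lra].
Qed.

(** Differentiate [Gamma_funS] and divide by it. *)
Lemma digammaS (p : R) : 0 < p -> digamma (p + 1) = digamma p + p^-1.
Proof.
move=> p0; rewrite /digamma.
have G0 := Gamma_fun_gt0 p0.
have D : is_derive p 1 Gamma_fun (derive1 Gamma_fun p).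
  by rewrite derive1E; apply: derivableP; exact: derivable_Gamma_fun.
have Dp1 : is_derive (p + 1) 1 Gamma_fun (derive1 Gamma_fun (p + 1)).
  by rewrite derive1E; apply: derivableP; apply: derivable_Gamma_fun; rewrite addr_gt0.
have D2 : is_derive p 1 (fun x => Gamma_fun (x + 1)) (derive1 Gamma_fun (p + 1)).
  apply: is_derive_eq.
  by rewrite /GRing.scale/= addr0 mulr1.
have D3 : is_derive p 1 (fun x => x * Gamma_fun x) (p * derive1 Gamma_fun p + Gamma_fun p).
  by apply: is_derive_eq; rewrite /GRing.scale/=; ring.
have E : derive1 Gamma_fun (p + 1) = p * derive1 Gamma_fun p + Gamma_fun p.
  rewrite -(@derive_val _ _ _ _ _ _ _ D2) -(@derive_val _ _ _ _ _ _ _ D3).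
  (* The recurrence holds for positive arguments, hence on a neighbourhood of [p], which determines
     the derivative. *)
  apply: near_eq_derive => //.
  near=> x; apply: Gamma_funS.
  near: x; exact: lt_nbhsr.
rewrite E Gamma_funS//; field.
by rewrite !gt_eqF.
Unshelve. all: by end_near. Qed.

End gamma_recurrence.

(** * Positive semidefinite Hermitian matrices *)

Section psd_matrices.
Local Open Scope sesquilinear_scope.
Context {C : numClosedFieldType}.

(** Sylvester's identity: up to the common factor [\det X], the two sides are the determinants of
    [Y X] and [X Y], both block triangular. *)
Lemma det_1addmulmxC (F : fieldType) m n (A : 'M[F]_(m, n)) (B : 'M[F]_(n, m)) :
  \det (1%:M + A *m B) = \det (1%:M + B *m A).
Proof.
pose X := block_mx 1%:M (- A) B 1%:M; pose Y := block_mx 1%:M A (0 : 'M[F]_(n, m)) 1%:M.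
have dY : \det Y = 1 by rewrite det_ublock !det1 mulr1.
have XY : X *m Y = block_mx 1%:M 0 B (1%:M + B *m A).
  by rewrite mulmx_block !mulmx1 !mul1mx !mulmx0 !addr0 addrN addrC.
have YX : Y *m X = block_mx (1%:M + A *m B) 0 B 1%:M.
  by rewrite mulmx_block !mulmx1 !mul1mx !mul0mx !add0r addNr.
have := congr1 determinant XY; rewrite det_mulmx dY mulr1 det_lblock det1 mul1r => <-.
by have := congr1 determinant YX; rewrite det_mulmx dY mul1r det_lblock det1 mulr1 => <-.
Qed.

Lemma scalar_mx_add (F : fieldType) n (a b : F) : (a + b)%:M = a%:M + b%:M :> 'M[F]_n.
Proof. by apply/matrixP => i j; rewrite !mxE mulrnDl. Qed.

Lemma det_add_rank1_unit (F : fieldType) n (S : 'M[F]_n) (v : 'cV[F]_n) (u : 'rV[F]_n) :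
  \det S != 0 -> \det (S + v *m u) = \det S + (u *m \adj S *m v) 0 0.
Proof.
move=> S0; have US : S \in unitmx by rewrite unitmxE unitfE.
have -> : S + v *m u = S *m (1%:M + (invmx S *m v) *m u).
  by rewrite mulmxDr mulmx1 !mulmxA mulmxV// mul1mx.
rewrite det_mulmx det_1addmulmxC det_mx11 mxE mulrDr.
rewrite [X in _ * X + _]mxE eqxx mulr1n mulr1; congr (_ + _).
rewrite /invmx US -!scalemxAl -scalemxAr mxE mulrA mulfV// mul1r.
by rewrite mulmxA.
Qed.

(** The identity is polynomial in [S], so it extends from invertible matrices: ['X%:M + S] has a
    monic, hence nonzero, determinant, and evaluating at 0 gives back [S]. Singular [S] do occur, as
    the replacement of rows starts from 0. *)
Lemma det_add_rank1 (F : fieldType) n (S : 'M[F]_n) (v : 'cV[F]_n) (u : 'rV[F]_n) :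
  \det (S + v *m u) = \det S + (u *m \adj S *m v) 0 0.
Proof.
pose Q := {fraction {poly F}}.
pose toQ := (@tofrac {poly F}).
pose Sp : 'M[{poly F}]_n := 'X%:M + map_mx polyC S.
have dSp : \det Sp != 0.
  have -> : Sp = char_poly_mx (- S) by rewrite /char_poly_mx /Sp map_mxN opprK.
  exact: monic_neq0 (char_poly_monic _).
have key : \det (Sp + map_mx polyC v *m map_mx polyC u) =
    \det Sp + (map_mx polyC u *m \adj Sp *m map_mx polyC v) 0 0.
  apply/eqP; rewrite -tofrac_eq; apply/eqP; rewrite rmorphD/= -!det_map_mx map_mxD map_mxM.
  rewrite det_add_rank1_unit; last by rewrite det_map_mx tofrac_eq0.
  congr (_ + _); rewrite -map_mx_adj -!map_mxM mxE//.
pose ev : {rmorphism {poly F} -> F} := horner_eval 0.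
have evS : map_mx ev Sp = S.
  by apply/matrixP => i j; rewrite !mxE /ev /= /horner_eval hornerD hornerC hornerMn hornerX mul0rn add0r.
have evC m' n' (A : 'M[F]_(m', n')) : map_mx ev (map_mx polyC A) = A.
  by apply/matrixP => i j; rewrite !mxE /ev /= /horner_eval hornerC.
have := congr1 ev key.
rewrite rmorphD/= -!det_map_mx map_mxD map_mxM evS !evC => ->; congr (_ + _).
have E : ev ((map_mx polyC u *m \adj Sp *m map_mx polyC v) 0 0) =
   (map_mx ev (map_mx polyC u *m \adj Sp *m map_mx polyC v)) 0 0 by rewrite [RHS]mxE.
by rewrite E !map_mxM map_mx_adj evS !evC.
Qed.

Definition psdmx n (M : 'M[C]_n) :=
  M ^t* = M /\ forall u : 'rV[C]_n, 0 <= (u *m M *m u ^t*) 0 0.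

Lemma trmxC_mul m n p (A : 'M[C]_(m, n)) (B : 'M[C]_(n, p)) :
  (A *m B) ^t* = B ^t* *m A ^t*.
Proof. by rewrite trmx_mul map_mxM. Qed.

Lemma trmxCD m n (A B : 'M[C]_(m, n)) : (A + B) ^t* = A ^t* + B ^t*.
Proof. by rewrite linearD/= map_mxD. Qed.

Lemma trmxCB m n (A B : 'M[C]_(m, n)) : (A - B) ^t* = A ^t* - B ^t*.
Proof. by apply/matrixP => i j; rewrite !mxE rmorphB. Qed.

Lemma trmxCZ m n a (A : 'M[C]_(m, n)) : (a *: A) ^t* = a^* *: A ^t*.
Proof. by apply/matrixP => i j; rewrite !mxE rmorphM. Qed.

Lemma row_norm_ge0 n (u : 'rV[C]_n) : 0 <= (u *m u ^t*) 0 0.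
Proof.
rewrite mxE; apply: sumr_ge0 => i _; rewrite !mxE -normCK.
by rewrite exprn_ge0.
Qed.

Lemma psdmx_gram m n (B : 'M[C]_(m, n)) : psdmx (B ^t* *m B).
Proof.
split; first by rewrite trmxC_mul trmxCK.
move=> u; have := row_norm_ge0 (u *m B ^t*).
by rewrite trmxC_mul trmxCK !mulmxA.
Qed.

Lemma psdmx1 n : psdmx (1%:M : 'M[C]_n).
Proof. by have := psdmx_gram (1%:M : 'M[C]_n); rewrite mulmx1 trmx1 map_mx1. Qed.

Lemma psdmxD n (M N : 'M[C]_n) : psdmx M -> psdmx N -> psdmx (M + N).
Proof.
move=> [hM pM] [hN pN]; split; first by rewrite trmxCD hM hN.
by move=> u; rewrite mulmxDr mulmxDl mxE addr_ge0.
Qed.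

Lemma psdmx_congr m n (M : 'M[C]_n) (B : 'M[C]_(n, m)) :
  psdmx M -> psdmx (B ^t* *m M *m B).
Proof.
move=> [hM pM]; split; first by rewrite !trmxC_mul trmxCK hM mulmxA.
move=> u; have := pM (u *m B ^t*).
by rewrite trmxC_mul trmxCK !mulmxA.
Qed.

Lemma psdmx0 n : psdmx (0 : 'M[C]_n).
Proof.
split; first by apply/matrixP => i j; rewrite !mxE conjC0.
by move=> u; rewrite mulmx0 mul0mx mxE.
Qed.

Lemma psdmxZ n (a : C) (M : 'M[C]_n) : 0 <= a -> psdmx M -> psdmx (a *: M).
Proof.
move=> a0 [hM pM]; split.
  apply/matrixP => i j; have /matrixP/(_ i j) := hM; rewrite !mxE => <-.
  by rewrite rmorphM/= (conj_Creal (ger0_real a0)).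
by move=> u; rewrite -scalemxAr -scalemxAl mxE mulr_ge0.
Qed.

Lemma psdmx_spectral n (M : 'M[C]_n) : psdmx M ->
  exists U : 'M[C]_n, exists d : 'rV[C]_n,
    [/\ U *m U ^t* = 1%:M, U ^t* *m U = 1%:M, M = U ^t* *m diag_mx d *m U
      & forall i, 0 <= d 0 i].
Proof.
move=> [hM pM].
have hM' : M \is hermsymmx.
  by apply/is_hermitianmxP; rewrite expr0 scale1r hM.
have /orthomx_spectralP ME := hermitian_normalmx hM'.
set U := spectralmx M in ME; set d := spectral_diag M in ME.
have uU : U \is unitarymx by exact: spectral_unitarymx.
have UU : U *m U ^t* = 1%:M by apply/unitarymxP.
have UU' : U ^t* *m U = 1%:M by exact: mulmx1C.
rewrite invmx_unitary// in ME.
exists U, d; split=> // i.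
(* The rows of [U] are eigenvectors, so the form takes the value [d 0 i] at the [i]-th one. *)
have := pM (row i U).
suff -> : (row i U *m M *m (row i U) ^t*) 0 0 = d 0 i by [].
have -> : (row i U *m M *m (row i U) ^t*) 0 0 = (U *m M *m U ^t*) i i.
  by rewrite -row_mul [LHS]mxE [RHS]mxE; apply: eq_bigr => k _; rewrite !mxE.
by rewrite ME !mulmxA UU mul1mx -mulmxA UU mulmx1 mxE eqxx mulr1n.
Qed.

(** Applied to [B^* B], this gives a square matrix with the same Gram matrix as a rectangular
    [B]. *)
Lemma psdmx_sqrt n (M : 'M[C]_n) : psdmx M -> exists S : 'M[C]_n, S ^t* *m S = M.
Proof.
move=> /psdmx_spectral[U [d [_ _ -> d0]]].
exists (diag_mx (\row_i sqrtC (d 0 i)) *m U).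
rewrite trmxC_mul mulmxA -(mulmxA (U ^t*)); congr (_ *m _ *m _).
rewrite tr_diag_mx map_diag_mx mulmx_diag; congr diag_mx.
apply/rowP => i; rewrite !mxE /= conj_Creal ?ger0_real ?sqrtC_ge0//.
by rewrite -expr2 sqrtCK.
Qed.

(** The [d i] are the eigenvalues; they are chosen before [t], so that one family serves for all
    shifts at once. *)
Lemma psdmx_det_shift n (M : 'M[C]_n) : psdmx M ->
  exists2 d : 'I_n -> C, forall i, 0 <= d i &
    forall t : C, \det (t%:M + M) = \prod_i (t + d i).
Proof.
move=> /psdmx_spectral[U [d [UU UU' -> d0]]].
exists (fun i => d 0 i) => // t.
have -> : t%:M + U ^t* *m diag_mx d *m U = U ^t* *m (diag_mx (\row_i (t + d 0 i))) *m U.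
  have -> : diag_mx (\row_i (t + d 0 i)) = t%:M + diag_mx d.
    by apply/matrixP => i j; rewrite !mxE mulrnDl.
  by rewrite mulmxDr mulmxDl mul_mx_scalar -scalemxAl UU' scalemx1.
rewrite !det_mulmx mulrC mulrA -det_mulmx UU det1 mul1r det_diag.
by apply: eq_bigr => i _; rewrite mxE.
Qed.

Lemma psdmx_det_ge0 n (M : 'M[C]_n) : psdmx M -> 0 <= \det M.
Proof.
move=> /psdmx_det_shift[d d0 /(_ 0)]; rewrite (_ : 0%:M = 0 :> 'M[C]_n).
  by rewrite add0r => ->; apply: prodr_ge0 => i _; rewrite add0r.
by apply/matrixP => i j; rewrite !mxE mul0rn.
Qed.

Lemma psdmx_inv n (M : 'M[C]_n) : psdmx M -> M \in unitmx -> psdmx (invmx M).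
Proof.
move=> [hM pM] uM.
have hI : (invmx M) ^t* = invmx M by rewrite trmx_inv map_invmx hM.
split => // u; have := pM (u *m invmx M).
by rewrite trmxC_mul hI mulmxKV// mulmxA.
Qed.

Lemma psdmx_adj n (S : 'M[C]_n) : psdmx S -> psdmx (\adj S).
Proof.
move=> pS; have [hS _] := pS; split.
  by rewrite trmx_adj map_mx_adj hS.
move=> u; have [S0|S0] := eqVneq (\det S) 0.
  (* For singular [S] the rank-one formula identifies the form at [u] with the determinant of
     [S + u^* u]. *)
  have := psdmx_det_ge0 (psdmxD pS (psdmx_gram u)).
  by rewrite det_add_rank1 S0 add0r.
have uS : S \in unitmx by rewrite unitmxE unitfE.
have -> : \adj S = \det S *: invmx S.
  by rewrite /invmx uS scalerA mulfV// scale1r.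
exact: (psdmxZ (psdmx_det_ge0 pS) (psdmx_inv pS uS)).2.
Qed.

Lemma det_gram_row m n (S : 'M[C]_m) (B : 'M[C]_(n, m)) (q : 'rV[C]_n) :
  \det (S + (q *m B) ^t* *m (q *m B)) =
  \det S + (q *m (B *m \adj S *m B ^t*) *m q ^t*) 0 0.
Proof. by rewrite det_add_rank1 trmxC_mul !mulmxA. Qed.

Lemma psdmx_adj_congr m n (S : 'M[C]_m) (B : 'M[C]_(n, m)) : psdmx S ->
  psdmx (B *m \adj S *m B ^t*).
Proof.
by move=> /psdmx_adj/(psdmx_congr (B ^t*)); rewrite trmxCK.
Qed.

(** Sylvester's identity moves the outer [B] to the other side, so the Laplace transform of the form
    in [det_gram_row] sees [B] only through [B^* B]. *)
Lemma det_1addZ_adj_congr m n (S : 'M[C]_m) (B : 'M[C]_(n, m)) (t : C) :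
  \det (1%:M + t *: (B *m \adj S *m B ^t*)) =
  \det (1%:M + t *: (\adj S *m (B ^t* *m B))).
Proof. by rewrite -mulmxA scalemxAr det_1addmulmxC -scalemxAl mulmxA. Qed.

Lemma row_norm_eq0 n (u : 'rV[C]_n) : (u *m u ^t*) 0 0 = 0 -> u = 0.
Proof.
rewrite mxE => /eqP; rewrite psumr_eq0 => [/allP H|i _]; last first.
  by rewrite !mxE -normCK exprn_ge0.
apply/rowP => i; rewrite [RHS]mxE.
have := H i (mem_index_enum i); rewrite !mxE -normCK /= expf_eq0/= normr_eq0.
by move/eqP.
Qed.

(** A vector in the kernel of [A A^*] is a linear relation between the rows of [A]; padded with 0 it
    remains one after a row is added. *)
Lemma det_gram_col_mx_singular N p (a : 'rV[C]_N) (A : 'M[C]_(p, N)) :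
  \det (A *m A ^t*) = 0 -> \det (col_mx a A *m (col_mx a A) ^t*) = 0.
Proof.
move=> /eqP/det0P[v v0 vW].
have vA : v *m A = 0.
  by apply: row_norm_eq0; rewrite trmxC_mul mulmxA -(mulmxA v) vW mul0mx mxE.
apply/eqP/det0P; exists (row_mx (0 : 'M[C]_1) v).
  apply: contra v0 => /eqP/(congr1 rsubmx); rewrite row_mxKr linear0 => ->.
  exact: eqxx.
by rewrite mulmxA mul_row_col mul0mx add0r vA mul0mx.
Qed.

(** When [A A^*] is invertible, this is the orthogonal projection onto the complement of the row
    space of [A]. *)
Definition row_coprojmx N p (A : 'M[C]_(p, N)) : 'M[C]_N :=
  1%:M - A ^t* *m invmx (A *m A ^t*) *m A.

(** Base times height: the form is the squared distance from [a] to the row space of [A].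
    Multiplication by the unitriangular [X] clears the lower left block and leaves this Schur
    complement. *)
Lemma det_gram_col_mx N p (a : 'rV[C]_N) (A : 'M[C]_(p, N)) :
  \det (A *m A ^t*) != 0 ->
  \det (col_mx a A *m (col_mx a A) ^t*) =
  \det (A *m A ^t*) * (a *m row_coprojmx A *m a ^t*) 0 0.
Proof.
move=> W0; set W := A *m A ^t* in W0 *.
have uW : W \in unitmx by rewrite unitmxE unitfE.
have E : col_mx a A *m (col_mx a A) ^t* =
    block_mx (a *m a ^t*) (a *m A ^t*) (A *m a ^t*) W.
  by rewrite tr_col_mx map_row_mx mul_col_row.
pose X := block_mx (1%:M : 'M[C]_1) 0 (- (invmx W *m A *m a ^t*)) 1%:M.
have dX : \det X = 1 by rewrite det_lblock !det1 mulr1.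
have EX : col_mx a A *m (col_mx a A) ^t* *m X =
    block_mx (a *m row_coprojmx A *m a ^t*) (a *m A ^t*) 0 W.
  rewrite E mulmx_block !mulmx1 !mulmx0 !add0r !mulmxN.
  congr block_mx.
    by rewrite /row_coprojmx -/W mulmxBr mulmxBl mulmx1 !mulmxA.
  by rewrite !mulmxA mulmxV// mul1mx addrN.
have := congr1 determinant EX.
by rewrite det_mulmx dX mulr1 det_ublock det_mx11 mulrC.
Qed.

(** A Hermitian idempotent is its own Gram matrix, hence positive semidefinite. *)
Lemma row_coprojmx_gram N p (A : 'M[C]_(p, N)) : \det (A *m A ^t*) != 0 ->
  row_coprojmx A = (row_coprojmx A) ^t* *m row_coprojmx A.
Proof.
move=> W0; set W := A *m A ^t* in W0 *.
have uW : W \in unitmx by rewrite unitmxE unitfE.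
have hW : W ^t* = W by rewrite /W trmxC_mul trmxCK.
have hI : (invmx W) ^t* = invmx W by rewrite trmx_inv map_invmx hW.
pose E := A ^t* *m invmx W *m A.
have hE : E ^t* = E by rewrite /E !trmxC_mul trmxCK hI mulmxA.
have EE : E *m E = E.
  by rewrite /E !mulmxA -(mulmxA _ A) -/W -(mulmxA _ _ W) mulVmx// mulmx1.
have -> : row_coprojmx A = 1%:M - E by [].
have -> : (1%:M - E) ^t* = 1%:M - E.
  by rewrite linearB/= trmx1 map_mxB map_mx1 hE.
by rewrite mulmxBr mulmx1 mulmxBl mul1mx EE subrr subr0.
Qed.

(** The projection has eigenvalue 1 with multiplicity [N - p], and 0 otherwise. The value makes the
    associated Gaussian form a Gamma variable of shape [N - p]. *)
Lemma det_1addZ_row_coprojmx N p (A : 'M[C]_(p, N)) (t : C) : (p <= N)%N ->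
  \det (A *m A ^t*) != 0 -> 1 + t != 0 ->
  \det (1%:M + t *: row_coprojmx A) = (1 + t) ^+ (N - p).
Proof.
move=> pN W0 t0; set W := A *m A ^t* in W0 *.
have uW : W \in unitmx by rewrite unitmxE unitfE.
(* This [c] allows [1 + t] to be factored out; Sylvester's identity then reduces the rest to the
   scalar matrix [1 + c = (1 + t)^-1] of size [p]. *)
pose c := - (t / (1 + t)).
have c1 : (1 + t) * c = - t by rewrite /c mulrN mulrC divfK.
have -> : 1%:M + t *: row_coprojmx A =
   (1 + t) *: (1%:M + A ^t* *m (c *: (invmx W *m A))).
  have -> : A ^t* *m (c *: (invmx W *m A)) = c *: (A ^t* *m invmx W *m A).
    by rewrite -scalemxAr mulmxA.
  rewrite [RHS]scalerDr scalerA c1.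
  by rewrite scaleNr scalerDl scale1r /row_coprojmx -/W scalerBr addrA.
rewrite detZ det_1addmulmxC -scalemxAl -mulmxA -/W mulVmx// scalemx1 -scalar_mx_add.
rewrite det_scalar exprB ?unitfE//; congr (_ * _).
rewrite -exprVn; congr (_ ^+ _); apply: (mulfI t0).
by rewrite mulfV// mulrDr mulr1 c1 addrK.
Qed.

Lemma trmxC_mx11 (X : 'M[C]_1) : (X ^t*) 0 0 = (X 0 0)^*.
Proof. by rewrite !mxE. Qed.

Section schur.
Variables (n : nat) (M : 'M[C]_(1 + n)).
Hypothesis pM : psdmx M.
Let a : C := ulsubmx M 0 0.
Let b : 'rV[C]_n := ursubmx M.
Let D : 'M[C]_n := drsubmx M.

(* The form left in the other coordinates once the first entry of a Gaussian row is
   integrated out of [expR (- formmx M q)]. *)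
Definition schur_shift : 'M[C]_n := D - (1 + a)^-1 *: (b ^t* *m b).

Lemma psdmx_block : M = block_mx a%:M b (b ^t*) D.
Proof.
have [hM _] := pM.
rewrite -[LHS]submxK; congr block_mx.
  by apply/matrixP => i j; rewrite !ord1 [RHS]mxE eqxx mulr1n.
by rewrite -[in LHS]hM /b; apply/matrixP => i j; rewrite !mxE.
Qed.

Lemma schur_corner_ge0 : 0 <= a.
Proof.
have [_ /(_ (row_mx 1%:M 0))] := pM.
rewrite {1}psdmx_block mul_row_block !mul1mx !mul0mx !addr0.
rewrite tr_row_mx map_col_mx mul_row_col trmx1 map_mx1 mulmx1 trmx0 (map_mx0 _) mulmx0 addr0.
by rewrite mxE eqxx mulr1n.
Qed.

Lemma psdmx_form_block (z : C) (q : 'rV[C]_n) :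
  (row_mx z%:M q *m M *m (row_mx z%:M q) ^t*) 0 0 =
  a * (z * z^*) + z * ((q *m b ^t*) 0 0)^* + z^* * (q *m b ^t*) 0 0
  + (q *m D *m q ^t*) 0 0.
Proof.
have hb : ((q *m b ^t*) 0 0)^* = (b *m q ^t*) 0 0.
  have -> : b *m q ^t* = (q *m b ^t*) ^t* by rewrite trmxC_mul trmxCK.
  by rewrite trmxC_mx11.
have hz : (z%:M : 'M[C]_1) ^t* = (z^*)%:M by rewrite tr_scalar_mx map_scalar_mx.
rewrite {1}psdmx_block mul_row_block tr_row_mx map_col_mx mul_row_col hz hb.
rewrite mxE !mulmxDl -!scalar_mxM.
rewrite mul_mx_scalar mul_scalar_mx -scalemxAl.
move: (q *m b ^t*) (b *m q ^t*) (q *m D *m q ^t*) => X Y Z.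
rewrite !mxE eqxx mulr1n; ring.
Qed.

Lemma schur_shift_form (q : 'rV[C]_n) :
  (q *m schur_shift *m q ^t*) 0 0 = (q *m D *m q ^t*) 0 0
    - (1 + a)^-1 * ((q *m b ^t*) 0 0 * ((q *m b ^t*) 0 0)^*).
Proof.
rewrite /schur_shift mulmxBr mulmxBl [LHS]mxE; congr (_ + _).
rewrite -scalemxAr -scalemxAl [LHS]mxE [X in - X]mxE; congr (- (_ * _)).
rewrite mulmxA -(mulmxA _ b); have -> : b *m q ^t* = (q *m b ^t*) ^t* by rewrite trmxC_mul trmxCK.
by rewrite [q *m b ^t*]mx11_scalar tr_scalar_mx map_scalar_mx -scalar_mxM !mxE eqxx !mulr1n.
Qed.

Lemma psdmx_schur_shift : psdmx schur_shift.
Proof.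
have a0 := schur_corner_ge0.
have a1 : 0 < 1 + a by rewrite ltr_wpDr.
have [hM fM] := pM.
have hD : D ^t* = D by rewrite /D -{2}hM; apply/matrixP => i j; rewrite !mxE.
have ar : (1 + a)^-1^* = (1 + a)^-1.
  by rewrite conj_Creal// ger0_real// invr_ge0 ltW.
split.
  by rewrite /schur_shift trmxCB hD trmxCZ ar trmxC_mul trmxCK.
(* Completing the square: this [z] minimises [|z|^2] plus the form of [M] at the row with entries
   [z] and [q], and the minimum, a sum of two nonnegative terms, is the form of [schur_shift] at
   [q]. *)
move=> q; pose c := (q *m b ^t*) 0 0; pose z := - c / (1 + a).
have := fM (row_mx z%:M q); rewrite psdmx_form_block -/c => H.
have zc : z^* = - c^* / (1 + a) by rewrite /z rmorphM rmorphN /= ar.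
rewrite schur_shift_form -/c.
suff -> : (q *m D *m q ^t*) 0 0 - (1 + a)^-1 * (c * c^*) =
  z * z^* + (a * (z * z^*) + z * c^* + z^* * c + (q *m D *m q ^t*) 0 0).
  by rewrite addr_ge0// -normCK exprn_ge0.
rewrite zc /z; field; by rewrite gt_eqF.
Qed.

(** [1 + schur_shift] is the Schur complement of the corner [1 + a] in [1 + M]. *)
Lemma det_1add_schur : \det (1%:M + M) = (1 + a) * \det (1%:M + schur_shift).
Proof.
have a0 := schur_corner_ge0.
have a1 : 1 + a != 0 by rewrite gt_eqF// ltr_wpDr.
pose X := block_mx (1%:M : 'M[C]_1) (- ((1 + a)^-1 *: b)) 0 1%:M.
have dX : \det X = 1 by rewrite det_ublock !det1 mulr1.
have E : (1%:M + M) *m X = block_mx (1 + a)%:M 0 (b ^t*) (1%:M + schur_shift).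
  rewrite {1}psdmx_block [X in X + _](scalar_mx_block 1 n) add_block_mx !add0r mulmx_block.
  rewrite !mulmx1 !mulmx0 !addr0 -scalar_mx_add mul_scalar_mx scalerN scalerA mulfV// scale1r addNr.
  congr block_mx; by rewrite mulmxN -scalemxAr /schur_shift addrC -addrA.
have := congr1 determinant E.
by rewrite det_mulmx dX mulr1 det_lblock det_scalar expr1.
Qed.

End schur.

End psd_matrices.

(** * Independent Gaussian families *)

(** Measurability of [F] is expressed by composition with every measurable family, in line with
    complex variables being handled through their real and imaginary parts. *)
Definition borel_functional {R : realType} (I : Type) (F : (I -> R[i]) -> \bar R) : Prop :=
  forall d (T : measurableType d) (Z : I -> T -> R[i]),
    (forall i, complex_random_variable (Z i)) ->
    measurable_fun setT (fun w => F (fun i => Z i w)).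

Section law_unique.
Context {R : realType} {I : finType}.
Local Notation V := (#|I|.-tuple (R * R)).

(** Tuples of pairs of reals carry a product sigma-algebra, on which the law of a finite family is a
    measure; this map reads such a tuple back as a family. *)
Definition family_of_tuple (v : V) (i : I) : R[i] :=
  let p := tnth v (enum_rank i) in Complex p.1 p.2.

Lemma measurable_family_of_tuple (i : I) :
  complex_random_variable (fun v : V => family_of_tuple v i).
Proof.
rewrite /complex_random_variable (_ : (fun w => _) = (fun v : V => tnth v (enum_rank i))).
  exact: measurable_tnth.
by apply/funext => v; rewrite /family_of_tuple /reim /=; case: (tnth _ _).
Qed.

Context {d : measure_display} {T : measurableType d}.

Definition tuple_of_family (Z : I -> T -> R[i]) (w : T) : V :=
  [tuple reim (Z (enum_val i) w) | i < #|I|].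

Lemma measurable_tuple_of_family (Z : I -> T -> R[i]) :
  (forall i, complex_random_variable (Z i)) -> measurable_fun setT (tuple_of_family Z).
Proof.
move=> mZ; apply/measurable_fun_tnthP => i.
rewrite (_ : _ \o _ = (fun w => reim (Z (enum_val i) w))); first exact: mZ.
by apply/funext => w /=; rewrite tnth_mktuple.
Qed.

Lemma tuple_of_familyK (Z : I -> T -> R[i]) w :
  family_of_tuple (tuple_of_family Z w) = (fun i => Z i w).
Proof.
by apply/funext => i; rewrite /family_of_tuple tnth_mktuple enum_rankK /=; case: (Z i w).
Qed.

End law_unique.

Definition tuple_rectangle {R : realType} n (A : 'I_n -> set (R * R)) : set (n.-tuple (R * R)) :=
  [set v | forall i, A i (tnth v i)].

Definition tuple_rectangles {R : realType} n : set (set (n.-tuple (R * R))) :=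
  [set B | exists A : 'I_n -> set (R * R), (forall i, measurable (A i)) /\ B = tuple_rectangle A].

Lemma measurable_tuple_rectangles {R : realType} n :
  @tuple_rectangles R n `<=` measurable.
Proof.
move=> _ [A [mA ->]].
rewrite (_ : tuple_rectangle A = \bigcap_(i in [set: 'I_n]) ((fun v => tnth v i) @^-1` A i)); last first.
  by apply/seteqP; split=> [v H i _|v H i]; [exact: H|exact: (H i I)].
apply: fin_bigcap_measurable => [|i _]; first exact: finite_finset.
by rewrite -[X in measurable X]setTI; exact: measurable_tnth.
Qed.

(** The product sigma-algebra is generated by preimages under single coordinates, which are
    rectangles with at most one side different from the whole space. *)
Lemma measurable_sub_tuple_rectangles {R : realType} n :
  (measurable : set (set (n.-tuple (R * R)))) `<=` <<s @tuple_rectangles R n >>.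
Proof.
apply: smallest_sub; first exact: smallest_sigma_algebra.
case: n => [|n]; first by rewrite big_ord0.
rewrite -bigcup_mkord_ord; apply: bigcup_sub => k _ _ [B mB <-].
apply: sub_sigma_algebra.
exists (fun i => if i == inord k then B else setT); split.
  by move=> i; case: ifP.
rewrite setTI; apply/seteqP; split => v /=.
  by move=> Bv i; case: eqP => [->|].
by move=> /(_ (inord k)); rewrite eqxx.
Qed.

Lemma setI_closed_tuple_rectangles {R : realType} n : setI_closed (@tuple_rectangles R n).
Proof.
move=> _ _ [A [mA ->]] [B [mB ->]]; exists (fun i => A i `&` B i); split.
  by move=> i; exact: measurableI.
by apply/seteqP; split => [v [Av Bv] i|v AB]; [split|split=> i; have [] := AB i].
Qed.

(** Both integrals are pushed forward to tuples. The two laws there are finite and agree on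
    rectangles, a generating class stable under intersection, so they coincide. *)
Lemma integral_law_unique {R : realType} {I : finType}
    d (T : measurableType d) (m : {measure set T -> \bar R}) (Z : I -> T -> R[i])
    d' (T' : measurableType d') (m' : {measure set T' -> \bar R}) (Z' : I -> T' -> R[i])
    (F : (I -> R[i]) -> \bar R) :
  (forall i, complex_random_variable (Z i)) -> (forall i, complex_random_variable (Z' i)) ->
  (m setT < +oo)%E ->
  (forall A : I -> set (R * R), (forall i, measurable (A i)) ->
     m (\bigcap_(i in [set: I]) ((fun w => reim (Z i w)) @^-1` A i)) =
     m' (\bigcap_(i in [set: I]) ((fun w => reim (Z' i w)) @^-1` A i))) ->
  borel_functional F -> (forall z, 0 <= F z)%E ->
  (\int[m]_w F (fun i => Z i w) = \int[m']_w F (fun i => Z' i w))%E.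
Proof.
move=> mZ mZ' fin rect mF F0.
pose Fh v := F (@family_of_tuple R I v).
have mFh : measurable_fun setT Fh.
  by apply: (mF _ _ (fun i v => @family_of_tuple R I v i)) => i; exact: measurable_family_of_tuple.
have step d0 (T0 : measurableType d0) (m0 : {measure set T0 -> \bar R}) (Z0 : I -> T0 -> R[i])
   (mZ0 : forall i, complex_random_variable (Z0 i)) :
   (\int[m0]_w F (fun i => Z0 i w) = \int[pushforward m0 (tuple_of_family Z0)]_v Fh v)%E.
  rewrite (ge0_integral_pushforward (measurable_tuple_of_family mZ0))//; last first.
    by move=> v _; exact: F0.
  by apply: eq_integral => w _; rewrite /= /Fh tuple_of_familyK.
rewrite step// step//; apply: eq_measure_integral => [||mt mt' A mA _]; [exact: measurable_tuple_of_family|exact: measurable_tuple_of_family|].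
apply: (@g_sigma_algebra_measure_unique _ R _ (@tuple_rectangles R #|I|) _ (fun _ => setT)).
- exact: measurable_tuple_rectangles.
- move=> _; exists (fun=> setT); split=> //.
  by apply/seteqP; split.
- by apply/seteqP; split => // v _; exists 0%N.
- exact: setI_closed_tuple_rectangles.
- move=> _ [B [mB ->]]; rewrite /pushforward.
  have E d0 (T0 : measurableType d0) (Z0 : I -> T0 -> R[i]) :
     tuple_of_family Z0 @^-1` tuple_rectangle B =
     \bigcap_(i in [set: I]) ((fun w => reim (Z0 i w)) @^-1` B (enum_rank i)).
    apply/seteqP; split => [w H i _|w H i] /=.
      by have := H (enum_rank i); rewrite tnth_mktuple enum_rankK.
    by have := H (enum_val i) Logic.I; rewrite tnth_mktuple /= enum_valK.
  have H := rect _ (fun i => mB (enum_rank i)).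
  by rewrite -(E _ _ Z) -(E _ _ Z') in H; exact: H.
- by move=> _; exact: fin.
- exact: measurable_sub_tuple_rectangles.
Qed.

Lemma integral_prob_cst {R : realType} d (T : measurableType d) (P : probability T R) (c : \bar R) :
  (\int[P]_x c = c)%E.
Proof.
rewrite -[LHS]/(\int[P]_x (cst c x))%E integral_cst// -[RHS]mule1; congr (_ * _)%E.
exact: probability_setT.
Qed.

Section gaussian_family.
Context {R : realType}.

Definition gaussian_family d (T : measurableType d) (P : probability T R)
    (I : finType) (Z : I -> T -> R[i]) : Prop :=
  (forall i, std_complex_gaussian P (Z i)) /\ mutually_independent P Z.

Lemma gaussian_family_measurable d (T : measurableType d) (P : probability T R)
    (I : finType) (Z : I -> T -> R[i]) :
  gaussian_family P Z -> forall i, complex_random_variable (Z i).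
Proof. by move=> [H _] i; have [] := H i. Qed.

Definition gaussian_mass (A : set (R * R)) : \bar R :=
  (\int[lebesgue_measure \x lebesgue_measure]_(z in A)
       (pi^-1 * expR (- (z.1 ^+ 2 + z.2 ^+ 2)))%:E)%E.

Lemma measurable_preim_family d (T : measurableType d) (Z : T -> R[i]) (A : set (R * R)) :
  complex_random_variable Z -> measurable A -> measurable ((fun w => reim (Z w)) @^-1` A).
Proof. by move=> mZ mA; rewrite -[X in measurable X]setTI; exact: mZ. Qed.

Lemma gaussian_family_set d (T : measurableType d) (P : probability T R)
    (I : finType) (Z : I -> T -> R[i]) (J : {set I}) (A : I -> set (R * R)) :
  gaussian_family P Z -> (forall i, measurable (A i)) ->
  P (\bigcap_(i in [set` J]) ((fun w => reim (Z i w)) @^-1` A i)) =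
  (\prod_(i in J) gaussian_mass (A i))%E.
Proof.
move=> [G ind] mA; rewrite ind; last by move=> i _; exact: mA.
by apply: eq_bigr => i _; have [_ ->] := G i.
Qed.

Lemma gaussian_family_reindex d (T : measurableType d) (P : probability T R)
    (I I' : finType) (Z : I -> T -> R[i]) (f : I' -> I) : injective f ->
  gaussian_family P Z -> gaussian_family P (fun i => Z (f i)).
Proof.
move=> fI GZ; have [G ind] := GZ; split; first by move=> i; exact: G.
move=> J A mA.
(* Independence of the original family is tested on the image of [J], to which the sets [A] are
   carried along [f]; [setT] is a default value outside that image. *)
pose B (i : I) : set (R * R) := if [pick j in J | f j == i] is Some j then A j else setT.
have BE j : j \in J -> B (f j) = A j.
  move=> jJ; rewrite /B; case: pickP => [k /andP[kJ /eqP/fI -> //]|/(_ j)].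
  by rewrite jJ eqxx.
have mB i : measurable (B i).
  rewrite /B; case: pickP => [j /andP[jJ _]|_]; [exact: mA|exact: measurableT].
have -> : \bigcap_(i in [set` J]) ((fun w => reim (Z (f i) w)) @^-1` A i) =
   \bigcap_(i in [set` f @: J]) ((fun w => reim (Z i w)) @^-1` B i).
  apply/seteqP; split => w H i /=.
    by move=> /imsetP[j jJ ->]; rewrite BE//; exact: H.
  by move=> iJ; have := H (f i) (imset_f f iJ); rewrite /= BE.
rewrite ind; last by move=> i _; exact: mB.
rewrite big_imset/=; last by move=> i j _ _ /fI.
by apply: eq_bigr => i iJ; rewrite BE.
Qed.

(** Conditioning on the entries outside [J]: by independence those in [J] may be drawn from another
    copy, and Tonelli gives an iterated integral whose inner part has the other entries frozen. *)
Lemma integral_decouple (I : finType) (J : {set I})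
    d (T : measurableType d) (P : probability T R) (Z : I -> T -> R[i])
    d' (T' : measurableType d') (P' : probability T' R) (Z' : I -> T' -> R[i])
    (F : (I -> R[i]) -> \bar R) :
  gaussian_family P Z -> gaussian_family P' Z' ->
  borel_functional F -> (forall z, 0 <= F z)%E ->
  (\int[P]_w F (fun i => Z i w) =
   \int[P]_w \int[P']_w' F (fun i => if i \in J then Z' i w' else Z i w))%E.
Proof.
move=> GZ GZ' mF F0.
pose Z2 (i : I) (p : T * T') : R[i] := if i \in J then Z' i p.2 else Z i p.1.
have mZ2 i : complex_random_variable (Z2 i).
  rewrite /complex_random_variable /Z2; case: (i \in J).
    exact: (measurableT_comp (gaussian_family_measurable GZ' i) measurable_snd).
  exact: (measurableT_comp (gaussian_family_measurable GZ i) measurable_fst).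
rewrite -(@fubini_tonelli1 _ _ T T' R P P' (fun p => F (fun i => Z2 i p))); last 2 first.
- exact: mF.
- by move=> p; exact: F0.
apply: integral_law_unique => //.
- exact: (gaussian_family_measurable GZ).
- by rewrite (_ : _ setT = 1%E) ?ltry//; exact: probability_setT.
move=> A mA.
have -> : \bigcap_(i in [set: I]) ((fun w => reim (Z2 i w)) @^-1` A i) =
  (\bigcap_(i in [set` ~: J]) ((fun w => reim (Z i w)) @^-1` A i)) `*`
  (\bigcap_(i in [set` J]) ((fun w => reim (Z' i w)) @^-1` A i)).
  apply/seteqP; split => [[w w'] H|[w w'] [/= H1 H2] i _].
    split => i /= iJ; have := H i Logic.I; rewrite /Z2 /= ?iJ//.
    by move: iJ; rewrite inE => /negbTE ->.
  by rewrite /Z2/=; case: ifPn => iJ; [exact: H2|apply: H1; rewrite /= inE].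
set E1 := \bigcap_(i in [set` ~: J]) _; set E2 := \bigcap_(i in [set` J]) _.
have mE1 : measurable E1.
  by apply: fin_bigcap_measurable => [|i _]; [exact: finite_finset|
    exact: measurable_preim_family (gaussian_family_measurable GZ i) (mA i)].
have mE2 : measurable E2.
  by apply: fin_bigcap_measurable => [|i _]; [exact: finite_finset|
    exact: measurable_preim_family (gaussian_family_measurable GZ' i) (mA i)].
transitivity (P E1 * P' E2)%E; last by apply/esym; exact: (@product_measure1E _ _ T T' R P P' E1 E2).
rewrite /E1 /E2.
have -> : [set: I] = [set` [set: I]%SET] by apply/seteqP; split => // i _; rewrite /= inE.
apply: etrans (gaussian_family_set [set: I] GZ mA) _.
rewrite (gaussian_family_set (~: J) GZ mA) (gaussian_family_set J GZ' mA).
rewrite (bigID (mem (~: J)))/=; congr (_ * _)%E.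
  by apply: eq_bigl => i; rewrite inE.
by apply: eq_bigl => i; rewrite !inE negbK.
Qed.

End gaussian_family.

(** * Integrals against the complex Gaussian density *)

Section gaussian_density.
Import HBNNSimple.
Context {R : realType}.
Local Notation mu := (@lebesgue_measure R).

(** It holds for indicators by assumption, for simple functions by linearity, and passes to monotone
    limits. *)
Lemma ge0_integral_density d (T : measurableType d) (m nu : {measure set T -> \bar R}) (g : T -> R)
    (f : T -> \bar R) :
  measurable_fun setT g -> (forall x, 0 <= g x) ->
  (forall A, measurable A -> nu A = \int[m]_(x in A) (g x)%:E)%E ->
  measurable_fun setT f -> (forall x, 0 <= f x)%E ->
  (\int[nu]_x f x = \int[m]_x (f x * (g x)%:E))%E.
Proof.
move=> mg g0 nuE mf f0.
pose fn := nnsfun_approx measurableT mf.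
have fncvg x : (fn n x)%:E @[n --> \oo] --> f x.
  by apply: cvg_nnsfun_approx => //.
have fnnd x : {homo (fun n => fn n x) : a b / (a <= b)%N >-> a <= b}.
  by move=> a b ab; exact/lefP/nd_nnsfun_approx.
have mfn n : measurable_fun setT (fun x => (fn n x)%:E).
  by apply/measurable_EFinP; exact: measurable_funP.
have step n : (\int[nu]_x (fn n x)%:E = \int[m]_x ((fn n x)%:E * (g x)%:E))%E.
  transitivity (\int[nu]_x (\sum_(y \in range (fn n)) (y * \1_(fn n @^-1` [set y]) x)%:E))%E.
    by apply: eq_integral => t _; rewrite /= fimfunE -fsumEFin.
  have mind r : measurable_fun setT (fun x => (r * \1_(fn n @^-1` [set r]) x)%:E).
    by apply/measurable_EFinP; exact: measurable_funM.
  rewrite ge0_integral_fsum//; last by move=> y x _; exact: nnfun_muleindic_ge0.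
  transitivity (\int[m]_x (\sum_(y \in range (fn n)) (y * \1_(fn n @^-1` [set y]) x)%:E * (g x)%:E))%E; last first.
    apply: eq_integral => x _; rewrite -ge0_mule_fsuml => [|y]; last exact: nnfun_muleindic_ge0.
    by rewrite fsumEFin // -(fimfunE _ x).
  rewrite ge0_integral_fsum//; last 2 first.
  - by move=> y; apply: emeasurable_funM => //; exact/measurable_EFinP.
  - by move=> y x _; apply: mule_ge0; [exact: nnfun_muleindic_ge0|rewrite lee_fin].
  apply: eq_fsbigr => r; rewrite inE => -[z _ <-].
  have r0 : 0 <= fn n z by [].
  set A := fn n @^-1` _.
  have mA : measurable A by exact: measurable_funPTI.
  under eq_integral do rewrite EFinM.
  under [RHS]eq_integral do rewrite EFinM -muleA.
  rewrite !ge0_integralZl ?lee_fin//.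
  - congr (_ * _)%E; rewrite integral_indic// setIT nuE// [LHS]integral_mkcond.
    apply: eq_integral => x _; rewrite patchE indicE; case: ifPn => _; first by rewrite mul1e.
    by rewrite mul0e.
  - by apply: emeasurable_funM; apply/measurable_EFinP => //; exact: measurable_indic.
  - by move=> x _; rewrite mule_ge0 ?lee_fin.
  - exact/measurable_EFinP.
have L1 : (\int[nu]_x f x = limn (fun n => \int[nu]_x (fn n x)%:E))%E.
  rewrite -monotone_convergence//; last 2 first.
  - by move=> n x _; rewrite lee_fin.
  - by move=> x _ a b ab; rewrite lee_fin; exact: fnnd.
  by apply: eq_integral => x _; apply/esym/cvg_lim => //; exact: fncvg.
have L2 : (\int[m]_x (f x * (g x)%:E) = limn (fun n => \int[m]_x ((fn n x)%:E * (g x)%:E)))%E.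
  rewrite -monotone_convergence//; last 3 first.
  - by move=> n; apply: emeasurable_funM => //; exact/measurable_EFinP.
  - by move=> n x _; rewrite mule_ge0 ?lee_fin.
  - by move=> x _ a b ab; rewrite lee_wpmul2r ?lee_fin//; exact: fnnd.
  apply: eq_integral => x _; apply/esym/cvg_lim => //.
  by apply: cvgeZr => //; exact: fncvg.
rewrite L1 L2; congr (limn _); apply/funext => n; exact: step.
Qed.

(** Completing the square exhibits a multiple of the normal density with mean [b / a] and variance
    [1 / (2 a)]. *)
Lemma integral_expR_quadratic (a b : R) : 0 < a ->
  (\int[mu]_x (expR (- (a * x ^+ 2) + 2 * b * x))%:E =
   (Num.sqrt (pi / a) * expR (b ^+ 2 / a))%:E)%E.
Proof.
move=> a0.
pose s := Num.sqrt ((2 * a)^-1).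
have a2 : 0 < (2 * a)^-1 by rewrite invr_gt0 mulr_gt0.
have s0 : 0 < s by rewrite sqrtr_gt0.
have s2 : s ^+ 2 = (2 * a)^-1 by rewrite sqr_sqrtr// ltW.
have pa0 : 0 < pi / a by rewrite divr_gt0// pi_gt0.
have E x : expR (- (a * x ^+ 2) + 2 * b * x) =
    Num.sqrt (pi / a) * expR (b ^+ 2 / a) * normal_pdf (b / a) s x.
  rewrite normal_pdfE ?gt_eqF// /normal_peak /normal_fun.
  rewrite s2 (_ : (2 * a)^-1 * pi *+ 2 = pi / a); last first.
    by rewrite -mulr_natr; field; rewrite gt_eqF.
  rewrite mulrACA mulfV ?mul1r; last by rewrite gt_eqF// sqrtr_gt0.
  rewrite -expRD; congr expR.
  rewrite -mulr_natr; field; by rewrite gt_eqF.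
under eq_integral do rewrite E EFinM.
rewrite ge0_integralZl//.
- by rewrite integral_normal_pdf ?mule1// gt_eqF.
- by apply/measurable_EFinP; exact: measurable_normal_pdf.
- by move=> x _; rewrite lee_fin normal_pdf_ge0.
Qed.

Lemma integral_std_complex_gaussian d (T : measurableType d) (P : probability T R) (Z : T -> R[i])
    (f : measurableTypeR R * measurableTypeR R -> \bar R) :
  std_complex_gaussian P Z -> measurable_fun setT f -> (forall z, 0 <= f z)%E ->
  (\int[P]_w f (reim (Z w)) =
   \int[mu]_x \int[mu]_y (f (x, y) * (pi^-1 * expR (- (x ^+ 2 + y ^+ 2)))%:E))%E.
Proof.
move=> [mZ HZ] mf f0.
pose X : T -> measurableTypeR R * measurableTypeR R := fun w => reim (Z w).
have mX : measurable_fun setT X by exact: mZ.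
pose g (z : measurableTypeR R * measurableTypeR R) : R := pi^-1 * expR (- (z.1 ^+ 2 + z.2 ^+ 2)).
have mg : measurable_fun setT g.
  apply: measurable_funM => //; apply: measurableT_comp; first exact: measurable_expR.
  apply: measurableT_comp => //; apply: measurable_funD; apply: measurable_funX.
    exact: measurable_fst.
  exact: measurable_snd.
have g0 z : 0 <= g z by rewrite mulr_ge0 ?expR_ge0// invr_ge0 pi_ge0.
transitivity (\int[pushforward P X]_z f z)%E.
  by rewrite (ge0_integral_pushforward mX)// => z _; exact: f0.
rewrite (@ge0_integral_density _ _ (mu \x mu)%E (pushforward P X) g f mg g0 _ mf f0); last first.
  by move=> A mA; exact: HZ.
rewrite fubini_tonelli1//.
- by apply: emeasurable_funM => //; exact/measurable_EFinP.
- by move=> z; rewrite mule_ge0// lee_fin.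
Qed.

(** The density raises the quadratic coefficient to [1 + a], and the integral splits into one over
    the real part and one over the imaginary part. Each yields a root of [pi / (1 + a)], whose
    square cancels the factor [pi^-1]. *)
Lemma gaussian_exp_quadratic d (T : measurableType d) (P : probability T R) (Z : T -> R[i])
    (a c1 c2 : R) : std_complex_gaussian P Z -> 0 <= a ->
  (\int[P]_w (expR (- (a * ((complex.Re (Z w)) ^+ 2 + (complex.Im (Z w)) ^+ 2))
     - 2 * (c1 * complex.Re (Z w) + c2 * complex.Im (Z w))))%:E =
   ((1 + a)^-1 * expR ((c1 ^+ 2 + c2 ^+ 2) / (1 + a)))%:E)%E.
Proof.
move=> GZ a0; have a1 : 0 < 1 + a by rewrite ltr_wpDr.
pose f (z : measurableTypeR R * measurableTypeR R) : \bar R :=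
  (expR (- (a * (z.1 ^+ 2 + z.2 ^+ 2)) - 2 * (c1 * z.1 + c2 * z.2)))%:E.
have m1 : measurable_fun setT (fun z : measurableTypeR R * measurableTypeR R => (z.1 : R)).
  exact: measurable_fst.
have m2 : measurable_fun setT (fun z : measurableTypeR R * measurableTypeR R => (z.2 : R)).
  exact: measurable_snd.
have mf : measurable_fun setT f.
  apply/measurable_EFinP; apply: measurableT_comp; first exact: measurable_expR.
  apply: measurable_funB.
    apply: measurableT_comp => //; apply: measurable_funM => //.
    by apply: measurable_funD; exact: measurable_funX.
  by apply: measurable_funM => //; apply: measurable_funD; exact: measurable_funM.
have f0 z : (0 <= f z)%E by rewrite lee_fin expR_ge0.
rewrite (integral_std_complex_gaussian GZ mf f0).
have split_exp (x y : R) :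
    expR (- (a * (x ^+ 2 + y ^+ 2)) - 2 * (c1 * x + c2 * y)) * (pi^-1 * expR (- (x ^+ 2 + y ^+ 2))) =
    pi^-1 * expR (- ((1 + a) * x ^+ 2) + 2 * (- c1) * x) * expR (- ((1 + a) * y ^+ 2) + 2 * (- c2) * y).
  rewrite mulrCA -[in RHS]mulrA -!expRD; congr (_ * expR _); ring.
have E x : (\int[mu]_y (f (x, y) * (pi^-1 * expR (- (x ^+ 2 + y ^+ 2)))%:E) =
  (pi^-1 * (Num.sqrt (pi / (1 + a)) * expR (c2 ^+ 2 / (1 + a))))%:E *
    (expR (- ((1 + a) * x ^+ 2) + 2 * (- c1) * x))%:E)%E.
  transitivity (\int[mu]_y ((pi^-1 * expR (- ((1 + a) * x ^+ 2) + 2 * (- c1) * x))%:E *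
     (expR (- ((1 + a) * y ^+ 2) + 2 * (- c2) * y))%:E))%E.
    apply: eq_integral => y _; rewrite /f /= -!EFinM; congr _%:E.
    exact: split_exp.
  rewrite ge0_integralZl//; last 2 first.
  - apply/measurable_EFinP; apply: measurableT_comp; first exact: measurable_expR.
    apply: measurable_funD; last exact: measurable_funM.
    by apply: measurableT_comp => //; apply: measurable_funM => //; exact: measurable_funX.
  - by rewrite lee_fin mulr_ge0 ?expR_ge0// invr_ge0 pi_ge0.
  rewrite integral_expR_quadratic// -!EFinM sqrrN; congr _%:E; ring.
under eq_integral do rewrite E.
rewrite ge0_integralZl//; last 2 first.
- apply/measurable_EFinP; apply: measurableT_comp; first exact: measurable_expR.
  apply: measurable_funD; last exact: measurable_funM.
  by apply: measurableT_comp => //; apply: measurable_funM => //; exact: measurable_funX.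
- by rewrite lee_fin mulr_ge0 ?invr_ge0 ?pi_ge0// mulr_ge0 ?expR_ge0// sqrtr_ge0.
rewrite integral_expR_quadratic// -EFinM sqrrN; congr _%:E.
have pa0 : 0 <= pi / (1 + a) by rewrite divr_ge0 ?pi_ge0 ?(ltW a1).
have := sqr_sqrtr pa0; set s := Num.sqrt _ => s2.
rewrite mulrDl expRD.
transitivity (pi^-1 * s ^+ 2 * (expR (c1 ^+ 2 / (1 + a)) * expR (c2 ^+ 2 / (1 + a)))); first by ring.
by rewrite s2 (mulrA pi^-1) mulVf ?mul1r// gt_eqF// pi_gt0.
Qed.

End gaussian_density.

(** * Random matrices *)

Section measurable_matrices.
Context {R : realType} {d : measure_display} {T : measurableType d}.
Local Open Scope sesquilinear_scope.
Implicit Types Z : T -> R[i].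

Lemma complex_random_variableP Z : complex_random_variable Z <->
  measurable_fun setT (fun w => complex.Re (Z w)) /\ measurable_fun setT (fun w => complex.Im (Z w)).
Proof.
split=> [mZ|[mR mI]]; last exact: measurable_fun_pair.
split; first exact: (measurableT_comp measurable_fst mZ).
exact: (measurableT_comp measurable_snd mZ).
Qed.

Lemma complex_random_variable_cst (c : R[i]) : complex_random_variable (fun _ : T => c).
Proof. exact: measurable_cst. Qed.

Lemma complex_random_variableD Z Z' : complex_random_variable Z -> complex_random_variable Z' ->
  complex_random_variable (fun w => Z w + Z' w).
Proof.
move=> /complex_random_variableP[mR mI] /complex_random_variableP[mR' mI'].
apply/complex_random_variableP; split.
  by rewrite (_ : (fun w => _) = (fun w => complex.Re (Z w) + complex.Re (Z' w)));
    [exact: measurable_funD|apply/funext => w; case: (Z w) => ? ?; case: (Z' w)].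
by rewrite (_ : (fun w => _) = (fun w => complex.Im (Z w) + complex.Im (Z' w)));
  [exact: measurable_funD|apply/funext => w; case: (Z w) => ? ?; case: (Z' w)].
Qed.

Lemma complex_random_variableM Z Z' : complex_random_variable Z -> complex_random_variable Z' ->
  complex_random_variable (fun w => Z w * Z' w).
Proof.
move=> /complex_random_variableP[mR mI] /complex_random_variableP[mR' mI'].
apply/complex_random_variableP; split.
  rewrite (_ : (fun w => _) = (fun w => complex.Re (Z w) * complex.Re (Z' w) - complex.Im (Z w) * complex.Im (Z' w)));
    last by apply/funext => w; case: (Z w) => ? ?; case: (Z' w).
  by apply: measurable_funB; exact: measurable_funM.
rewrite (_ : (fun w => _) = (fun w => complex.Re (Z w) * complex.Im (Z' w) + complex.Im (Z w) * complex.Re (Z' w)));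
  last by apply/funext => w; case: (Z w) => ? ?; case: (Z' w).
by apply: measurable_funD; exact: measurable_funM.
Qed.

Lemma complex_random_variable_conj Z : complex_random_variable Z ->
  complex_random_variable (fun w => (Z w)^*).
Proof.
move=> /complex_random_variableP[mR mI]; apply/complex_random_variableP; split.
  by rewrite (_ : (fun w => _) = (fun w => complex.Re (Z w)))//; apply/funext => w; case: (Z w).
rewrite (_ : (fun w => _) = (fun w => - complex.Im (Z w))).
  exact: measurableT_comp.
by apply/funext => w; case: (Z w).
Qed.

Lemma complex_random_variable_sum (J : Type) (r : seq J) (P : pred J) (Z : J -> T -> R[i]) :
  (forall j, complex_random_variable (Z j)) ->
  complex_random_variable (fun w => \sum_(j <- r | P j) Z j w).
Proof.
move=> mZ; elim: r => [|j r IH].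
  by under eq_fun do rewrite big_nil; exact: complex_random_variable_cst.
under eq_fun do rewrite big_cons; case: (P j) => //.
exact: complex_random_variableD.
Qed.

Lemma complex_random_variable_prod (J : Type) (r : seq J) (P : pred J) (Z : J -> T -> R[i]) :
  (forall j, complex_random_variable (Z j)) ->
  complex_random_variable (fun w => \prod_(j <- r | P j) Z j w).
Proof.
move=> mZ; elim: r => [|j r IH].
  by under eq_fun do rewrite big_nil; exact: complex_random_variable_cst.
under eq_fun do rewrite big_cons; case: (P j) => //.
exact: complex_random_variableM.
Qed.

Definition measurable_mx m n (A : T -> 'M[R[i]]_(m, n)) : Prop :=
  forall i j, complex_random_variable (fun w => A w i j).

Lemma measurable_mx_cst m n (A : 'M[R[i]]_(m, n)) : measurable_mx (fun _ => A).
Proof. by move=> i j; exact: complex_random_variable_cst. Qed.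

Lemma measurable_mxD m n (A B : T -> 'M[R[i]]_(m, n)) :
  measurable_mx A -> measurable_mx B -> measurable_mx (fun w => A w + B w).
Proof.
by move=> mA mB i j; under eq_fun do rewrite mxE; exact: complex_random_variableD.
Qed.

Lemma measurable_mulmx m n p (A : T -> 'M[R[i]]_(m, n)) (B : T -> 'M[R[i]]_(n, p)) :
  measurable_mx A -> measurable_mx B -> measurable_mx (fun w => A w *m B w).
Proof.
move=> mA mB i j; under eq_fun do rewrite mxE.
by apply: complex_random_variable_sum => k; exact: complex_random_variableM.
Qed.

Lemma measurable_trmxC m n (A : T -> 'M[R[i]]_(m, n)) :
  measurable_mx A -> measurable_mx (fun w => (A w) ^t*).
Proof.
move=> mA i j; under eq_fun do rewrite !mxE.
exact: complex_random_variable_conj.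
Qed.

Lemma measurable_col_mx m1 m2 n (A : T -> 'M[R[i]]_(m1, n)) (B : T -> 'M[R[i]]_(m2, n)) :
  measurable_mx A -> measurable_mx B -> measurable_mx (fun w => col_mx (A w) (B w)).
Proof.
move=> mA mB i j; under eq_fun do rewrite mxE.
by case: (fintype.split i) => k; [exact: mA|exact: mB].
Qed.

Lemma measurable_det n (A : T -> 'M[R[i]]_n) :
  measurable_mx A -> complex_random_variable (fun w => \det (A w)).
Proof.
move=> mA; apply: complex_random_variable_sum => s.
apply: complex_random_variableM; first exact: complex_random_variable_cst.
by apply: complex_random_variable_prod => i; exact: mA.
Qed.

Lemma measurable_Re Z : complex_random_variable Z ->
  measurable_fun setT (fun w => complex.Re (Z w)).
Proof. by move=> /complex_random_variableP[]. Qed.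

End measurable_matrices.

Section gaussian_matrices.
Context {R : realType}.
Local Open Scope sesquilinear_scope.

Definition gaussian_mx d (T : measurableType d) (P : probability T R) m n
    (A : T -> 'M[R[i]]_(m, n)) : Prop :=
  gaussian_family P (fun (e : 'I_m * 'I_n) w => A w e.1 e.2).

Definition borel_mx m n (F : 'M[R[i]]_(m, n) -> \bar R) : Prop :=
  forall d (T : measurableType d) (A : T -> 'M[R[i]]_(m, n)),
    measurable_mx A -> measurable_fun setT (fun w => F (A w)).

Lemma borel_mx_functional m n (F : 'M[R[i]]_(m, n) -> \bar R) : borel_mx F ->
  borel_functional (fun z : 'I_m * 'I_n -> R[i] => F (\matrix_(i, j) z (i, j))).
Proof.
move=> bF d T Z mZ; apply: (bF _ _ (fun w => \matrix_(i, j) Z (i, j) w)) => i j.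
by under eq_fun do rewrite mxE; exact: mZ.
Qed.

Lemma gaussian_mx_measurable d (T : measurableType d) (P : probability T R) m n
    (A : T -> 'M[R[i]]_(m, n)) : gaussian_mx P A -> measurable_mx A.
Proof. by move=> GA i j; exact: (gaussian_family_measurable GA (i, j)). Qed.

Lemma gaussian_mxsub d (T : measurableType d) (P : probability T R) m n m' n'
    (f : 'I_m' -> 'I_m) (g : 'I_n' -> 'I_n) (A : T -> 'M[R[i]]_(m, n)) :
  injective f -> injective g -> gaussian_mx P A -> gaussian_mx P (fun w => mxsub f g (A w)).
Proof.
move=> fI gI GA; rewrite /gaussian_mx.
have := @gaussian_family_reindex R _ T P _ _ _ (fun e : 'I_m' * 'I_n' => (f e.1, g e.2)) _ GA.
rewrite (_ : (fun i : 'I_m' * 'I_n' => _) = (fun e w => (mxsub f g (A w)) e.1 e.2)).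
  by apply=> -[i j] [i' j'] /= [/fI -> /gI ->].
by apply/funext => e; apply/funext => w; rewrite mxE.
Qed.

Lemma gaussian_mx_tr d (T : measurableType d) (P : probability T R) m n
    (A : T -> 'M[R[i]]_(m, n)) : gaussian_mx P A -> gaussian_mx P (fun w => (A w)^T).
Proof.
move=> GA; rewrite /gaussian_mx.
have := @gaussian_family_reindex R _ T P _ _ _ (fun e : 'I_n * 'I_m => (e.2, e.1)) _ GA.
rewrite (_ : (fun i : 'I_n * 'I_m => _) = (fun e w => (A w)^T e.1 e.2)).
  by apply=> -[i j] [i' j'] /= [-> ->].
by apply/funext => e; apply/funext => w; rewrite mxE.
Qed.

Lemma gaussian_usubmx d (T : measurableType d) (P : probability T R) m1 m2 n
    (A : T -> 'M[R[i]]_(m1 + m2, n)) : gaussian_mx P A -> gaussian_mx P (fun w => usubmx (A w)).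
Proof.
move=> GA; have := gaussian_mxsub (@lshift_inj m1 m2) (@inj_id 'I_n) GA.
by congr gaussian_mx; apply/funext => w; apply/matrixP => i j; rewrite !mxE.
Qed.

Lemma gaussian_dsubmx d (T : measurableType d) (P : probability T R) m1 m2 n
    (A : T -> 'M[R[i]]_(m1 + m2, n)) : gaussian_mx P A -> gaussian_mx P (fun w => dsubmx (A w)).
Proof.
move=> GA; have := gaussian_mxsub (@rshift_inj m1 m2) (@inj_id 'I_n) GA.
by congr gaussian_mx; apply/funext => w; apply/matrixP => i j; rewrite !mxE.
Qed.

Lemma gaussian_lsubmx d (T : measurableType d) (P : probability T R) m n1 n2
    (A : T -> 'M[R[i]]_(m, n1 + n2)) : gaussian_mx P A -> gaussian_mx P (fun w => lsubmx (A w)).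
Proof.
move=> GA; have := gaussian_mxsub (@inj_id 'I_m) (@lshift_inj n1 n2) GA.
by congr gaussian_mx; apply/funext => w; apply/matrixP => i j; rewrite !mxE.
Qed.

Lemma gaussian_rsubmx d (T : measurableType d) (P : probability T R) m n1 n2
    (A : T -> 'M[R[i]]_(m, n1 + n2)) : gaussian_mx P A -> gaussian_mx P (fun w => rsubmx (A w)).
Proof.
move=> GA; have := gaussian_mxsub (@inj_id 'I_m) (@rshift_inj n1 n2) GA.
by congr gaussian_mx; apply/funext => w; apply/matrixP => i j; rewrite !mxE.
Qed.

(** [integral_decouple] with [A] itself as the second copy: the inner variable [w'] draws the upper
    block while the lower one is frozen at [w]. *)
Lemma integral_gaussian_col_mx d (T : measurableType d) (P : probability T R) m1 m2 n
    (A : T -> 'M[R[i]]_(m1 + m2, n)) (F : 'M[R[i]]_(m1 + m2, n) -> \bar R) :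
  gaussian_mx P A -> borel_mx F -> (forall X, 0 <= F X)%E ->
  (\int[P]_w F (A w) = \int[P]_w \int[P]_w' F (col_mx (usubmx (A w')) (dsubmx (A w))))%E.
Proof.
move=> GA bF F0.
have := integral_decouple [set e : 'I_(m1 + m2) * 'I_n | (e.1 < m1)%N]%SET GA GA (borel_mx_functional bF) (fun z => F0 _).
have E (X : 'M[R[i]]_(m1 + m2, n)) : \matrix_(i, j) X (i, j).1 (i, j).2 = X.
  by apply/matrixP => i j; rewrite mxE.
under eq_integral do rewrite E.
move=> ->; apply: eq_integral => w _; apply: eq_integral => w' _; congr F.
apply/matrixP => i j; rewrite !mxE inE /=.
by case: splitP => k ik; rewrite !mxE; congr (A _ _ _); exact/val_inj.
Qed.

Lemma integral_gaussian_row_mx d (T : measurableType d) (P : probability T R) m n1 n2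
    (A : T -> 'M[R[i]]_(m, n1 + n2)) (F : 'M[R[i]]_(m, n1 + n2) -> \bar R) :
  gaussian_mx P A -> borel_mx F -> (forall X, 0 <= F X)%E ->
  (\int[P]_w F (A w) = \int[P]_w \int[P]_w' F (row_mx (lsubmx (A w')) (rsubmx (A w))))%E.
Proof.
move=> GA bF F0.
have := integral_decouple [set e : 'I_m * 'I_(n1 + n2) | (e.2 < n1)%N]%SET GA GA (borel_mx_functional bF) (fun z => F0 _).
have E (X : 'M[R[i]]_(m, n1 + n2)) : \matrix_(i, j) X (i, j).1 (i, j).2 = X.
  by apply/matrixP => i j; rewrite mxE.
under eq_integral do rewrite E.
move=> ->; apply: eq_integral => w _; apply: eq_integral => w' _; congr F.
apply/matrixP => i j; rewrite !mxE inE /=.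
by case: splitP => k ik; rewrite !mxE; congr (A _ _ _); exact/val_inj.
Qed.

End gaussian_matrices.

(** * Real parts of complex numbers *)

Section complex_real_part.
Context {R : realType}.
Implicit Types z : R[i].

Lemma complex_ReD z z' : complex.Re (z + z') = complex.Re z + complex.Re z'.
Proof. by case: z => ? ?; case: z'. Qed.

Lemma complex_ReB z z' : complex.Re (z - z') = complex.Re z - complex.Re z'.
Proof. by case: z => ? ?; case: z'. Qed.

Lemma complex_ReM_ge0 z z' : 0 <= z -> complex.Re (z * z') = complex.Re z * complex.Re z'.
Proof. by move=> /ger0_Im; case: z => x y /= ->; case: z' => u v /=; rewrite mul0r subr0. Qed.

Lemma complex_Re_ge0 z : 0 <= z -> 0 <= complex.Re z.
Proof. by rewrite lecE => /andP[]. Qed.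

Lemma complex_Re_realK z : 0 <= z -> real_complex R (complex.Re z) = z.
Proof. by move=> /ger0_Im; case: z => x y /= ->. Qed.

Lemma complex_Re_inv z : 0 <= z -> complex.Re z^-1 = (complex.Re z)^-1.
Proof.
move=> z0; rewrite -[in LHS](complex_Re_realK z0) -[in LHS]fmorphV//.
Qed.

Lemma complex_Re_sqr_norm z : complex.Re (z * z^*) = complex.Re z ^+ 2 + complex.Im z ^+ 2.
Proof. by case: z => x y /=; rewrite !expr2; ring. Qed.

Lemma complex_Re_cross z c :
  complex.Re (z * c^* + z^* * c) = 2 * (complex.Re c * complex.Re z + complex.Im c * complex.Im z).
Proof. by case: z => x y; case: c => u v /=; ring. Qed.

End complex_real_part.

(** * Hermitian forms in a Gaussian row *)

Section gaussian_quadratic_forms.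
Context {R : realType}.
Local Open Scope sesquilinear_scope.
Local Notation mu := (@lebesgue_measure R).

Definition formmx n (M : 'M[R[i]]_n) (q : 'rV[R[i]]_n) : R :=
  complex.Re ((q *m M *m q ^t*) 0 0).

Lemma formmx_ge0 n (M : 'M[R[i]]_n) q : psdmx M -> 0 <= formmx M q.
Proof. by move=> [_ H]; apply: complex_Re_ge0. Qed.

Lemma formmxZ n (M : 'M[R[i]]_n) (t : R) q : 0 <= t ->
  formmx (real_complex R t *: M) q = t * formmx M q.
Proof.
move=> t0; rewrite /formmx -scalemxAr -scalemxAl mxE complex_ReM_ge0//.
by rewrite ler0c.
Qed.

Lemma measurable_formmx d (T : measurableType d) n (M : 'M[R[i]]_n) (q : T -> 'rV[R[i]]_n) :
  measurable_mx q -> measurable_fun setT (fun w => formmx M (q w)).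
Proof.
move=> mq; apply: measurable_Re.
have := measurable_mulmx (measurable_mulmx mq (measurable_mx_cst M)) (measurable_trmxC mq).
exact.
Qed.

(** Induction on the length: integrating out the first coordinate by [gaussian_exp_quadratic] leaves
    the factor [(1 + a)^-1] and the form of [schur_shift M], exactly as the determinant splits in
    [det_1add_schur]. *)
Lemma gaussian_row_laplace n (M : 'M[R[i]]_n) d (T : measurableType d) (P : probability T R)
    (q : T -> 'rV[R[i]]_n) : gaussian_mx P q -> psdmx M ->
  (\int[P]_w (expR (- formmx M (q w)))%:E = ((complex.Re (\det (1%:M + M)))^-1)%:E)%E.
Proof.
elim: n => [|n IH] in M q * => Gq pM.
  rewrite det_mx00 /= invr1 -[RHS](integral_prob_cst P); apply: eq_integral => w _.
  by rewrite /formmx mxE big_ord0 /= oppr0 expR0.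
rewrite -[n.+1]/(1 + n)%N in M q Gq pM *.
have bF : borel_mx (fun X : 'rV[R[i]]_(1 + n) => (expR (- formmx M X))%:E).
  move=> d0 T0 A mA; apply/measurable_EFinP; apply: measurableT_comp; first exact: measurable_expR.
  by apply: measurableT_comp => //; exact: measurable_formmx.
rewrite (integral_gaussian_row_mx Gq bF); last by move=> X; rewrite lee_fin expR_ge0.
have Gl := gaussian_lsubmx Gq; have Gr := gaussian_rsubmx Gq.
have a0 := schur_corner_ge0 pM.
set a := ulsubmx M 0 0 in a0.
pose b : 'rV[R[i]]_n := ursubmx M; pose D : 'M[R[i]]_n := drsubmx M.
pose al := complex.Re a.
have al0 : 0 <= al by exact: complex_Re_ge0.
pose S := schur_shift M; have pS := psdmx_schur_shift pM.
have Gz : std_complex_gaussian P (fun w => lsubmx (q w) 0 0).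
  by have [/(_ (0, 0))] := Gl.
have inner w : (\int[P]_w' (expR (- formmx M (row_mx (lsubmx (q w')) (rsubmx (q w)))))%:E =
    ((1 + al)^-1)%:E * (expR (- formmx S (rsubmx (q w))))%:E)%E.
  set r := rsubmx (q w); pose c := (r *m b ^t*) 0 0.
  have E w' : expR (- formmx M (row_mx (lsubmx (q w')) r)) =
    expR (- formmx D r) * expR (- (al * ((complex.Re (lsubmx (q w') 0 0)) ^+ 2 + (complex.Im (lsubmx (q w') 0 0)) ^+ 2))
     - 2 * (complex.Re c * complex.Re (lsubmx (q w') 0 0) + complex.Im c * complex.Im (lsubmx (q w') 0 0))).
    rewrite -expRD; congr expR.
    rewrite /formmx [lsubmx (q w')]mx11_scalar (psdmx_form_block pM) -/a -/b -/D -/c.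
    set z := lsubmx _ 0 0; rewrite -(mx11_scalar (lsubmx (q w'))) -/z.
    rewrite complex_ReD -addrA complex_ReD complex_Re_cross complex_ReM_ge0// complex_Re_sqr_norm.
    by rewrite /al; ring.
  under eq_integral do rewrite E EFinM.
  rewrite ge0_integralZl//; last first.
  - apply/measurable_EFinP; apply: measurableT_comp; first exact: measurable_expR.
    have [mz _] := Gz; have /complex_random_variableP[mR mI] := mz.
    apply: measurable_funB.
      apply: measurableT_comp => //; apply: measurable_funM => //.
      by apply: measurable_funD; exact: measurable_funX.
    by apply: measurable_funM => //; apply: measurable_funD; exact: measurable_funM.
  rewrite (gaussian_exp_quadratic _ _ Gz al0) -!EFinM; congr _%:E.
  rewrite mulrCA; congr (_ * _); rewrite -expRD; congr expR.
  rewrite [in RHS]/formmx (schur_shift_form M) -/b -/D -/c -/a complex_ReB.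
  rewrite complex_ReM_ge0; last by rewrite invr_ge0 addr_ge0.
  rewrite complex_Re_inv ?addr_ge0// complex_ReD -/al complex_Re_sqr_norm /formmx.
  by rewrite /=; field; rewrite gt_eqF// ltr_wpDr.
under eq_integral do rewrite inner.
rewrite ge0_integralZl//; last 2 first.
- apply/measurable_EFinP; apply: measurableT_comp; first exact: measurable_expR.
  by apply: measurableT_comp => //; apply: measurable_formmx; exact: gaussian_mx_measurable Gr.
- by rewrite lee_fin invr_ge0 addr_ge0.
rewrite (IH S _ Gr pS) (det_1add_schur pM) complex_ReM_ge0 ?addr_ge0// complex_ReD -/a -/al.
by rewrite -EFinM invfM.
Qed.

Lemma laplace_gaussian_row n (M : 'M[R[i]]_n) d (T : measurableType d) (P : probability T R)
    (q : T -> 'rV[R[i]]_n) (a t : R) : gaussian_mx P q -> psdmx M -> 0 <= t ->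
  laplace P setT (fun=> 1) (fun w => a + formmx M (q w)) t =
  (expR (- (t * a)) * (complex.Re (\det (1%:M + real_complex R t *: M)))^-1)%:E.
Proof.
move=> Gq pM t0.
have t0' : 0 <= real_complex R t by rewrite ler0c.
rewrite EFinM -(gaussian_row_laplace Gq (psdmxZ t0' pM)) -ge0_integralZl//; last first.
- apply/measurable_EFinP; apply: measurableT_comp; first exact: measurable_expR.
  apply: measurableT_comp => //; apply: measurable_formmx; exact: gaussian_mx_measurable Gq.
apply: eq_integral => w _; rewrite -EFinM mul1r -expRD formmxZ//; congr (expR _)%:E; ring.
Qed.

Lemma eq_gaussian_row_moment n m (M : 'M[R[i]]_n) (M' : 'M[R[i]]_m)
    d (T : measurableType d) (P : probability T R) (q : T -> 'rV[R[i]]_n)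
    d' (T' : measurableType d') (P' : probability T' R) (q' : T' -> 'rV[R[i]]_m) (a s : R) :
  gaussian_mx P q -> gaussian_mx P' q' -> psdmx M -> psdmx M' -> 0 <= a -> 0 < s < 1 ->
  (forall t : R, \det (1%:M + real_complex R t *: M) = \det (1%:M + real_complex R t *: M')) ->
  (\int[P]_w ((a + formmx M (q w)) `^ s)%:E = \int[P']_w ((a + formmx M' (q' w)) `^ s)%:E)%E.
Proof.
move=> Gq Gq' pM pM' a0 s01 E.
under eq_integral do rewrite -[_ `^ s]mul1r.
under [RHS]eq_integral do rewrite -[_ `^ s]mul1r.
apply: eq_powR_moment => //.
- by apply: measurable_funD => //; apply: measurable_formmx; exact: gaussian_mx_measurable Gq.
- by move=> w; rewrite addr_ge0// formmx_ge0.
- by apply: measurable_funD => //; apply: measurable_formmx; exact: gaussian_mx_measurable Gq'.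
- by move=> w; rewrite addr_ge0// formmx_ge0.
- by rewrite laplace_gaussian_row// ltry.
- by move=> t t0; rewrite !laplace_gaussian_row// E.
Qed.

Lemma gaussian_row_gamma_moment n (M : 'M[R[i]]_n) r
    d (T : measurableType d) (P : probability T R) (q : T -> 'rV[R[i]]_n) (s : R) :
  gaussian_mx P q -> psdmx M -> 0 < s < 1 ->
  (forall t : R, 0 <= t -> \det (1%:M + real_complex R t *: M) = (1 + real_complex R t) ^+ r.+1) ->
  (\int[P]_w ((formmx M (q w)) `^ s)%:E = (Gamma_fun (r.+1%:R + s) / Gamma_fun r.+1%:R)%:E)%E.
Proof.
move=> Gq pM s01 E.
have r0 : (0 : R) < r.+1%:R by [].
have s0 : 0 < s by case/andP: s01.
have G0 := Gamma_fun_gt0 r0.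
(* The Gamma density of shape [r + 1], extended by 0. The absolute value in [X] keeps the variable
   nonnegative everywhere and changes nothing where [h] is nonzero. *)
pose h (x : measurableTypeR R) : R := \1_(`]0%R, +oo[%classic : set R) x * ((Gamma_fun r.+1%:R)^-1 * (x `^ (r.+1%:R - 1) * expR (- (1 * x)))).
pose X (x : measurableTypeR R) : R := `|x|.
have mh : measurable_fun setT h.
  apply: measurable_funM; first exact: measurable_indic.
  by apply: measurable_funM => //; exact: measurable_gamma_integrand.
have mX : measurable_fun setT X by exact: normr_measurable.
have h0 x : 0 <= h x by rewrite mulr_ge0// mulr_ge0 ?gamma_integrand_ge0// invr_ge0 ltW.
have X0 x : 0 <= X x by exact: normr_ge0.
have hint (f : R -> R) : measurable_fun setT f -> (forall x, 0 <= f x) ->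
   (\int[mu]_x (h x * f (X x))%:E =
    (Gamma_fun r.+1%:R)^-1%:E * \int[mu]_(x in `]0%R, +oo[) (x `^ (r.+1%:R - 1) * expR (- (1 * x)) * f x)%:E)%E.
  move=> mf f0; rewrite -ge0_integralZl//; last 3 first.
  - apply/measurable_EFinP; apply: measurable_funM; first exact: measurable_gamma_integrand.
    exact: measurable_funTS.
  - by move=> x _; rewrite lee_fin mulr_ge0// gamma_integrand_ge0.
  - by rewrite lee_fin invr_ge0 ltW.
  rewrite [RHS]integral_mkcond; apply: eq_integral => x _.
  rewrite patchE /h indicE; case: ifPn => [/set_mem/=|_]; last by rewrite !mul0r.
  rewrite in_itv/= andbT => x0; rewrite mul1r /X ger0_norm ?(ltW x0)//.
  by rewrite -EFinM -!mulrA mul1r.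
have Lh t : 0 <= t -> laplace mu setT h X t = ((1 + t) `^ (- r.+1%:R))%:E.
  move=> t0; have t1 : 0 < 1 + t by rewrite ltr_wpDr.
  rewrite /laplace (hint (fun x => expR (- (t * x)))); last 2 first.
  - by apply: measurableT_comp; [exact: measurable_expR|apply: measurableT_comp => //; exact: measurable_funM].
  - by move=> x; rewrite expR_ge0.
  have -> : (\int[mu]_(x in `]0%R, +oo[) (x `^ (r.+1%:R - 1) * expR (- (1 * x)) * expR (- (t * x)))%:E = gamma_integral r.+1%:R (1 + t))%E.
    by apply: eq_integral => x _; congr _%:E; rewrite -mulrA -expRD; congr (_ * expR _); ring.
  rewrite gamma_integralE// -EFinM; congr _%:E.
  by rewrite mulrCA mulVf ?mulr1// gt_eqF.
have LP t : 0 <= t -> laplace P setT (fun=> 1) (fun w => formmx M (q w)) t = ((1 + t) `^ (- r.+1%:R))%:E.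
  move=> t0; have t1 : 0 < 1 + t by rewrite ltr_wpDr.
  have := laplace_gaussian_row 0 Gq pM t0.
  rewrite mulr0 oppr0 expR0 mul1r E// => H.
  rewrite (_ : (fun w => formmx M (q w)) = (fun w => 0 + formmx M (q w))); last by apply/funext => w; rewrite add0r.
  rewrite H; congr _%:E; rewrite powRN powR_mulrn ?(ltW t1)//; congr (_^-1).
  by rewrite -(rmorph1 (real_complex R)) -rmorphD -rmorphXn.
under eq_integral do rewrite -[_ `^ s]mul1r.
rewrite (@eq_powR_moment R _ _ P _ _ _ _ mu h X)//.
- rewrite (hint (fun x => x `^ s)); last 2 first.
  + exact: measurable_powR.
  + by move=> x; exact: powR_ge0.
  rewrite mulrC EFinM; congr (_ * _)%E.
  rewrite Gamma_fun_EFin ?addr_gt0//; apply: eq_integral => x /set_mem/=.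
  rewrite in_itv/= andbT => x0; congr _%:E; rewrite mulrAC -powRD ?(gt_eqF x0) ?implybT//.
  by congr (_ `^ _ * _); ring.
- by apply: measurable_formmx; exact: gaussian_mx_measurable Gq.
- by move=> w; rewrite formmx_ge0.
- by rewrite LP// ltry.
- by move=> t t0; rewrite LP// Lh.
Qed.

End gaussian_quadratic_forms.

(** * Moments of Gram determinants *)

Local Open Scope sesquilinear_scope.

(** With [C] square, [C^* G^* G C] is a product of square matrices. The Gram determinant of [G] is
    then transposed because [gaussian_gramT_moment] proceeds by adding rows. *)
Lemma det_gram_mul_sqrt (F : numClosedFieldType) N n m
    (B : 'M[F]_(n, m)) (C : 'M[F]_m) (G : 'M[F]_(N, m)) : C ^t* *m C = B ^t* *m B ->
  \det ((G *m C) ^t* *m (G *m C)) = \det (B ^t* *m B) * \det (G^T *m (G^T) ^t*).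
Proof.
move=> <-; rewrite trmxC_mul mulmxA -(mulmxA _ (G ^t*)) !det_mulmx mulrAC; congr (_ * _).
by rewrite -[LHS]det_tr trmx_mul map_trmx !trmxK.
Qed.

Section gram_moments.
Context {R : realType}.
Local Open Scope sesquilinear_scope.

(** The moment of order [s] of the Gamma law of shape [k]. *)
Definition gamma_ratio (s : R) (k : nat) : R := Gamma_fun (k%:R + s) / Gamma_fun k%:R.

Lemma gamma_ratio_ge0 (s : R) k : 0 <= s -> (0 < k)%N -> 0 <= gamma_ratio s k.
Proof.
move=> s0 k0; have k0' : (0 : R) < k%:R by rewrite ltr0n.
by apply: divr_ge0; apply: ltW; apply: Gamma_fun_gt0 => //; rewrite ltr_pwDl.
Qed.

Definition gram_power m n (s : R) (X : 'M[R[i]]_(m, n)) : R :=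
  (complex.Re (\det (X ^t* *m X))) `^ s.

Lemma det_gram_ge0 m n (X : 'M[R[i]]_(m, n)) : 0 <= \det (X ^t* *m X).
Proof. exact: psdmx_det_ge0 (psdmx_gram X). Qed.

Lemma det_gramT_ge0 m n (X : 'M[R[i]]_(m, n)) : 0 <= \det (X *m X ^t*).
Proof. by have := det_gram_ge0 (X ^t*); rewrite trmxCK. Qed.

Lemma measurable_det_shift_gram d (T : measurableType d) p m n (S : T -> 'M[R[i]]_m)
    (A : T -> 'M[R[i]]_(p, n)) (B : 'M[R[i]]_(n, m)) (s : R) :
  measurable_mx S -> measurable_mx A ->
  measurable_fun setT (fun w => ((complex.Re (\det (S w + (A w *m B) ^t* *m (A w *m B)))) `^ s)%:E).
Proof.
move=> mS mA; apply/measurable_EFinP.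
apply: (measurableT_comp (measurable_powR s)).
apply: measurable_Re; apply: measurable_det; apply: measurable_mxD => //.
have mAB : measurable_mx (fun w => A w *m B) by apply: measurable_mulmx => //; exact: measurable_mx_cst.
by apply: measurable_mulmx => //; exact: measurable_trmxC.
Qed.

(** Given the [p] lower rows, the determinant is theirs times the squared distance of a Gaussian row
    to their span, a form of Gamma law of shape [N - p]. *)
Lemma gaussian_gramT_moment (s : R) : 0 < s < 1 -> forall p N
    d (T : measurableType d) (P : probability T R) (A : T -> 'M[R[i]]_(p, N)),
  (p <= N)%N -> gaussian_mx P A ->
  (\int[P]_w ((complex.Re (\det (A w *m (A w) ^t*))) `^ s)%:E =
   (\prod_(i < p) gamma_ratio s (N - i))%:E)%E.
Proof.
move=> s01 p N d T P; have s0 : 0 < s by case/andP: s01.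
have mD m' n' d0 (T0 : measurableType d0) (X : T0 -> 'M[R[i]]_(m', n')) : measurable_mx X ->
   measurable_fun setT (fun w => ((complex.Re (\det (X w *m (X w) ^t*))) `^ s)%:E).
  move=> mX; apply/measurable_EFinP; apply: (measurableT_comp (measurable_powR s)).
  apply: measurable_Re; apply: measurable_det; apply: measurable_mulmx => //.
  exact: measurable_trmxC.
elim: p => [|p IH] A pN GA.
  rewrite big_ord0 -[RHS](integral_prob_cst P); apply: eq_integral => w _.
  by rewrite det_mx00 /= powR1.
rewrite -[p.+1]/(1 + p)%N in A GA *.
pose F (X : 'M[R[i]]_(1 + p, N)) := ((complex.Re (\det (X *m X ^t*))) `^ s)%:E.
have bF : borel_mx F by move=> d0 T0 X mX; exact: mD.
rewrite (integral_gaussian_col_mx GA bF); last by move=> X; rewrite lee_fin powR_ge0.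
have Gu := gaussian_usubmx GA; have Gd := gaussian_dsubmx GA.
have inner w : (\int[P]_w' F (col_mx (usubmx (A w')) (dsubmx (A w))) =
    (gamma_ratio s (N - p))%:E * ((complex.Re (\det (dsubmx (A w) *m (dsubmx (A w)) ^t*))) `^ s)%:E)%E.
  set X := dsubmx (A w).
  (* If the lower rows are dependent, both determinants vanish and [0^s = 0]; this pointwise case
     takes the place of almost sure invertibility. *)
  have [D0|D0] := eqVneq (\det (X *m X ^t*)) 0.
    rewrite D0 /= powR0 ?gt_eqF// mule0; apply: integral0_eq => w' _.
    by rewrite /F det_gram_col_mx_singular//= powR0// gt_eqF.
  have D0' := det_gramT_ge0 X.
  have pP : psdmx (row_coprojmx X) by rewrite row_coprojmx_gram//; exact: psdmx_gram.
  have E w' : F (col_mx (usubmx (A w')) X) =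
     (((complex.Re (\det (X *m X ^t*))) `^ s)%:E * ((formmx (row_coprojmx X) (usubmx (A w'))) `^ s)%:E)%E.
    rewrite /F det_gram_col_mx// complex_ReM_ge0// powRM ?formmx_ge0//.
    exact: complex_Re_ge0.
  under eq_integral do rewrite E.
  rewrite ge0_integralZl//; last 3 first.
  - apply/measurable_EFinP; apply: (measurableT_comp (measurable_powR s)).
    by apply: measurable_formmx; exact: gaussian_mx_measurable Gu.
  - by move=> x _; rewrite lee_fin powR_ge0.
  - by rewrite lee_fin powR_ge0.
  have Np : (N - p)%N = (N - p).-1.+1 by rewrite prednK// subn_gt0.
  rewrite (@gaussian_row_gamma_moment _ _ (row_coprojmx X) (N - p).-1)//.
    by rewrite muleC -Np.
  move=> t t0; rewrite det_1addZ_row_coprojmx ?(ltnW pN)// -?Np//.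
  by rewrite gt_eqF// ltr_pwDl// ler0c.
under eq_integral do rewrite inner.
rewrite ge0_integralZl//; last 3 first.
- by apply: mD; exact: gaussian_mx_measurable Gd.
- by move=> x _; rewrite lee_fin powR_ge0.
- by rewrite lee_fin gamma_ratio_ge0 ?(ltW s0)// subn_gt0.
by rewrite (IH _ (ltnW pN) Gd) -EFinM big_ord_recr/= mulrC.
Qed.

(* Both sides are moments of an affine function of a Hermitian form whose Laplace transform
   only depends on [\adj S *m (B ^t* *m B)]. *)
Lemma gaussian_gram_row_replace (s : R) n m (B : 'M[R[i]]_(n, m)) (C S : 'M[R[i]]_m)
    d (T : measurableType d) (P : probability T R) (q : T -> 'rV[R[i]]_n)
    d' (T' : measurableType d') (P' : probability T' R) (g : T' -> 'rV[R[i]]_m) :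
  0 < s < 1 -> C ^t* *m C = B ^t* *m B -> gaussian_mx P q -> gaussian_mx P' g -> psdmx S ->
  (\int[P]_w ((complex.Re (\det (S + (q w *m B) ^t* *m (q w *m B)))) `^ s)%:E =
   \int[P']_w ((complex.Re (\det (S + (g w *m C) ^t* *m (g w *m C)))) `^ s)%:E)%E.
Proof.
move=> s01 CB Gq Gg pS; have dS := psdmx_det_ge0 pS.
have fE k (D : 'M[R[i]]_(k, m)) (x : 'rV[R[i]]_k) :
   complex.Re (\det (S + (x *m D) ^t* *m (x *m D))) =
   complex.Re (\det S) + formmx (D *m \adj S *m D ^t*) x.
  by rewrite det_gram_row complex_ReD.
under eq_integral do rewrite fE.
under [RHS]eq_integral do rewrite fE.
apply: (eq_gaussian_row_moment Gq Gg (psdmx_adj_congr B pS) (psdmx_adj_congr C pS) _ s01).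
  exact: complex_Re_ge0.
move=> t; have EB := det_1addZ_adj_congr S B (real_complex R t).
have EC := det_1addZ_adj_congr S C (real_complex R t).
rewrite -CB -EC in EB.
exact: EB.
Qed.

(** Induction on the number of rows. The top row of [Q] is replaced while the lower ones are frozen;
    Tonelli then freezes the new row instead, and its Gram matrix joins [S]. This is why [S] is
    arbitrary. *)
Lemma gaussian_gram_replace (s : R) n m (B : 'M[R[i]]_(n, m)) (C : 'M[R[i]]_m) :
  0 < s < 1 -> C ^t* *m C = B ^t* *m B -> forall N
    d (T : measurableType d) (P : probability T R) (Q : T -> 'M[R[i]]_(N, n))
    d' (T' : measurableType d') (P' : probability T' R) (G : T' -> 'M[R[i]]_(N, m)) (S : 'M[R[i]]_m),
  gaussian_mx P Q -> gaussian_mx P' G -> psdmx S ->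
  (\int[P]_w ((complex.Re (\det (S + (Q w *m B) ^t* *m (Q w *m B)))) `^ s)%:E =
   \int[P']_w ((complex.Re (\det (S + (G w *m C) ^t* *m (G w *m C)))) `^ s)%:E)%E.
Proof.
move=> s01 CB N d T P Q d' T' P'; elim: N => [|N IH] in Q * => G S GQ GG pS.
  have Z k (X : 'M[R[i]]_(0, k)) : S + (X *m (0 : 'M[R[i]]_(k, m))) ^t* *m (X *m (0 : 'M[R[i]]_(k, m))) = S.
    by rewrite mulmx0 mulmx0 addr0.
  have Z' k (X : 'M[R[i]]_(0, k)) (D : 'M[R[i]]_(k, m)) : S + (X *m D) ^t* *m (X *m D) = S.
    by rewrite (flatmx0 (X *m D)) mulmx0 addr0.
  under eq_integral do rewrite Z'.
  under [RHS]eq_integral do rewrite Z'.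
  by rewrite !integral_prob_cst.
rewrite -[N.+1]/(1 + N)%N in Q G GQ GG *.
pose FF k (D : 'M[R[i]]_(k, m)) (X : 'M[R[i]]_(1 + N, k)) :=
  ((complex.Re (\det (S + (X *m D) ^t* *m (X *m D)))) `^ s)%:E.
have bFF k D : borel_mx (@FF k D).
  move=> d0 T0 X mX; apply: (measurable_det_shift_gram (S := fun=> S)) => //.
  exact: measurable_mx_cst.
have FF0 k D X : (0 <= @FF k D X)%E by rewrite lee_fin powR_ge0.
have FFE k D (x : 'rV[R[i]]_k) (X : 'M[R[i]]_(N, k)) : @FF k D (col_mx x X) =
   ((complex.Re (\det ((S + (X *m D) ^t* *m (X *m D)) + (x *m D) ^t* *m (x *m D)))) `^ s)%:E.
  rewrite /FF mul_col_mx tr_col_mx map_row_mx mul_row_col.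
  by rewrite (addrC (_ *m (x *m D))) addrA.
rewrite (integral_gaussian_col_mx GQ (bFF n B))//.
rewrite (integral_gaussian_col_mx GG (bFF m C))//.
have GQu := gaussian_usubmx GQ; have GQd := gaussian_dsubmx GQ.
have GGu := gaussian_usubmx GG; have GGd := gaussian_dsubmx GG.
have step1 w : (\int[P]_w' FF n B (col_mx (usubmx (Q w')) (dsubmx (Q w))) =
   \int[P']_w' ((complex.Re (\det ((S + (dsubmx (Q w) *m B) ^t* *m (dsubmx (Q w) *m B))
      + (usubmx (G w') *m C) ^t* *m (usubmx (G w') *m C)))) `^ s)%:E)%E.
  under eq_integral do rewrite FFE.
  have pS' := psdmxD pS (psdmx_gram (dsubmx (Q w) *m B)).
  exact: (gaussian_gram_row_replace s01 CB GQu GGu pS').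
under eq_integral do rewrite step1.
have mQd := gaussian_mx_measurable GQd; have mGu := gaussian_mx_measurable GGu.
have mGd := gaussian_mx_measurable GGd.
have mgram d0 (T0 : measurableType d0) p k (X : T0 -> 'M[R[i]]_(p, k)) (D : 'M[R[i]]_(k, m)) :
   measurable_mx X -> measurable_mx (fun w => S + (X w *m D) ^t* *m (X w *m D)).
  move=> mX; apply: measurable_mxD; first exact: measurable_mx_cst.
  have mXD : measurable_mx (fun w => X w *m D) by apply: measurable_mulmx => //; exact: measurable_mx_cst.
  by apply: measurable_mulmx => //; exact: measurable_trmxC.
have mfst d1 (T1 : measurableType d1) d2 (T2 : measurableType d2) p k (X : T1 -> 'M[R[i]]_(p, k)) :
   measurable_mx X -> measurable_mx (fun z : T1 * T2 => X z.1).
  by move=> mX i j; exact: (measurableT_comp (mX i j) measurable_fst).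
have msnd d1 (T1 : measurableType d1) d2 (T2 : measurableType d2) p k (X : T2 -> 'M[R[i]]_(p, k)) :
   measurable_mx X -> measurable_mx (fun z : T1 * T2 => X z.2).
  by move=> mX i j; exact: (measurableT_comp (mX i j) measurable_snd).
pose f (z : T * T') : \bar R := ((complex.Re (\det ((S + (dsubmx (Q z.1) *m B) ^t* *m (dsubmx (Q z.1) *m B))
      + (usubmx (G z.2) *m C) ^t* *m (usubmx (G z.2) *m C)))) `^ s)%:E.
have mf : measurable_fun setT f.
  apply: measurable_det_shift_gram; last exact: (msnd _ _ _ _ _ _ _ mGu).
  by apply: (mgram _ _ _ _ (fun z : T * T' => dsubmx (Q z.1))); exact: (mfst _ _ _ _ _ _ _ mQd).
have f0 z : (0 <= f z)%E by rewrite lee_fin powR_ge0.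
rewrite [LHS](@fubini_tonelli _ _ T T' R P P' f mf f0).
pose g (z : T' * T') : \bar R := FF m C (col_mx (usubmx (G z.2)) (dsubmx (G z.1))).
have mg : measurable_fun setT g.
  apply: bFF; apply: measurable_col_mx; first exact: (msnd _ _ _ _ _ _ _ mGu).
  exact: (mfst _ _ _ _ _ _ _ mGd).
have g0 z : (0 <= g z)%E by rewrite FF0.
(* The right-hand side is put in the same order: the top row of [G] outside, the lower rows
   inside. *)
rewrite [RHS](@fubini_tonelli _ _ T' T' R P' P' g mg g0).
apply: eq_integral => w' _; rewrite /f /g /=.
set U := (usubmx (G w') *m C) ^t* *m _.
have pU := psdmxD pS (psdmx_gram (usubmx (G w') *m C)).
have AC (X : 'M[R[i]]_m) : S + X + U = (S + U) + X by rewrite addrAC.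
under eq_integral do rewrite AC.
under [RHS]eq_integral do rewrite FFE AC.
exact: IH.
Qed.

Lemma gaussian_gram_moment (s : R) N n m (B : 'M[R[i]]_(n, m))
    d (T : measurableType d) (P : probability T R) (Q : T -> 'M[R[i]]_(N, n)) :
  0 < s < 1 -> (m <= n)%N -> (m <= N)%N -> gaussian_mx P Q ->
  (\int[P]_w (gram_power s (Q w *m B))%:E =
   (gram_power s B * \prod_(i < m) gamma_ratio s (N - i))%:E)%E.
Proof.
move=> s01 mn mN GQ.
have [C CB] := psdmx_sqrt (psdmx_gram B).
(* The first [m] columns of [Q] provide a Gaussian matrix of the required size on the same
   probability space. *)
pose G w : 'M[R[i]]_(N, m) := mxsub id (widen_ord mn) (Q w).
have GG : gaussian_mx P G.
  apply: gaussian_mxsub => // i j /(congr1 val) /= ij; exact: val_inj.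
have E0 p k (X : 'M[R[i]]_(p, k)) (D : 'M[R[i]]_(k, m)) :
   gram_power s (X *m D) = (complex.Re (\det (0 + (X *m D) ^t* *m (X *m D)))) `^ s.
  by rewrite /gram_power add0r.
under eq_integral do rewrite E0.
rewrite (gaussian_gram_replace s01 CB GQ GG (@psdmx0 _ m)).
under eq_integral do rewrite -E0.
have dB := det_gram_ge0 B.
have E w : (gram_power s (G w *m C))%:E =
   ((gram_power s B)%:E * ((complex.Re (\det ((G w)^T *m ((G w)^T) ^t*))) `^ s)%:E)%E.
  have dG := det_gramT_ge0 (G w)^T.
  rewrite /gram_power (det_gram_mul_sqrt (G w) CB) (complex_ReM_ge0 _ dB).
  by rewrite (powRM s (complex_Re_ge0 dB) (complex_Re_ge0 dG)).
under eq_integral do rewrite E.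
have GT := gaussian_mx_tr GG.
rewrite ge0_integralZl//; last 3 first.
- apply/measurable_EFinP; apply: (measurableT_comp (measurable_powR s)).
  have mT := gaussian_mx_measurable GT.
  by apply: measurable_Re; apply: measurable_det; apply: measurable_mulmx => //; exact: measurable_trmxC.
- by move=> w _; rewrite lee_fin powR_ge0.
- by rewrite lee_fin powR_ge0.
by rewrite (gaussian_gramT_moment s01 mN GT) EFinM.
Qed.

End gram_moments.

(** * Moments of the Gram determinant of a product channel *)

Section channel_moments.
Context {R : realType}.
Variable N : nat -> nat.

(** [channel_matrix] for deterministic factors, so that the product becomes a function of the family
    of entries, as [integral_decouple] requires. *)
Fixpoint matrix_chain (q : forall k : nat, 'M[R[i]]_(N k.+1, N k)) (K : nat) :
    'M[R[i]]_(N K, N 0%N) :=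
  if K is k.+1 then q k *m matrix_chain q k else 1%:M.

Lemma eq_matrix_chain q q' K : (forall k, (k < K)%N -> q k = q' k) ->
  matrix_chain q K = matrix_chain q' K.
Proof.
elim: K => //= K IH E; rewrite (E K (ltnSn K)) IH// => k kK; exact/E/ltnW.
Qed.

Lemma channel_matrixE d (T : measurableType d) (Q : forall k, T -> 'M[R[i]]_(N k.+1, N k)) K w :
  channel_matrix Q K w = matrix_chain (fun k => Q k w) K.
Proof. by elim: K => //= K ->. Qed.

(* Outside the range [k < K] the matrix has no entry in the family and is set to 0. *)
Definition mx_of_family K (z : entry_index K N -> R[i]) (k : nat) : 'M[R[i]]_(N k.+1, N k) :=
  match pselect (k < K)%N with
  | left h => \matrix_(i, j) z (Tagged (fun k : 'I_K => ('I_(N k.+1) * 'I_(N k))%type)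
                                     (i := Ordinal h) (i, j))
  | right _ => 0
  end.

Lemma mx_of_familyE K (z : entry_index K N -> R[i]) k (q : 'M[R[i]]_(N k.+1, N k)) : (k < K)%N ->
  (forall (h : (k < K)%N) i j, z (Tagged (fun k : 'I_K => ('I_(N k.+1) * 'I_(N k))%type)
                                     (i := Ordinal h) (i, j)) = q i j) ->
  mx_of_family z k = q.
Proof.
move=> kK E; rewrite /mx_of_family; case: pselect => // h.
by apply/matrixP => i j; rewrite mxE E.
Qed.

Section measurability.
Context {d : measure_display} {T : measurableType d}.

Lemma measurable_mx_of_family K (Z : entry_index K N -> T -> R[i]) k :
  (forall e, complex_random_variable (Z e)) ->
  measurable_mx (fun w => mx_of_family (fun e => Z e w) k).
Proof.
move=> mZ i j; rewrite /mx_of_family; case: pselect => h.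
  by under eq_fun do rewrite mxE; exact: mZ.
by under eq_fun do rewrite mxE; exact: complex_random_variable_cst.
Qed.

Lemma measurable_matrix_chain K (Q : forall k, T -> 'M[R[i]]_(N k.+1, N k)) :
  (forall k, (k < K)%N -> measurable_mx (Q k)) ->
  measurable_mx (fun w => matrix_chain (fun k => Q k w) K).
Proof.
elim: K => [|K IH] mQ /=; first exact: measurable_mx_cst.
apply: measurable_mulmx; first exact: mQ.
by apply: IH => k kK; apply: mQ; exact: ltnW.
Qed.

Lemma measurable_gram_power m n (s : R) (X : T -> 'M[R[i]]_(m, n)) :
  measurable_mx X -> measurable_fun setT (fun w => gram_power s (X w)).
Proof.
move=> mX; apply: (measurableT_comp (measurable_powR s)).
apply: measurable_Re; apply: measurable_det; apply: measurable_mulmx => //.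
exact: measurable_trmxC.
Qed.

End measurability.

Section rayleigh.
Context {d : measure_display} {T : measurableType d}.
Variables (P : probability T R) (Q : forall k, T -> 'M[R[i]]_(N k.+1, N k)).

Lemma rayleigh_gaussian_mx K k : (k < K)%N -> is_rayleigh_product_channel P K Q ->
  gaussian_mx P (Q k).
Proof.
move=> kK rQ.
pose f (e : 'I_(N k.+1) * 'I_(N k)) : entry_index K N :=
  Tagged (fun k : 'I_K => ('I_(N k.+1) * 'I_(N k))%type) (i := Ordinal kK) e.
have fI : injective f by move=> e e' /eqP; rewrite /f eq_Tagged => /eqP.
exact: (gaussian_family_reindex fI rQ).
Qed.

Lemma rayleigh_product_channel_pred K :
  is_rayleigh_product_channel P K.+1 Q -> is_rayleigh_product_channel P K Q.
Proof.
move=> rQ.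
pose f (e : entry_index K N) : entry_index K.+1 N :=
  Tagged (fun k : 'I_K.+1 => ('I_(N k.+1) * 'I_(N k))%type)
    (i := widen_ord (leqnSn K) (tag e)) (tagged e).
have fI : injective f.
  case=> [k x] [k' x'] E.
  have kk' : k = k' by apply: val_inj; exact: (congr1 (fun e => val (tag e)) E).
  subst k'; move/eqP: E; rewrite /f eq_Tagged/= => /eqP -> //.
exact: (gaussian_family_reindex fI rQ).
Qed.

Lemma rayleigh_measurable K : is_rayleigh_product_channel P K Q ->
  measurable_mx (fun w => channel_matrix Q K w).
Proof.
move=> rQ; under eq_fun do rewrite channel_matrixE.
apply: measurable_matrix_chain => k kK.
exact/gaussian_mx_measurable/(rayleigh_gaussian_mx kK rQ).
Qed.

(** Induction on the number of factors: the entries of the last factor are drawn with all others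
    frozen, so that [gaussian_gram_moment] applies with [B] the product of the earlier factors. The
    minimality of [N 0] gives its two size conditions. *)
Lemma rayleigh_gram_moment K (s : R) : 0 < s < 1 ->
  (forall k, (k <= K)%N -> (N 0 <= N k)%N) -> is_rayleigh_product_channel P K Q ->
  (\int[P]_w (gram_power s (channel_matrix Q K w))%:E =
   (\prod_(k < K) \prod_(i < N 0) gamma_ratio s (N k.+1 - i))%:E)%E.
Proof.
move=> s01; elim: K => [|K IH] N0 rQ.
  rewrite big_ord0 -[RHS](integral_prob_cst P); apply: eq_integral => w _.
  by rewrite /gram_power /= mulmx1 trmx1 map_mx1 det1 /= powR1.
pose F (z : entry_index K.+1 N -> R[i]) : \bar R :=
  (gram_power s (matrix_chain (mx_of_family z) K.+1))%:E.
have bF : borel_functional F.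
  move=> d0 T0 Z mZ; apply/measurable_EFinP; apply: measurable_gram_power.
  by apply: measurable_matrix_chain => k _; exact: measurable_mx_of_family.
have F0 z : (0 <= F z)%E by rewrite lee_fin powR_ge0.
have FE w : (gram_power s (channel_matrix Q K.+1 w))%:E = F (fun e => entry Q e w).
  rewrite /F channel_matrixE; congr (gram_power s _)%:E.
  by apply: eq_matrix_chain => k kK; apply/esym/mx_of_familyE.
under eq_integral do rewrite FE.
rewrite (integral_decouple [set e : entry_index K.+1 N | tag e == ord_max]%SET rQ rQ bF F0).
have inner w : (\int[P]_w' F (fun e => if e \in [set e : entry_index K.+1 N | tag e == ord_max]%SET
     then entry Q e w' else entry Q e w) =
   (\prod_(i < N 0) gamma_ratio s (N K.+1 - i))%:E * (gram_power s (channel_matrix Q K w))%:E)%E.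
  have E w' : F (fun e => if e \in [set e : entry_index K.+1 N | tag e == ord_max]%SET
     then entry Q e w' else entry Q e w) = (gram_power s (Q K w' *m channel_matrix Q K w))%:E.
    set z := fun e => _.
    have zK : mx_of_family z K = Q K w'.
      by apply: mx_of_familyE => // h i j; rewrite /z inE/= -val_eqE/= eqxx.
    have zk : matrix_chain (mx_of_family z) K = channel_matrix Q K w.
      rewrite channel_matrixE; apply: eq_matrix_chain => k kK.
      by apply: mx_of_familyE => [|h i j]; [exact: ltnW|rewrite /z inE/= -val_eqE/= ltn_eqF].
    by rewrite -zK -zk.
  under eq_integral do rewrite E.
  rewrite (gaussian_gram_moment _ s01 _ _ (rayleigh_gaussian_mx (ltnSn K) rQ)) ?N0//.
  by rewrite -EFinM mulrC.
under eq_integral do rewrite inner.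
have rQ' := rayleigh_product_channel_pred rQ.
rewrite ge0_integralZl//; last 3 first.
- by apply/measurable_EFinP; apply: measurable_gram_power; exact: rayleigh_measurable.
- by move=> w _; rewrite lee_fin powR_ge0.
- rewrite lee_fin prodr_ge0// => i _; apply: gamma_ratio_ge0; first by case/andP: s01 => /ltW.
  by rewrite subn_gt0 (leq_trans (ltn_ord i))// N0.
rewrite IH//; last by move=> k kK; exact/N0/leqW.
by rewrite -EFinM [in RHS]big_ord_recr/= mulrC.
Qed.

End rayleigh.
End channel_moments.

(** * Logarithmic moments as limits of fractional moments *)

Section shifted_products.
Context {R : realType}.
Implicit Types (x y s t : R).

(** For [z = x] and [z = y] the ratio [z / (x + y)] is at most 1, hence at most its power of
    exponent [s <= 1]; the two ratios add up to 1. *)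
Lemma powR_subadditive x y s : 0 <= x -> 0 <= y -> 0 < s -> s <= 1 ->
  (x + y) `^ s <= x `^ s + y `^ s.
Proof.
move=> x0 y0 s0 s1.
have [xy0|xy0] := eqVneq (x + y) 0; first by rewrite xy0 powR0 ?gt_eqF// addr_ge0// powR_ge0.
have xyp : 0 < x + y by rewrite lt_neqAle eq_sym xy0 addr_ge0.
have H z : 0 <= z -> z <= x + y -> z / (x + y) * (x + y) `^ s <= z `^ s.
  move=> z0 zxy; have [->|zn0] := eqVneq z 0; first by rewrite mul0r mul0r powR_ge0.
  have zp : 0 < z / (x + y) by rewrite divr_gt0// lt_neqAle eq_sym zn0.
  have zK : z = z / (x + y) * (x + y) by rewrite mulfVK.
  have -> : z `^ s = (z / (x + y)) `^ s * (x + y) `^ s by rewrite -powRM ?(ltW zp) ?(ltW xyp)// -zK.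
  rewrite ler_wpM2r ?powR_ge0//.
  by apply: ger1_powR => //; rewrite zp ler_pdivrMr// mul1r.
have -> : (x + y) `^ s = x / (x + y) * (x + y) `^ s + y / (x + y) * (x + y) `^ s.
  by rewrite -mulrDl -mulrDl divff// mul1r.
by rewrite lerD// H// ?lerDl ?lerDr.
Qed.

Lemma powR_le1D x s s' : 0 <= x -> 0 <= s -> s <= s' -> x `^ s <= 1 + x `^ s'.
Proof.
move=> x0 s0 ss'; have [x1|x1] := leP x 1.
  have [->|xn0] := eqVneq x 0.
    by rewrite (le_trans (_ : _ <= 1)) ?lerDl ?powR_ge0// /powR eqxx lern1 leq_b1.
  have xp : 0 < x <= 1 by rewrite lt_neqAle eq_sym xn0 x0.
  rewrite (le_trans (ger_powR xp s0))// powRr0 lerDl; exact: powR_ge0.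
by rewrite (le_trans (ler_powR (ltW x1) ss'))// lerDr.
Qed.

Lemma shifted_prod_ge0 m (d : 'I_m -> R) t : (forall i, 0 <= d i) -> 0 <= t ->
  0 <= \prod_(i < m) (t + d i).
Proof. by move=> d0 t0; apply: prodr_ge0 => i _; rewrite addr_ge0. Qed.

Lemma shifted_prod_ge m (d : 'I_m -> R) t : (forall i, 0 <= d i) -> 0 <= t ->
  t ^+ m <= \prod_(i < m) (t + d i).
Proof.
move=> d0 t0; rewrite -[X in t ^+ X]card_ord -prodr_const.
by apply: ler_prod => i _; rewrite t0 lerDl d0.
Qed.

Lemma shifted_prod_le m (d : 'I_m -> R) t t' : (forall i, 0 <= d i) -> 0 <= t -> t <= t' ->
  \prod_(i < m) (t + d i) <= \prod_(i < m) (t' + d i).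
Proof. by move=> d0 t0 tt'; apply: ler_prod => i _; rewrite addr_ge0//= lerD2r. Qed.

(** The product is a polynomial in [t] with nonnegative coefficients, and [t^k <= t] on [[0, 1]] for
    [k >= 1]. *)
Lemma shifted_prod_affine m (d : 'I_m -> R) t : (forall i, 0 <= d i) -> 0 <= t <= 1 ->
  \prod_(i < m) (t + d i) <= \prod_(i < m) d i + t * \prod_(i < m) (1 + d i).
Proof.
move=> d0 /andP[t0 t1]; elim: m => [|m IH] in d d0 *; first by rewrite !big_ord0 mulr1 lerDl.
rewrite !big_ord_recl; have := IH (fun i => d (lift ord0 i)) (fun i => d0 _).
have : \prod_(i < m) (t + d (lift ord0 i)) <= \prod_(i < m) (1 + d (lift ord0 i)) by exact: shifted_prod_le.
have := d0 ord0; set A := \prod_(i < m) _; set B := \prod_(i < m) _; set D := \prod_(i < m) _.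
set e := d ord0 => e0 AB AD; rewrite mulrDl.
apply: (@le_trans _ _ (t * B + e * (D + t * B))).
  by rewrite lerD// ler_wpM2l.
by rewrite le_eqVlt; apply/orP; left; apply/eqP; ring.
Qed.

End shifted_products.

Section log_moments.
Context {R : realType}.
Implicit Types (y s e : R).

Lemma ln_le_subr1 y : 0 < y -> ln y <= y - 1.
Proof.
by move=> y0; have := @le_ln1Dx R (y - 1); rewrite addrCA subrr addr0 ltrBrDr addNr; apply.
Qed.

Lemma ln_le_powR_quotient y s : 0 < y -> 0 < s -> ln y <= (y `^ s - 1) / s.
Proof.
move=> y0 s0; rewrite ler_pdivlMr// mulrC -ln_powR.
exact/ln_le_subr1/powR_gt0.
Qed.

(* With [u = y `^ s], the error is [(u - 1) * ln y <= s * (ln y)^2 * max u 1]. *)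
Lemma powR_quotient_le y s : 0 < y -> 0 < s ->
  (y `^ s - 1) / s <= ln y + s * ((ln y) ^+ 2 * (1 + y `^ s)).
Proof.
move=> y0 s0; rewrite ler_pdivrMr//.
have u0 : 0 < y `^ s by exact: powR_gt0.
have L : y `^ s - 1 <= s * ln y * y `^ s.
  have /ln_le_subr1 : 0 < (y `^ s)^-1 by rewrite invr_gt0.
  rewrite lnV ?posrE// ln_powR => H.
  have := ler_wpM2r (ltW u0) H; rewrite mulrBl mulVf ?gt_eqF// mul1r mulNr => H'.
  by rewrite -lerN2 opprB.
have L' : s * ln y <= y `^ s - 1.
  by rewrite -ln_powR; exact: ln_le_subr1.
set u := y `^ s in u0 L L' *; set l := ln y in L L' *.
apply: (le_trans L).
suff : s * l * (u - 1) <= s * l * (s * l) * (1 + u) by lra.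
have [l0|l0] := leP 0 l.
  have sl0 : 0 <= s * l by rewrite mulr_ge0// ltW.
  rewrite -(mulrA (s * l) (s * l)) ler_wpM2l//; apply: (le_trans L).
  by rewrite ler_wpM2l// lerDr.
have sl0 : s * l < 0 by rewrite pmulr_rlt0.
rewrite -(mulrA (s * l) (s * l)) ler_wnM2l ?(ltW sl0)//; apply: le_trans L'.
by rewrite mulrDr mulr1 gerDl nmulr_rle0// ltW.
Qed.

(** With [z = y^e], the square is at most [(ln c)^2 + e^-2 z^2] and the other factor at most
    [2 + z]. The product has degree 3 in [z], whence the exponent [e * 3]; the bound is uniform in
    [s <= e]. *)
Lemma ln_sqr_powR_le c y s e : 0 < c -> c <= y -> 0 < e -> 0 < s -> s <= e ->
  (ln y) ^+ 2 * (1 + y `^ s) <= 3 * ((ln c) ^+ 2 + e ^- 2) * (1 + y `^ (e * 3)).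
Proof.
move=> c0 cy e0 s0 se; have y0 := lt_le_trans c0 cy.
have us := powR_le1D (ltW y0) (ltW s0) se.
rewrite powRrM powR_mulrn ?powR_ge0//.
have : ln y ^+ 2 <= ln c ^+ 2 + e ^- 2 * (y `^ e) ^+ 2.
  have [y1|y1] := leP 1 y.
    rewrite ler_wpDl ?sqr_ge0// -exprVn -exprMn lerXn2r ?nnegrE ?ln_ge0//.
      by rewrite mulr_ge0 ?powR_ge0// invr_ge0 ltW.
    by rewrite mulrC ler_pdivlMr// mulrC; exact: mulr_ln_le_powR.
  rewrite ler_wpDr//; first by rewrite mulr_ge0 ?sqr_ge0// invr_ge0 sqr_ge0.
  have ly : ln y <= 0 by rewrite ln_le0// ltW.
  have cly : ln c <= ln y by rewrite ler_ln ?posrE.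
  by rewrite -[leLHS]sqrrN -[leRHS]sqrrN lerXn2r ?nnegrE ?lerN2 ?oppr_ge0//; lra.
have u0 := powR_ge0 y s; have z0 := powR_ge0 y e.
have L0 := sqr_ge0 (ln y); have C0 := sqr_ge0 (ln c); have E0 : 0 <= e ^- 2 by rewrite invr_ge0 sqr_ge0.
move: us u0 z0 L0 C0 E0.
set u := y `^ s; set z := y `^ e; set L := ln y ^+ 2; set C := ln c ^+ 2; set E := e ^- 2.
move=> us u0 z0 L0 C0 E0 LCE.
have [z1 z2] : z <= 1 + z ^+ 3 /\ z ^+ 2 <= 1 + z ^+ 3.
  have [zl|zg] := leP z 1.
    have z3 : 0 <= z ^+ 3 by rewrite exprn_ge0.
    have z2 : z ^+ 2 <= 1 by rewrite expr_le1.
    by split; lra.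
  have z3 : z <= z ^+ 3 by rewrite ler_eXnr// ltW.
  have z23 : z ^+ 2 <= z ^+ 3 by rewrite ler_weXn2l// ltW.
  by split; lra.
apply: (@le_trans _ _ ((C + E * z ^+ 2) * (2 + z))).
  by apply: ler_pM => //; lra.
have H1 : C * z <= C + C * z ^+ 3 by have := ler_wpM2l C0 z1; rewrite mulrDr mulr1.
have H2 : E * z ^+ 2 <= E + E * z ^+ 3 by have := ler_wpM2l E0 z2; rewrite mulrDr mulr1.
have H3 : 0 <= C * z ^+ 3 by rewrite mulr_ge0// exprn_ge0.
have -> : (C + E * z ^+ 2) * (2 + z) = 2 * C + C * z + 2 * (E * z ^+ 2) + E * z ^+ 3 by ring.
have -> : 3 * (C + E) * (1 + z ^+ 3) = 3 * C + 3 * E + 3 * (C * z ^+ 3) + 3 * (E * z ^+ 3) by ring.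
lra.
Qed.

End log_moments.

Section log_limit.
Context {R : realType} {d : measure_display} {T : measurableType d}.
Variable P : probability T R.
Implicit Types (s t : R) (w : T).

Local Notation Ex f := (\int[P]_w (f w))%R.

Lemma integrable_prob_cst (c : R) : P.-integrable setT (EFin \o cst c).
Proof. exact: finite_measure_integrable_cst. Qed.

Lemma le_expectation_affine (f g : T -> R) (a b : R) :
  P.-integrable setT (EFin \o f) -> P.-integrable setT (EFin \o g) ->
  (forall w, f w <= a * g w + b) -> Ex f <= a * Ex g + b.
Proof.
move=> fi gi fg.
have ai : P.-integrable setT (EFin \o (fun w => a * g w)).
  have := integrableZl (@measurableT _ T) a gi.
  by apply: eq_integrable.
have bi := integrable_prob_cst b.
have abi : P.-integrable setT (EFin \o (fun w => a * g w + cst b w)).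
  by have := integrableD (@measurableT _ T) ai bi; apply: eq_integrable.
apply: (le_trans (le_Rintegral (@measurableT _ T) fi abi _)); first by move=> w _; exact: fg.
rewrite RintegralD// RintegralZl// Rintegral_cst//.
suff -> : fine (P setT) = 1 by rewrite mulr1.
exact: (congr1 fine (probability_setT P)).
Qed.

Variables (m : nat) (Y : R -> T -> R) (s0 : R) (M : R -> R) (l : R).
Hypothesis Y_prod : forall w, exists2 D : 'I_m -> R,
  forall i, 0 <= D i & forall t, Y t w = \prod_(i < m) (t + D i).
Hypothesis Y_meas : forall t, measurable_fun setT (Y t).
Hypothesis s0_gt0 : 0 < s0.
Hypothesis Y1_moment : (\int[P]_w (Y 1 w `^ s0)%:E < +oo)%E.
Hypothesis Y0_moment : forall s, 0 < s < 1 -> (\int[P]_w (Y 0 w `^ s)%:E = (M s)%:E)%E.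
Hypothesis M_quotient : (M s - 1) / s @[s --> 0^'+] --> l.

Let Y_ge0 t w : 0 <= t -> 0 <= Y t w.
Proof. by move=> t0; have [D D0 ->] := Y_prod w; exact: shifted_prod_ge0. Qed.

Let Y_ge t w : 0 <= t -> t ^+ m <= Y t w.
Proof. by move=> t0; have [D D0 ->] := Y_prod w; exact: shifted_prod_ge. Qed.

Let Y_le t t' w : 0 <= t -> t <= t' -> Y t w <= Y t' w.
Proof. by move=> t0 tt'; have [D D0 E] := Y_prod w; rewrite !E; exact: shifted_prod_le. Qed.

Let Y_affine t w : 0 <= t <= 1 -> Y t w <= Y 0 w + t * Y 1 w.
Proof.
move=> t01; have [D D0 E] := Y_prod w; rewrite !E.
have -> : \prod_(i < m) (0 + D i) = \prod_(i < m) D i by apply: eq_bigr => i _; rewrite add0r.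
exact: shifted_prod_affine.
Qed.

Let Y_gt0 t w : 0 < t -> 0 < Y t w.
Proof. by move=> t0; apply: lt_le_trans (Y_ge w (ltW t0)); rewrite exprn_gt0. Qed.

Let meas_pow t s : measurable_fun setT (fun w => Y t w `^ s).
Proof. exact: measurableT_comp (measurable_powR s) (Y_meas t). Qed.

Let Y1i : P.-integrable setT (EFin \o (fun w => Y 1 w `^ s0)).
Proof.
apply/integrableP; split; first by apply/measurable_EFinP; exact: meas_pow.
under eq_integral do rewrite /= ger0_norm ?powR_ge0//.
exact: Y1_moment.
Qed.

Let YD1i (a b : R) : P.-integrable setT (EFin \o (fun w => a * Y 1 w `^ s0 + b)).
Proof.
have ai := integrableZl (@measurableT _ T) a Y1i.
by have := integrableD (@measurableT _ T) ai (integrable_prob_cst b); apply: eq_integrable.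
Qed.

Let powR_integrable t s : 0 <= t <= 1 -> 0 < s <= s0 ->
  P.-integrable setT (EFin \o (fun w => Y t w `^ s)).
Proof.
move=> /andP[t0 t1] /andP[sp ss0].
apply: (le_integrable measurableT _ _ (YD1i 1 1)) => [|w _].
  by apply/measurable_EFinP; exact: meas_pow.
rewrite /= lee_fin ger0_norm ?powR_ge0// ger0_norm ?addr_ge0 ?mulr_ge0 ?powR_ge0//.
rewrite mul1r addrC (le_trans _ (powR_le1D (Y_ge0 w ler01) (ltW sp) ss0))//.
by apply: ge0_ler_powR; rewrite ?nnegrE ?(ltW sp) ?Y_ge0// Y_le.
Qed.

(** [Y t >= t^m] bounds the logarithm below; [s0 * ln y <= y^s0] and [Y t <= Y 1] bound it above. *)
Lemma ln_shifted_integrable t : 0 < t <= 1 ->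
  P.-integrable setT (EFin \o (fun w => ln (Y t w))).
Proof.
move=> /andP[t0 t1].
apply: (le_integrable measurableT _ _ (YD1i s0^-1 `|ln (t ^+ m)|)) => [|w _].
  by apply/measurable_EFinP; exact: (measurableT_comp (@measurable_ln R) (Y_meas t)).
have y0 := Y_gt0 w t0.
rewrite /= lee_fin [leRHS]ger0_norm; last by rewrite addr_ge0// mulr_ge0 ?powR_ge0// invr_ge0 ltW.
have H1 : ln (Y t w) <= s0^-1 * Y 1 w `^ s0.
  rewrite mulrC ler_pdivlMr// mulrC; apply: (le_trans (mulr_ln_le_powR _ y0)) => //.
  by apply: ge0_ler_powR; rewrite ?nnegrE ?(ltW s0_gt0) ?Y_ge0 ?(ltW t0)// Y_le// ltW.
have H2 : ln (t ^+ m) <= ln (Y t w) by rewrite ler_ln ?posrE ?exprn_gt0// Y_ge// ltW.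
rewrite ler_norml; apply/andP; split; last by rewrite ler_wpDr.
rewrite opprD; apply: le_trans H2; rewrite (le_trans _ (lerNnormlW (lexx _)))//.
by rewrite gerDr oppr_le0 mulr_ge0 ?powR_ge0// invr_ge0 ltW.
Qed.

Let Ex_Y0 s : 0 < s < 1 -> Ex (fun w => Y 0 w `^ s) = M s.
Proof. by move=> s01; rewrite /Rintegral Y0_moment. Qed.

Let upper t s : 0 < t <= 1 -> 0 < s < 1 -> s <= s0 ->
  Ex (fun w => ln (Y t w)) <= (M s - 1) / s + t `^ s * (Ex (fun w => Y 1 w `^ s) / s).
Proof.
move=> t01 s01 ss0; have [t0 t1] := andP t01; have [sp s1] := andP s01.
have i0 : P.-integrable setT (EFin \o (fun w => Y 0 w `^ s)) by apply: powR_integrable; rewrite ?lexx ?sp ?ler01.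
have i1 : P.-integrable setT (EFin \o (fun w => Y 1 w `^ s)) by apply: powR_integrable; rewrite ?lexx ?sp ?ler01.
have i1' : P.-integrable setT (EFin \o (fun w => t `^ s * Y 1 w `^ s)).
  by have := integrableZl (@measurableT _ T) (t `^ s) i1; apply: eq_integrable.
have gi : P.-integrable setT (EFin \o (fun w => Y 0 w `^ s + t `^ s * Y 1 w `^ s)).
  by have := integrableD (@measurableT _ T) i0 i1'; apply: eq_integrable.
have := le_expectation_affine (a := s^-1) (b := - s^-1) (ln_shifted_integrable t01) gi.
rewrite RintegralD// RintegralZl// Ex_Y0// => H; apply: (le_trans (H _)) => [w|]; last first.
  by rewrite le_eqVlt; apply/orP; left; apply/eqP; ring.
have y0 := Y_gt0 w t0; apply: (le_trans (ln_le_powR_quotient y0 sp)).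
rewrite mulrC mulrBr mulr1 lerD2r ler_wpM2l ?invr_ge0 ?(ltW sp)//.
rewrite -powRM ?Y_ge0 ?(ltW t0)//; apply: le_trans; last first.
  by apply: powR_subadditive; rewrite ?mulr_ge0 ?Y_ge0 ?(ltW t0) ?(ltW s1).
by apply: ge0_ler_powR; rewrite ?nnegrE ?addr_ge0 ?mulr_ge0 ?Y_ge0 ?(ltW sp) ?(ltW t0)// Y_affine// t1 ltW.
Qed.

(** The error term comes from [ln_sqr_powR_le] with [e = s0 / 3], so that its exponent [3 e] is the
    available moment [s0]. The constant depends on [t] but not on [s]. *)
Let lower t s : 0 < t <= 1 -> 0 < s < 1 -> s <= s0 / 3 ->
  (M s - 1) / s <= Ex (fun w => ln (Y t w)) +
    s * (3 * ((ln (t ^+ m)) ^+ 2 + (s0 / 3) ^- 2) * (Ex (fun w => Y 1 w `^ s0) + 1)).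
Proof.
move=> t01 s01 ss0; have [t0 t1] := andP t01; have [sp s1] := andP s01.
have ss0' : s <= s0 by apply: (le_trans ss0); rewrite ler_pdivrMr// ler_peMr// ?ltW// ltr1n.
set C := 3 * _.
have i0 : P.-integrable setT (EFin \o (fun w => Y 0 w `^ s)) by apply: powR_integrable; rewrite ?lexx ?sp ?ler01.
have li := ln_shifted_integrable t01.
have gi' := YD1i (s * C) (s * C).
have gi : P.-integrable setT (EFin \o (fun w => ln (Y t w) + (s * C * Y 1 w `^ s0 + s * C))).
  by have := integrableD (@measurableT _ T) li gi'; apply: eq_integrable.
have ai : P.-integrable setT (EFin \o (fun w => s * C * Y 1 w `^ s0)).
  by have := integrableZl (@measurableT _ T) (s * C) Y1i; apply: eq_integrable.
have ci := integrable_prob_cst (s * C).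
have := le_expectation_affine (a := s) (b := 1) i0 gi.
rewrite Ex_Y0// RintegralD// => H.
have E : Ex (fun w => s * C * Y 1 w `^ s0 + s * C) <= s * C * Ex (fun w => Y 1 w `^ s0) + s * C.
  exact: le_expectation_affine.
rewrite ler_pdivrMr// lerBlDr; apply: (le_trans (H _)) => [w|]; last first.
  rewrite lerD2r mulrC ler_wpM2r ?(ltW sp)// lerD2l (le_trans E)//.
  by rewrite le_eqVlt; apply/orP; left; apply/eqP; ring.
have y0 := Y_gt0 w t0.
rewrite -lerBlDr -ler_pdivrMl// mulrC.
apply: (@le_trans _ _ ((Y t w `^ s - 1) / s)).
  rewrite ler_wpM2r ?invr_ge0 ?(ltW sp)// lerD2r.
  by apply: ge0_ler_powR; rewrite ?nnegrE ?Y_ge0 ?(ltW sp) ?(ltW t0)// Y_le// ltW.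
apply: (le_trans (powR_quotient_le y0 sp)); rewrite lerD2l.
have -> : s * C * Y 1 w `^ s0 + s * C = s * (C * (Y 1 w `^ s0 + 1)) by ring.
rewrite ler_wpM2l ?(ltW sp)//.
have e0 : 0 < s0 / 3 by rewrite divr_gt0.
apply: (le_trans (ln_sqr_powR_le (exprn_gt0 m t0) (Y_ge w (ltW t0)) e0 sp ss0)).
rewrite divfK// [Y 1 w `^ s0 + 1]addrC; apply: ler_wpM2l.
  by rewrite mulr_ge0// addr_ge0 ?sqr_ge0// invr_ge0 sqr_ge0.
rewrite lerD2l; apply: ge0_ler_powR; rewrite ?nnegrE ?Y_ge0 ?(ltW s0_gt0) ?(ltW t0)//.
by rewrite Y_le// ltW.
Qed.

(** [lower], with [t] fixed and [s] tending to 0, gives [l <= E ln Y_t] for every [t]. In [upper],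
    one [s] with quotient close to [l] is fixed first, and only then [t] tends to 0. *)
Lemma ln_shifted_cvg : Ex (fun w => ln (Y t w)) @[t --> 0^'+] --> l.
Proof.
have ge t : 0 < t <= 1 -> l <= Ex (fun w => ln (Y t w)).
  move=> t01; set C := 3 * ((ln (t ^+ m)) ^+ 2 + (s0 / 3) ^- 2) * (Ex (fun w => Y 1 w `^ s0) + 1).
  have cl : (M s - 1) / s - s * C @[s --> 0^'+] --> l - 0 * C.
    apply: cvgB => //; apply: cvgMr_tmp; exact: cvg_within_filter.
  rewrite mul0r subr0 in cl.
  apply: (ler_cvg_to cl (cvg_cst _)).
  near=> s; rewrite lerBlDr; apply: lower => //.
    by apply/andP; split; near: s; [exact: nbhs_right_gt|exact: nbhs_right_lt].
  by near: s; apply: nbhs_right_le; rewrite divr_gt0.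
apply/cvgrPdist_le => e e0.
have e20 : 0 < e / 2 by rewrite divr_gt0.
have [s [s01 ss0 Ms]] : exists s, [/\ 0 < s < 1, s <= s0 & (M s - 1) / s <= l + e / 2].
  apply: (@filter_ex _ (0^'+)); near=> s; split.
  - by apply/andP; split; near: s; [exact: nbhs_right_gt|exact: nbhs_right_lt].
  - by near: s; exact: nbhs_right_le.
  - near: s; have /cvgrPdist_le/(_ _ e20) := M_quotient; apply: filterS => s.
    by rewrite ler_distlC => /andP[].
have sp : 0 < s by case/andP: s01.
set C := Ex (fun w => Y 1 w `^ s) / s.
have tC : t `^ s * C @[t --> 0^'+] --> 0 * C by apply: cvgMr_tmp; exact: powR_cvg0.
rewrite mul0r in tC.
near=> t.
have t01 : 0 < t <= 1 by apply/andP; split; near: t; [exact: nbhs_right_gt|exact: nbhs_right_le].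
have tl : t `^ s * C <= e / 2.
  near: t; have /cvgrPdist_le/(_ _ e20) := tC; apply: filterS => t.
  by rewrite sub0r normrN => /(le_trans (ler_norm _)).
rewrite distrC ger0_norm ?subr_ge0 ?ge// lerBlDl.
by apply: (le_trans (upper t01 s01 ss0)); rewrite -/C; lra.
Unshelve. all: by end_near.
Qed.

End log_limit.

(** * High-SNR limit *)

Section gamma_ratio_derivative.
Context {R : realType}.

Lemma is_derive_gamma_ratio k : (0 < k)%N ->
  is_derive (0 : R) 1 (fun s : R => gamma_ratio s k) (digamma k%:R).
Proof.
move=> k0; have k0' : (0 : R) < k%:R by rewrite ltr0n.
have D := derivable_Gamma_fun k0'.
have E : (fun h : R => h^-1 *: (Gamma_fun (k%:R + (h *: 1 + 0)) - Gamma_fun (k%:R + 0 : R))) =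
         (fun h : R => h^-1 *: (Gamma_fun (h *: 1 + k%:R) - Gamma_fun (k%:R : R))).
  by apply/funext => h; rewrite !addr0 [k%:R + _]addrC.
have D1 : is_derive (0 : R) 1 (fun s : R => Gamma_fun (k%:R + s)) (derive1 Gamma_fun (k%:R : R)).
  apply: DeriveDef; first by rewrite /derivable E.
  by rewrite derive1E /derive E.
have := is_deriveZ (Gamma_fun k%:R)^-1 D1.
rewrite /digamma mulrC; congr is_derive.
by apply/funext => s /=; rewrite /gamma_ratio mulrC.
Qed.

Lemma gamma_ratio0 k : (0 < k)%N -> gamma_ratio (0 : R) k = 1.
Proof.
move=> k0; have k0' : (0 : R) < k%:R by rewrite ltr0n.
by rewrite /gamma_ratio addr0 divff// gt_eqF// Gamma_fun_gt0.
Qed.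

(** Leibniz rule: in each term the other factors equal 1 at 0. *)
Lemma is_derive_prod1 n (f : 'I_n -> R -> R) (l : 'I_n -> R) :
  (forall i, f i 0 = 1) -> (forall i, is_derive (0 : R) 1 (f i) (l i)) ->
  is_derive (0 : R) 1 (fun s => \prod_(i < n) f i s) (\sum_(i < n) l i).
Proof.
elim: n => [|n IH] in f l * => f1 fl.
  rewrite big_ord0; under eq_fun do rewrite big_ord0; exact: is_derive_cst.
rewrite big_ord_recr/=; under eq_fun do rewrite big_ord_recr/=.
have := IH _ _ (fun i => f1 (widen_ord (leqnSn n) i)) (fun i => fl (widen_ord (leqnSn n) i)).
move=> H; apply: (is_derive_eq (is_deriveM H (fl ord_max))).
rewrite f1 big1 => [|i _]; last exact: f1.
by rewrite !scale1r addrC.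
Qed.

Lemma cvg_difference_quotient (f : R -> R) (l : R) : is_derive (0 : R) 1 f l -> f 0 = 1 ->
  (f s - 1) / s @[s --> 0^'+] --> l.
Proof.
move=> [fd fl] f1.
have : h^-1 *: (f (h *: 1 + 0) - f 0) @[h --> 0^'] --> l by rewrite -fl; exact: fd.
rewrite (_ : (fun h => _) = (fun s => (f s - 1) / s)); last first.
  apply/funext => h; rewrite addr0 f1.
  by rewrite -[_ *: _]/(h^-1 * (f (h * 1) - 1)) mulr1 mulrC.
by move=> /cvg_dnbhs_at_right.
Qed.

Lemma cvg_gamma_product_quotient K m (N : nat -> nat) :
  (forall k, (k <= K)%N -> (m <= N k)%N) ->
  ((\prod_(k < K) \prod_(i < m) gamma_ratio s (N k.+1 - i)) - 1) / s @[s --> (0 : R)^'+] -->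
  \sum_(k < K) \sum_(i < m) digamma ((N k.+1 - i)%:R : R).
Proof.
move=> mN; have p (k : 'I_K) (i : 'I_m) : (0 < N k.+1 - i)%N.
  by rewrite subn_gt0 (leq_trans (ltn_ord i))// mN.
have E (k : 'I_K) : \prod_(i < m) gamma_ratio (0 : R) (N k.+1 - i) = 1.
  by rewrite big1// => i _; exact: gamma_ratio0.
apply: cvg_difference_quotient; last by rewrite big1.
apply: is_derive_prod1 => [//|k]; apply: is_derive_prod1 => i; first exact: gamma_ratio0.
exact: is_derive_gamma_ratio.
Qed.

End gamma_ratio_derivative.

(** * Polynomial bounds in the entries *)

Section poly_dominated.
Context {F : numDomainType} {T : Type}.
Variable b : T -> F.
Hypothesis b_ge2 : forall w, 2 <= b w.

(* As [b >= 2], a power of [b] also absorbs the constants arising from sums. *)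
Definition poly_dominated (Z : T -> F) := exists n : nat, forall w, `|Z w| <= b w ^+ n.

Let b_ge1 w : 1 <= b w.
Proof. by apply: le_trans (b_ge2 w); rewrite ler1n. Qed.

Lemma poly_dominated1 (Z : T -> F) : (forall w, `|Z w| <= 1) -> poly_dominated Z.
Proof. by move=> H; exists 0%N => w; rewrite expr0. Qed.

Lemma poly_dominatedD Z Z' : poly_dominated Z -> poly_dominated Z' ->
  poly_dominated (fun w => Z w + Z' w).
Proof.
move=> [n H] [n' H']; exists (maxn n n').+1 => w; apply: (le_trans (ler_normD _ _)).
have b0 : 0 <= b w by exact: le_trans (b_ge1 w).
rewrite exprS (le_trans (_ : _ <= 2 * b w ^+ maxn n n'))//; last by rewrite ler_wpM2r// exprn_ge0.
rewrite mulr_natl mulr2n lerD//.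
  by apply: (le_trans (H w)); rewrite ler_weXn2l// leq_maxl.
by apply: (le_trans (H' w)); rewrite ler_weXn2l// leq_maxr.
Qed.

Lemma poly_dominatedM Z Z' : poly_dominated Z -> poly_dominated Z' ->
  poly_dominated (fun w => Z w * Z' w).
Proof.
move=> [n H] [n' H']; exists (n + n')%N => w.
by rewrite normrM exprD ler_pM.
Qed.

Lemma poly_dominated_sum (J : Type) (r : seq J) (Z : J -> T -> F) :
  (forall j, poly_dominated (Z j)) -> poly_dominated (fun w => \sum_(j <- r) Z j w).
Proof.
move=> H; elim: r => [|j r IH].
  by apply: poly_dominated1 => w; rewrite big_nil normr0.
under eq_fun do rewrite big_cons; exact: poly_dominatedD.
Qed.

Lemma poly_dominated_prod (J : Type) (r : seq J) (Z : J -> T -> F) :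
  (forall j, poly_dominated (Z j)) -> poly_dominated (fun w => \prod_(j <- r) Z j w).
Proof.
move=> H; elim: r => [|j r IH].
  by apply: poly_dominated1 => w; rewrite big_nil normr1.
under eq_fun do rewrite big_cons; exact: poly_dominatedM.
Qed.

Definition poly_dominated_mx m n (A : T -> 'M[F]_(m, n)) :=
  forall i j, poly_dominated (fun w => A w i j).

Lemma poly_dominated_mx1 n : poly_dominated_mx (fun _ => 1%:M : 'M[F]_n).
Proof. by move=> i j; apply: poly_dominated1 => w; rewrite mxE normr_nat lern1 leq_b1. Qed.

Lemma poly_dominated_mxD m n (A B : T -> 'M[F]_(m, n)) :
  poly_dominated_mx A -> poly_dominated_mx B -> poly_dominated_mx (fun w => A w + B w).
Proof. by move=> hA hB i j; under eq_fun do rewrite mxE; exact: poly_dominatedD. Qed.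

Lemma poly_dominated_mulmx m n p (A : T -> 'M[F]_(m, n)) (B : T -> 'M[F]_(n, p)) :
  poly_dominated_mx A -> poly_dominated_mx B -> poly_dominated_mx (fun w => A w *m B w).
Proof.
move=> hA hB i j; under eq_fun do rewrite mxE.
by apply: poly_dominated_sum => k; exact: poly_dominatedM.
Qed.

Lemma poly_dominated_det n (A : T -> 'M[F]_n) :
  poly_dominated_mx A -> poly_dominated (fun w => \det (A w)).
Proof.
move=> hA; apply: poly_dominated_sum => s; apply: poly_dominatedM.
  by apply: poly_dominated1 => w; rewrite normrX normrN1 expr1n.
by apply: poly_dominated_prod => i; exact: hA.
Qed.

End poly_dominated.

Local Open Scope sesquilinear_scope.

Lemma poly_dominated_trmxC {F : numClosedFieldType} {T : Type} (b : T -> F) m n (A : T -> 'M[F]_(m, n)) :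
  poly_dominated_mx b A -> poly_dominated_mx b (fun w => (A w) ^t*).
Proof.
move=> hA i j; have [p H] := hA j i; exists p => w.
by rewrite !mxE norm_conjC.
Qed.

Lemma EFin_Rintegral {R : realType} d (T : measurableType d) (P : probability T R) (f : T -> R) :
  P.-integrable setT (EFin \o f) -> (\int[P]_w (f w)%:E = (\int[P]_w f w)%R%:E)%E.
Proof. by move=> fi; rewrite /Rintegral fineK//; exact: integrable_fin_num. Qed.

Lemma cvg_inv_at_right0 {R : realType} : (q : R)^-1 @[q --> +oo] --> 0^'+.
Proof.
move=> A [e /= e0 HA]; exists e^-1; split; first exact: num_real.
move=> q eq; have q0 : 0 < q by apply: lt_trans eq; rewrite invr_gt0.
apply: HA; last by rewrite /= invr_gt0.
by rewrite /= sub0r normrN gtr0_norm ?invr_gt0// invf_plt ?posrE.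
Qed.

Section gaussian_norm.
Context {R : realType} {d : measure_display} {T : measurableType d}.
Variable P : probability T R.
Local Open Scope sesquilinear_scope.

(** [|Z|] is the power [1/2] of [|Z|^2], the form of the identity matrix of size 1, so its mean is a
    fractional moment given by [gaussian_row_gamma_moment]. *)
Lemma gaussian_family_norm_integrable (I : finType) (Z : I -> T -> R[i]) i :
  gaussian_family P Z -> P.-integrable setT (EFin \o (fun w => complex.Re `|Z i w|)).
Proof.
move=> GZ.
have GM : gaussian_mx P (fun w => (\matrix_(_ < 1, _ < 1) Z i w : 'M[R[i]]_(1, 1))).
  have fI : injective (fun _ : 'I_1 * 'I_1 => i) by move=> [a b] [a' b'] _; rewrite !ord1.
  have := gaussian_family_reindex fI GZ; congr gaussian_family.
  by apply/funext => e; apply/funext => w; rewrite mxE.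
have E w : complex.Re `|Z i w| = formmx 1%:M (\matrix_(_ < 1, _ < 1) Z i w : 'M[R[i]]_(1, 1)) `^ 2^-1.
  rewrite /formmx mulmx1 !mxE big_ord1 !mxE -[Z i w * _]/(Z i w * (Z i w)^*) -normCK expr2.
  have z0 : 0 <= `|Z i w| by exact: normr_ge0.
  rewrite (complex_ReM_ge0 _ z0) -expr2 powR12_sqrt ?sqr_ge0// sqrtr_sqr.
  by rewrite [RHS]ger0_norm//; exact: complex_Re_ge0.
have mf : measurable_fun setT (fun w => formmx 1%:M (\matrix_(_ < 1, _ < 1) Z i w : 'M[R[i]]_(1, 1)) `^ 2^-1).
  apply: (measurableT_comp (measurable_powR _)); apply: measurable_formmx.
  exact: gaussian_mx_measurable GM.
rewrite (_ : (fun w => complex.Re _) = fun w => formmx 1%:M (\matrix_(_ < 1, _ < 1) Z i w : 'M[R[i]]_(1, 1)) `^ 2^-1); last exact/funext.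
apply/integrableP; split; first exact/measurable_EFinP.
under eq_integral do rewrite /= ger0_norm ?powR_ge0//.
rewrite (@gaussian_row_gamma_moment _ _ _ 0%N _ _ _ _ _ GM (@psdmx1 _ 1)) ?ltry//.
  by apply/andP; split; lra.
move=> t _; rewrite expr1 scalemx1 -scalar_mx_add det_scalar1 //.
Qed.

End gaussian_norm.

(** * High-SNR asymptotics of a single channel *)

Section rayleigh_asymptotics.
Context {R : realType} {d : measure_display} {T : measurableType d}.
Variables (P : probability T R) (N : nat -> nat) (K : nat).
Variable Q : forall k : nat, T -> 'M[R[i]]_(N k.+1, N k).
Hypothesis rQ : is_rayleigh_product_channel P K Q.
Hypothesis N0_min : forall k, (k <= K)%N -> (N 0 <= N k)%N.
Local Open Scope sesquilinear_scope.

Let H w : 'M[R[i]]_(N K, N 0) := channel_matrix Q K w.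

Definition shifted_det (t : R) (w : T) : R :=
  complex.Re (\det ((real_complex R t)%:M + H w ^t* *m H w)).

Lemma shifted_detE w : exists2 D : 'I_(N 0) -> R, forall i, 0 <= D i &
  forall t : R, shifted_det t w = \prod_(i < N 0) (t + D i).
Proof.
have [D D0 E] := psdmx_det_shift (psdmx_gram (H w)).
exists (fun i => complex.Re (D i)) => [i|t]; first exact: complex_Re_ge0.
rewrite /shifted_det E (eq_bigr (fun i => real_complex R (t + complex.Re (D i)))).
  by rewrite -rmorph_prod.
by move=> i _; rewrite rmorphD/= complex_Re_realK.
Qed.

Lemma measurable_shifted_det t : measurable_fun setT (shifted_det t).
Proof.
have mH := rayleigh_measurable rQ.
apply: measurable_Re; apply: measurable_det; apply: measurable_mxD.
  exact: measurable_mx_cst.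
by apply: measurable_mulmx => //; exact: measurable_trmxC.
Qed.

Lemma shifted_det0_moment (s : R) : 0 < s < 1 ->
  (\int[P]_w (shifted_det 0 w `^ s)%:E =
   (\prod_(k < K) \prod_(i < N 0) gamma_ratio s (N k.+1 - i))%:E)%E.
Proof.
move=> s01; rewrite -(rayleigh_gram_moment s01 N0_min rQ); apply: eq_integral => w _.
rewrite /shifted_det /gram_power (_ : (real_complex R 0)%:M = 0) ?add0r//.
by apply/matrixP => i j; rewrite !mxE mul0rn.
Qed.

Let b w : R[i] := 2 + \sum_(e : entry_index K N) `|entry Q e w|.

Let b_ge2 w : 2 <= b w.
Proof. by rewrite lerDl; apply: sumr_ge0 => e _; exact: normr_ge0. Qed.

Let entry_le_b (e : entry_index K N) w : `|entry Q e w| <= b w.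
Proof.
rewrite /b (bigD1 e)//= addrCA lerDl addr_ge0//.
by apply: sumr_ge0 => e' _; exact: normr_ge0.
Qed.

Lemma channel_poly_dominated k : (k <= K)%N ->
  poly_dominated_mx b (fun w => channel_matrix Q k w).
Proof.
elim: k => [|k IH] kK /=; first exact: poly_dominated_mx1.
apply: poly_dominated_mulmx => //; last exact/IH/ltnW.
move=> i j; exists 1%N => w; rewrite expr1.
exact: (entry_le_b (Tagged (fun k : 'I_K => ('I_(N k.+1) * 'I_(N k))%type) (i := Ordinal kK) (i, j))).
Qed.

(** The determinant is at most [beta^(n+1)], so its power [1 / (n + 1)] is at most [beta], which is
    integrable as a constant plus moduli of Gaussian entries. *)
Lemma shifted_det1_moment : exists2 s0 : R, 0 < s0 &
  (\int[P]_w (shifted_det 1 w `^ s0)%:E < +oo)%E.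
Proof.
have [n Hn] : poly_dominated b (fun w => \det (1%:M + H w ^t* *m H w)).
  apply: poly_dominated_det => //; apply: poly_dominated_mxD => //.
    exact: poly_dominated_mx1.
  have HH := channel_poly_dominated (leqnn K).
  by apply: poly_dominated_mulmx => //; exact: poly_dominated_trmxC.
pose beta w : R := 2 + \sum_(e : entry_index K N) complex.Re `|entry Q e w|.
have bE w : b w = real_complex R (beta w).
  by rewrite /b /beta rmorphD rmorph_sum rmorph_nat; congr (_ + _).
have beta1 w : 1 <= beta w.
  rewrite (le_trans (_ : _ <= 2)) ?ler1n// lerDl; apply: sumr_ge0 => e _.
  by apply: complex_Re_ge0; exact: normr_ge0.
have Y0 w : 0 <= shifted_det 1 w.
  by have [D D0 ->] := shifted_detE w; exact: shifted_prod_ge0.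
(* The degree is raised by one so that the exponent [1 / (n + 1)] makes sense even if [n = 0]. *)
have Yb w : shifted_det 1 w <= beta w ^+ n.+1.
  have dp : 0 <= \det (1%:M + H w ^t* *m H w).
    exact: psdmx_det_ge0 (psdmxD (psdmx1 _) (psdmx_gram (H w))).
  have := Hn w; rewrite ger0_norm// bE -rmorphXn/= -(complex_Re_realK dp) lecR => Hw.
  by rewrite exprS (le_trans Hw)// ler_peMl// exprn_ge0// (le_trans _ (beta1 w)).
exists n.+1%:R^-1; first by rewrite invr_gt0.
have beta0 w : 0 <= beta w by exact: le_trans (beta1 w).
have bi : P.-integrable setT (EFin \o beta).
  have si : P.-integrable setT (fun w => \sum_(e : entry_index K N) (complex.Re `|entry Q e w|)%:E)%E.
    by apply: integrable_sum => // e _; exact: (gaussian_family_norm_integrable e rQ).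
  have := integrableD (@measurableT _ T) (integrable_prob_cst P 2) si.
  by apply: eq_integrable => // w _; rewrite /= sumEFin.
have /integrableP[_ ] := bi; apply: le_lt_trans.
apply: ge0_le_integral => //.
- by move=> w _; rewrite lee_fin powR_ge0.
- apply/measurable_EFinP; exact: (measurableT_comp (measurable_powR _) (measurable_shifted_det 1)).
- by apply: measurableT_comp => //; case/integrableP: bi.
- move=> w _; rewrite /= lee_fin ger0_norm//.
  have -> : beta w = (beta w ^+ n.+1) `^ n.+1%:R^-1.
    by rewrite -powR_mulrn// -powRrM mulfV ?powRr1// pnatr_eq0.
  by apply: ge0_ler_powR; rewrite ?nnegrE ?invr_ge0 ?exprn_ge0.
Qed.

Let ln_integrable t : 0 < t <= 1 -> P.-integrable setT (EFin \o (fun w => ln (shifted_det t w))).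
Proof.
have [s0 s0p Hs0] := shifted_det1_moment.
exact: (ln_shifted_integrable shifted_detE measurable_shifted_det s0p Hs0).
Qed.

(** Factoring [q] out of a determinant of size [N 0] gives [q^(N 0)]; [q >= 1] puts the shift [q^-1]
    in the range where the logarithm is known to be integrable. *)
Lemma ergodic_capacity_shifted_det q : 1 <= q ->
  ergodic_capacity P K Q q = ((N 0)%:R * ln q + \int[P]_w ln (shifted_det q^-1 w))%R%:E.
Proof.
move=> q1; have q0 : 0 < q by exact: lt_le_trans q1.
have E w : ln (complex.Re (\det (1%:M + real_complex R q *: (H w ^t* *m H w)))) =
   (N 0)%:R * ln q + ln (shifted_det q^-1 w).
  have -> : 1%:M + real_complex R q *: (H w ^t* *m H w) =
     real_complex R q *: ((real_complex R q^-1)%:M + H w ^t* *m H w).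
    rewrite scalerDr scale_scalar_mx -rmorphM/= divff ?gt_eqF//.
  have qn0 : 0 <= real_complex R q ^+ N 0 by rewrite exprn_ge0// ler0c ltW.
  rewrite detZ (complex_ReM_ge0 _ qn0) -rmorphXn/= lnM ?posrE ?exprn_gt0//.
    by rewrite lnXn// mulr_natl.
  rewrite -/(shifted_det q^-1 w).
  have [D D0 ->] := shifted_detE w; apply: prodr_gt0 => i _.
  by rewrite ltr_pwDl ?invr_gt0.
rewrite /ergodic_capacity expectation.unlock; under eq_integral do rewrite E.
have li : P.-integrable setT (EFin \o (fun w => ln (shifted_det q^-1 w))).
  by apply: ln_integrable; rewrite invr_gt0 q0 invf_le1.
have ci := integrable_prob_cst P ((N 0)%:R * ln q).
rewrite EFin_Rintegral; last first.
  by have := integrableD (@measurableT _ T) ci li; apply: eq_integrable.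
rewrite RintegralD// Rintegral_cst//; congr (_ + _)%:E.
rewrite -[RHS]mulr1; congr (_ * _); exact: (congr1 fine (probability_setT P)).
Qed.

Lemma ln_shifted_det_cvg :
  (\int[P]_w ln (shifted_det q^-1 w))%R @[q --> +oo] -->
  \sum_(k < K) \sum_(i < N 0) digamma ((N k.+1 - i)%:R : R).
Proof.
have [s0 s0p Hs0] := shifted_det1_moment.
have C := ln_shifted_cvg shifted_detE measurable_shifted_det s0p Hs0 shifted_det0_moment
  (cvg_gamma_product_quotient N0_min).
exact: (cvg_comp _ _ cvg_inv_at_right0 C).
Qed.

End rayleigh_asymptotics.

(** With [l = i + 1], [N k - l + 1] becomes the natural number [N k - i], which is not truncated
    because [i < n <= N k]. *)
Lemma digamma_sum_shift {R : realType} K n (N : nat -> nat) :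
  (forall k, (k <= K)%N -> (n <= N k)%N) ->
  \sum_(1 <= k < K.+1) \sum_(1 <= l < n.+1) digamma ((N k)%:R - l%:R + 1 : R) =
  \sum_(k < K) \sum_(i < n) digamma ((N k.+1 - i)%:R : R).
Proof.
move=> nN; rewrite big_add1 big_mkord; apply: eq_bigr => k _.
rewrite big_add1 big_mkord; apply: eq_bigr => i _.
have iN : (i <= N k.+1)%N by apply: leq_trans (ltnW (ltn_ord i)) (nN _ (ltn_ord k)).
by rewrite natrB// -[i.+1%:R]natr1 opprD addrA subrK.
Qed.

(** Telescoping of [digammaS]; [l <= n] keeps every argument at least 1. *)
Lemma digamma_increment {R : realType} n l m : (l <= n)%N -> (0 < l)%N -> (n <= m)%N ->
  digamma (m%:R - l%:R + 1 : R) - digamma (n%:R - l%:R + 1) =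
  \sum_(n <= s < m) (s%:R - l%:R + 1)^-1.
Proof.
move=> ln l0; elim: m => [|m IH] nm.
  by move: nm; rewrite leqn0 => /eqP ->; rewrite subrr big_geq.
move: nm; rewrite leq_eqVlt => /predU1P[<-|]; first by rewrite subrr big_geq.
rewrite ltnS => nm; rewrite big_nat_recr//= -IH//.
have p0 : (0 : R) < m%:R - l%:R + 1 by rewrite ltr_wpDl// subr_ge0 ler_nat (leq_trans ln).
rewrite -[m.+1%:R]natr1 (_ : m%:R + 1 - l%:R + 1 = (m%:R - l%:R + 1) + 1); last by ring.
by rewrite digammaS// addrAC.
Qed.

Theorem mainTheorem4 (R : realType) (K : nat) (N : nat -> nat)
  (K_ge1 : (1 <= K)%N)
  (N_gt0 : forall k : nat, (k <= K)%N -> (0 < N k)%N)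
  (N0_min : forall k : nat, (k <= K)%N -> (N 0 <= N k)%N)
  (* a channel with parameters (N_0, N_1, ..., N_K) *)
  (d : measure_display) (T : measurableType d) (P : probability T R)
  (Q : forall k : nat, T -> 'M[R[i]]_(N k.+1, N k))
  (Q_rayleigh : is_rayleigh_product_channel P K Q)
  (* a channel with parameters (N_0, N_0, ..., N_0) *)
  (d' : measure_display) (T' : measurableType d') (P' : probability T' R)
  (Q' : nat -> T' -> 'M[R[i]]_(N 0%N, N 0%N))
  (Q'_rayleigh : @is_rayleigh_product_channel R d' T' P' K (fun=> N 0%N) Q') :
  let increment : R :=
    \sum_(1 <= k < K.+1) \sum_(1 <= l < (N 0%N).+1)
       digamma ((N k)%:R - l%:R + 1 : R)
    - \sum_(1 <= k < K.+1) \sum_(1 <= l < (N 0%N).+1)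
       digamma ((N 0%N)%:R - l%:R + 1 : R) in
  (ergodic_capacity P K Q q
     - @ergodic_capacity R d' T' P' K (fun=> N 0%N) Q' q)%E
    @[q --> +oo%R] --> increment%:E
  /\
  increment =
    \sum_(1 <= k < K.+1) \sum_(1 <= l < (N 0%N).+1)
      \sum_(N 0%N <= s < N k) (s%:R - l%:R + 1 : R)^-1.
Proof.
set increment := _ - _ => /=.
have N0' k : (k <= K)%N -> (N 0 <= N 0)%N by [].
split; last first.
  rewrite /increment -sumrB; apply: eq_big_nat => k /andP[k1 kK].
  rewrite -sumrB; apply: eq_big_nat => l /andP[l1 lN].
  by rewrite digamma_increment// N0_min.
rewrite /increment (digamma_sum_shift N0_min) (digamma_sum_shift N0').
have C := ln_shifted_det_cvg Q_rayleigh N0_min.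
have C' := ln_shifted_det_cvg Q'_rayleigh N0'.
pose L q := \int[P]_w ln (shifted_det K Q q^-1 w) - \int[P']_w ln (@shifted_det R d' T' (fun=> N 0%N) K Q' q^-1 w).
have CL : L q @[q --> +oo] -->
    \sum_(k < K) \sum_(i < N 0) digamma ((N k.+1 - i)%:R : R) -
    \sum_(k < K) \sum_(i < N 0) digamma ((N 0 - i)%:R : R).
  by apply: cvgB; [exact: C|exact: C'].
have : (L q)%:E @[q --> +oo] -->
    (\sum_(k < K) \sum_(i < N 0) digamma ((N k.+1 - i)%:R : R) -
     \sum_(k < K) \sum_(i < N 0) digamma ((N 0 - i)%:R : R))%:E.
  by apply: cvg_EFin; [exact: nearW|exact: CL].
(* For [q >= 1] both capacities are real and contain the same term [N_0 ln q], since the two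
   channels have equally many inputs; so their difference is eventually [L q]. *)
apply: cvg_trans; apply: near_eq_cvg; near=> q.
have q1 : 1 <= q by near: q; exact: nbhs_pinfty_ge.
rewrite (ergodic_capacity_shifted_det Q_rayleigh) // (ergodic_capacity_shifted_det Q'_rayleigh)//.
by rewrite -EFinB /L /=; congr _%:E; ring.
Unshelve. all: by end_near.
Qed.
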